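(* Let $H_{\mathbb R}$ be a real Hilbert space and $q\in(-1,1)$. The $C^*$-algebra $C_q^*(H_{\mathbb R})$ is weakly cp complemented in the von Neumann algebra $\Gamma_q(H_{\mathbb R})$; that is, there exists a unital completely positive map $\Phi:\Gamma_q(H_{\mathbb R})\to \big(C_q^*(H_{\mathbb R})\big)^{**}$ whose restriction to $C_q^*(H_{\mathbb R})$ is the identity (i.e. the canonical inclusion into the bidual).
   Context: Let $H_{\mathbb C}$ be the complexification of $H_{\mathbb R}$. The $q$-Fock space $\mathcal F_q(H_{\mathbb C})=\mathbb C\Omega\oplus\bigoplus_{n\ge1}H_{\mathbb C}^{\otimes n}$ is the Hilbert space completion of the algebraic direct sum of algebraic tensor powers for the inner product $\langle h_1\otimes\dots\otimes h_n,g_1\otimes\dots\otimes g_m\rangle_q=\delta_{n,m}\sum_{\pi\in S_n}q^{\mathrm{inv}(\pi)}\prod_{i=1}^n\langle h_i,g_{\pi(i)}\rangle$, where $\mathrm{inv}(\pi)$ is the number of inversions of $\pi$. For $h\in H_{\mathbb C}$, $a^*(h)$ is the bounded operator with $a^*(h)\Omega=h$, $a^*(h)(h_1\otimes\dots\otimes h_n)=h\otimes h_1\otimes\dots\otimes h_n$, and $a(h)$ is its adjoint. For $f\in H_{\mathbb R}$, $G(f)=a^*(f)+a(f)$. $C_q^*(H_{\mathbb R})$ and $\Gamma_q(H_{\mathbb R})$ are respectively the $C^*$-algebra and the von Neumann algebra generated by $\{G(f):f\in H_{\mathbb R}\}$ in $B(\mathcal F_q(H_{\mathbb C}))$. *)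

(* Defs.v *)
From HB Require Import structures.
From mathcomp Require Import all_boot all_order all_algebra perm complex ring lra.
From mathcomp Require Import boolp classical_sets functions reals topology.
From mathcomp Require Import normedtype.

Import Order.TTheory GRing.Theory Num.Theory.
Import numFieldNormedType.Exports.

Set Implicit Arguments.
Unset Strict Implicit.
Unset Printing Implicit Defensive.

Local Open Scope classical_set_scope.
Local Open Scope ring_scope.
Local Open Scope complex_scope.

(* Hilbert spaces over K, with the norm topology of the library.  [conj] is the
   identity when K is a real field and the conjugation when K = R[i].  Inner
   products are linear in their first argument. *)
HB.mixin Record isHilbert (K : numFieldType) (conj : K -> K) E
    & CompleteNormedModule K E := {
  inner : E -> E -> K;
  inner_linear : forall z, scalar (inner^~ z);
  inner_conj : forall x y, inner x y = conj (inner y x);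
  inner_norm : forall x, inner x x = `|x| ^+ 2 }.

#[short(type="hilbertType")]
HB.structure Definition Hilbert (K : numFieldType) (conj : K -> K) :=
  {E of CompleteNormedModule K E & isHilbert K conj E}.

Notation realHilbertType R := (@hilbertType R (@idfun R)).
Notation complexHilbertType R := (@hilbertType R[i] (@conjc R)).

Section blin.
Context {K : numFieldType} {V W : normedModType K}.

Definition is_blin : {pred V -> W} := fun f =>
  `[< linear f /\ exists M, forall x, `|f x| <= M * `|x| >].

Lemma is_blin_submod : GRing.submod_closed is_blin.
Proof.
split.
  apply/asboolP; split=> [a x y|]; first by rewrite /= scaler0 addr0.
  by exists 0 => x; rewrite mul0r normr0.
move=> a f g /asboolP[lf [M fM]] /asboolP[lg [N gN]]; apply/asboolP; split.
  move=> b x y /=; rewrite !fctE lf lg !scalerDr !scalerA (mulrC a b).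
  by rewrite addrACA.
exists (`|a| * M + N) => x; rewrite !fctE (le_trans (ler_normD _ _))// mulrDl.
by rewrite lerD// normrZ -mulrA ler_wpM2l.
Qed.

HB.instance Definition _ := GRing.isSubmodClosed.Build K (V -> W) is_blin
  is_blin_submod.

Record blin := Blin { blin_fun :> V -> W; blinP : blin_fun \in is_blin }.

HB.instance Definition _ := [isSub for blin_fun].
HB.instance Definition _ := [Choice of blin by <:].
HB.instance Definition _ := [SubChoice_isSubLmodule of blin by <:].
End blin.
Arguments blin {K} V W.
Arguments is_blin {K V W}.

Section blin_linear.
Context {K : numFieldType} {V W : normedModType K}.

Lemma blin_linear (T : blin V W) : linear T.
Proof. by have /asboolP[] := blinP T. Qed.

HB.instance Definition _ (T : blin V W) :=
  GRing.isLinear.Build K V W *:%R T (blin_linear T).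

Lemma blin_bounded (T : blin V W) : exists M, forall x, `|T x| <= M * `|x|.
Proof. by have /asboolP[] := blinP T. Qed.

Lemma blinW (T : blin V W) : exists2 M, 0 <= M & forall x, `|T x| <= M * `|x|.
Proof.
have [M TM] := blin_bounded T; exists `|M| => // x.
have [->|x0] := eqVneq x 0; first by rewrite linear0 !normr0 mulr0.
have M0 : 0 <= M by rewrite -(pmulr_lge0 _ (_ : 0 < `|x|)) ?normr_gt0// (le_trans _ (TM x)).
by rewrite ger0_norm.
Qed.

Lemma blin_ext (S T : blin V W) : (forall x, S x = T x) -> S = T.
Proof. by move=> ST; apply/val_inj/funext. Qed.

End blin_linear.

Section opnorm.
Context {R : realType} {V W : normedModType R[i]}.
Implicit Types S T : blin V W.

(* Norms over R[i] take values in R[i]: this is the usual real supremum, seen in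
   R[i]. *)
Definition opnorm T : R[i] :=
  (sup [set complex.Re `|T x| | x in [set x | `|x| <= 1]])%:C.

Lemma Re_norm (U : normedModType R[i]) (x : U) : (complex.Re `|x|)%:C = `|x|.
Proof. exact/RRe_real/normr_real. Qed.

Lemma opnorm_le T (M : R[i]) :
  (forall x, `|x| <= 1 -> `|T x| <= M) -> opnorm T <= M.
Proof.
move=> TM; have M0 : 0 <= M by rewrite (le_trans _ (TM 0 _))// normr0.
have Mr : (complex.Re M)%:C = M by apply/RRe_real/ger0_real.
rewrite -Mr lecR; apply: ge_sup => [|_ [x /= x1 <-]].
  by exists (complex.Re `|T 0|), 0 => //=; rewrite normr0.
by rewrite -lecR Re_norm Mr TM.
Qed.

Lemma opnorm_ub1 T x : `|x| <= 1 -> `|T x| <= opnorm T.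
Proof.
move=> x1; rewrite -[leLHS]Re_norm lecR; apply: ub_le_sup; last by exists x.
have [M M0 TM] := blinW T; have Mr : (complex.Re M)%:C = M by apply/RRe_real/ger0_real.
exists (complex.Re M) => _ [y /= y1 <-]; rewrite -lecR Re_norm Mr.
by rewrite (le_trans (TM y))// ler_piMr.
Qed.

Lemma opnorm_ge0 T : 0 <= opnorm T.
Proof. by rewrite (le_trans _ (@opnorm_ub1 T 0 _))// normr0. Qed.

Lemma opnormP T x : `|T x| <= opnorm T * `|x|.
Proof.
have [->|x0] := eqVneq x 0; first by rewrite linear0 !normr0 mulr0.
rewrite -ler_pdivrMr ?normr_gt0// mulrC.
have -> : `|x|^-1 * `|T x| = `|T (`|x|^-1 *: x)|.
  by rewrite linearZ normrZ normfV normr_id.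
by rewrite opnorm_ub1// normrZ normfV normr_id mulVf ?normr_eq0.
Qed.

Lemma opnormD S T : opnorm (S + T) <= opnorm S + opnorm T.
Proof.
apply: opnorm_le => x x1; rewrite (le_trans (ler_normD _ _))//.
by rewrite lerD// opnorm_ub1.
Qed.

Lemma opnormZ_le a T : opnorm (a *: T) <= `|a| * opnorm T.
Proof.
by apply: opnorm_le => x x1; rewrite normrZ ler_wpM2l// opnorm_ub1.
Qed.

Lemma opnormZ a T : opnorm (a *: T) = `|a| * opnorm T.
Proof.
apply/le_anti; rewrite opnormZ_le/=.
have [->|a0] := eqVneq a 0; first by rewrite normr0 mul0r opnorm_ge0.
rewrite -ler_pdivlMl ?normr_gt0// -normfV.
by rewrite -{1}[T](scalerK a0) opnormZ_le.
Qed.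

Lemma opnorm0_eq0 T : opnorm T = 0 -> T = 0.
Proof.
move=> T0; apply: blin_ext => x; apply/eqP; rewrite -normr_le0.
by rewrite (le_trans (opnormP T x))// T0 mul0r.
Qed.

HB.instance Definition _ :=
  Lmodule_isNormed.Build R[i] (blin V W) opnormD opnormZ opnorm0_eq0.

End opnorm.

Section blin_ring.
Context {R : realType} {V : normedModType R[i]}.
Implicit Types S T : blin V V.

Lemma blin_id_subproof : (@idfun V : V -> V) \in is_blin.
Proof.
apply/asboolP; split=> //; exists 1 => x; by rewrite mul1r.
Qed.
Definition blin_id : blin V V := Blin blin_id_subproof.

Lemma blin_comp_subproof S T : S \o T \in is_blin.
Proof.
apply/asboolP; split=> [a x y|]; first by rewrite /= !linearP.
exists (opnorm S * opnorm T) => x /=.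
by rewrite (le_trans (opnormP _ _))// -mulrA ler_wpM2l ?opnorm_ge0// opnormP.
Qed.
Definition blin_comp S T : blin V V := Blin (blin_comp_subproof S T).

Lemma blin_compA : associative blin_comp.
Proof. by move=> S T U; apply: blin_ext. Qed.
Lemma blin_comp1l : left_id blin_id blin_comp.
Proof. by move=> S; apply: blin_ext. Qed.
Lemma blin_comp1r : right_id blin_id blin_comp.
Proof. by move=> S; apply: blin_ext. Qed.
Lemma blin_compDl : left_distributive blin_comp +%R.
Proof. by move=> S T U; apply: blin_ext. Qed.
Lemma blin_compDr : right_distributive blin_comp +%R.
Proof. by move=> S T U; apply: blin_ext => x; rewrite /= linearD. Qed.

HB.instance Definition _ := GRing.Zmodule_isPzRing.Build (blin V V)
  blin_compA blin_comp1l blin_comp1r blin_compDl blin_compDr.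

End blin_ring.

Section real_arith.
Context {R : realFieldType}.
Fact diam_arith (a b : R) : 0 < b -> 0 <= a -> a ^+ 2 <= 4 * (b / 4) ^+ 2 -> a < b.
Proof. nra. Qed.
Fact var_arith (s p px f fx X2 S2 t n d k e : R) :
  X2 - 2 * fx <= d + k -> d <= S2 + X2 + 2 * (s * px) - 2 * (s * f + fx) ->
  - (s * (p - px)) <= t * (n * k) -> e = k + 2 * t * n * k ->
  0 <= e + (S2 + 2 * s * (p - f)).
Proof. nra. Qed.
End real_arith.

Section riesz.
Context {R : realType} {E : complexHilbertType R}.
Implicit Types (x y z : E) (S T : blin E E).
Local Notation Re := complex.Re.
Local Notation "<| x , y |>" := (inner x y).

Lemma innerDl x y z : inner (x + y) z = inner x z + inner y z.
Proof. by have := inner_linear z 1 x y; rewrite scale1r mul1r. Qed.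
Lemma inner0l z : inner 0 z = 0.
Proof. by have := inner_linear z (-1) 0 0; rewrite scaler0 addr0 mulN1r addNr. Qed.
Lemma innerZl a x z : inner (a *: x) z = a * inner x z.
Proof. by have := inner_linear z a x 0; rewrite addr0 inner0l addr0. Qed.
Lemma innerNl x z : inner (- x) z = - inner x z.
Proof. by rewrite -scaleN1r innerZl mulN1r. Qed.
Lemma innerDr x y z : inner x (y + z) = inner x y + inner x z.
Proof. by rewrite inner_conj innerDl rmorphD -!inner_conj. Qed.
Lemma innerZr a x z : inner x (a *: z) = (a^*)%C * inner x z.
Proof. by rewrite inner_conj innerZl rmorphM -inner_conj. Qed.
Lemma innerNr x z : inner x (- z) = - inner x z.
Proof. by rewrite inner_conj innerNl rmorphN -inner_conj. Qed.

Let rn x := Re `|x|.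

Let Re_conj (a : R[i]) : Re (a^*)%C = Re a. Proof. by case: a. Qed.
Let ReD (a b : R[i]) : Re (a + b) = Re a + Re b. Proof. by case: a; case: b. Qed.
Let ReN (a : R[i]) : Re (- a) = - Re a. Proof. by case: a. Qed.
Let ReZ (a : R) (b : R[i]) : Re (a%:C * b) = a * Re b.
Proof. by case: b => b c /=; rewrite mul0r subr0. Qed.

Let rnC x : (rn x)%:C = `|x|. Proof. exact: Re_norm. Qed.
Let rn_ge0 x : 0 <= rn x. Proof. by rewrite -ler0c rnC. Qed.
#[local] Hint Extern 0 (is_true (0 <= rn _)) => exact: rn_ge0 : core.
Let rn2 x : rn x ^+ 2 = Re <|x, x|>.
Proof. by rewrite inner_norm -rnC -rmorphXn. Qed.
Let rnD x y : rn (x + y) ^+ 2 = rn x ^+ 2 + rn y ^+ 2 + 2 * Re <|x, y|>.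
Proof.
rewrite !rn2 innerDl !innerDr !ReD [inner y x]inner_conj Re_conj.
move: (Re <|x, x|>) (Re _) (Re _) => a b c; ring.
Qed.
Let rnZ (a : R) x : rn (a%:C *: x) = `|a| * rn x.
Proof.
have aE : `|a%:C| = `|a|%:C by rewrite normc_def /= expr0n addr0 sqrtr_sqr.
by rewrite /rn normrZ aE ReZ.
Qed.
Let nC (a : R[i]) : (Re `|a|)%:C = `|a|. Proof. exact/RRe_real/normr_real. Qed.
Let Re_le (a : R[i]) : Re a <= Re `|a|.
Proof.
by rewrite -lecR nC (le_trans _ (normc_ge_Re _))// lecR ler_norm.
Qed.

Lemma cauchy_schwarz x y : `|Re (inner x y)| <= rn x * rn y.
Proof.
have CS t : 0 <= t ^+ 2 * rn x ^+ 2 + rn y ^+ 2 + 2 * t * Re <|x, y|>.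
  have := sqr_ge0 (rn (t%:C *: x + y)).
  by rewrite rnD rnZ innerZl ReZ exprMn real_normK ?num_real// [2 * (t * _)]mulrA.
have [x0|x0] := eqVneq (rn x) 0.
  have xE : x = 0 by apply/eqP; rewrite -normr_eq0 -rnC x0.
  rewrite xE inner0l (_ : Re 0 = 0)// normr0. by apply: mulr_ge0.
have x2 : 0 < rn x ^+ 2 by rewrite exprn_gt0// lt_def x0 rn_ge0.
rewrite -ler_sqr ?nnegrE ?mulr_ge0// real_normK ?num_real//.
have := CS (- Re <|x, y|> / rn x ^+ 2).
rewrite -(pmulr_lge0 _ x2).
have -> : forall b, ((- b / rn x ^+ 2) ^+ 2 * rn x ^+ 2 + rn y ^+ 2 +
   2 * (- b / rn x ^+ 2) * b) * rn x ^+ 2 = rn x ^+ 2 * rn y ^+ 2 - b ^+ 2.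
  by move=> b; field.
by rewrite subr_ge0 exprMn.
Qed.

Let ReiM (a : R[i]) : Re ('i * a) = - complex.Im a.
Proof. by case: a => b c /=; rewrite mul0r mul1r sub0r. Qed.

Section functional.
Variable (phi : E -> R[i]).
Hypothesis phil : scalar phi.
Variable (M : R).
Hypothesis phiM : forall x, Re (phi x) <= M * rn x.

Let phiD x y : phi (x + y) = phi x + phi y.
Proof. by have := phil 1 x y; rewrite scale1r mul1r. Qed.
Let phi0 : phi 0 = 0.
Proof. by have := phil (-1) 0 0; rewrite scaler0 addr0 mulN1r addNr. Qed.
Let phiZ a x : phi (a *: x) = a * phi x.
Proof. by have := phil a x 0; rewrite addr0 phi0 addr0. Qed.

Let J x := rn x ^+ 2 - 2 * Re (phi x).

Let J_lb x : - M ^+ 2 <= J x.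
Proof.
have := phiM x.
have : 0 <= (rn x - M) ^+ 2 by exact: sqr_ge0.
rewrite /J; move: (rn x) (Re _) => a b; nra.
Qed.

Let d := inf (range J).
Let hasd : has_inf (range J).
Proof.
split; first by exists (J 0), 0.
by exists (- M ^+ 2) => _ [x _ <-].
Qed.
Let dJ x : d <= J x. Proof. by apply: ge_inf; [exact: hasd.2|exists x]. Qed.

Let Sd (e : R) := [set x | J x <= d + e].
Let Sd0 e : 0 < e -> Sd e !=set0.
Proof.
move=> e0; have [_ [x _ <-] xe] := inf_adherent e0 hasd.
by exists x; exact: ltW.
Qed.

Let Sd_diam e x y : Sd e x -> Sd e y -> rn (x - y) ^+ 2 <= 4 * e.
Proof.
rewrite /Sd /=  => xe ye.
have := dJ ((2^-1)%:C *: (x + y)).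
have P1 := rnD x y; have P2 := rnD x (- y).
move: xe ye; rewrite /J rnZ phiZ ReZ phiD ReD exprMn real_normK ?num_real//.
rewrite P1 P2 innerNr ReN.
have -> : rn (- y) = rn y by rewrite /rn normrN.
move: (rn (x - y) ^+ 2) (rn (x + y) ^+ 2) (rn x ^+ 2) (rn y ^+ 2) => a b c f.
move: (Re <|x, y|>) (Re (phi x)) (Re (phi y)) d => g h i j.
lra.
Qed.

Lemma riesz : exists z, forall x, phi x = inner x z.
Proof.
pose F := filter_from [set e : R | 0 < e] Sd.
have FF : ProperFilter F.
  apply: filter_from_proper; last by move=> e /= /Sd0.
  apply: filter_from_filter; first by exists 1 => /=.
  move=> e f /= e0 f0; exists (Num.min e f); first by rewrite /= lt_min e0.
  by move=> x; rewrite /Sd/= => xe; split => /=; apply: (le_trans xe);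
    rewrite lerD2l ge_min lexx ?orbT.
have /cauchy_cvg/cvg_ex[z Fz] : cauchy F.
  apply: cauchy_exP => e e0.
  have er : (Re e)%:C = e by apply/RRe_real/gtr0_real.
  have r0 : 0 < Re e by rewrite -(ltcR _ (Re e)) er.
  have f0 : 0 < (Re e / 4) ^+ 2 by rewrite exprn_gt0// divr_gt0.
  have [x xf] := Sd0 f0.
  exists x, ((Re e / 4) ^+ 2) => //= y yf.
  rewrite -ball_normE /ball_/= -er -rnC ltcR.
  exact: diam_arith r0 (rn_ge0 _) (Sd_diam xf yf).
have near_z (e : R) : 0 < e -> exists2 x, Sd e x & rn (z - x) <= e.
  move=> e0.
  have /Fz[f f0 fz] : nbhs z (ball z e%:C) by apply: nbhsx_ballx; rewrite ltcR.
  have [x xm] : Sd (Num.min e f) !=set0 by apply: Sd0; rewrite lt_min e0.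
  exists x.
    by apply: (le_trans xm); rewrite lerD2l ge_min lexx.
  have : ball z e%:C x.
    by apply: fz; apply: (le_trans xm); rewrite lerD2l ge_min lexx orbT.
  by rewrite -ball_normE /ball_/= -rnC ltcR => /ltW.
have var v (s : R) : 0 <= s ^+ 2 * rn v ^+ 2 + 2 * s * Re (<|v, z|> - phi v).
  apply/ler_addgt0Pl => e e0.
  pose c := 1 + 2 * `|s| * rn v.
  have c0 : 0 < c by rewrite ltr_pwDl// !mulr_ge0.
  have [x xe zx] := near_z (e / c) (divr_gt0 e0 c0).
  have := dJ (s%:C *: v + x); move: xe; rewrite /Sd /J /= rnD phiD phiZ ReD ReZ.
  rewrite rnZ innerZl ReZ exprMn real_normK ?num_real// ReD ReN => xe dx.
  have : `|Re <|v, z - x|>| <= rn v * (e / c).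
    by rewrite (le_trans (cauchy_schwarz _ _))// ler_wpM2l.
  rewrite innerDr innerNr ReD ReN => vx.
  have : e = e / c + 2 * `|s| * rn v * (e / c).
    rewrite -[X in X + _]mul1r -mulrDl -/c mulrC mulfVK ?gt_eqF//.
  have : - (s * (Re <|v, z|> - Re <|v, x|>)) <= `|s| * (rn v * (e / c)).
    rewrite (le_trans (ler_norm _))// normrN normrM ler_wpM2l//.
  move=> h1 h2; exact: var_arith xe dx h1 h2.
have ReE v : Re (phi v) = Re <|v, z|>.
  apply/eqP; rewrite eq_sym -subr_eq0 -ReN -ReD; apply/eqP.
  set a := Re _.
  have va s : 0 <= s ^+ 2 * rn v ^+ 2 + 2 * s * a by exact: var.
  apply/eqP; apply/negPn/negP => a0.
  have a2 : 0 < a ^+ 2 by rewrite exprn_even_gt0.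
  have n0 : 0 < 1 + rn v ^+ 2 by rewrite ltr_pwDl// sqr_ge0.
  have := va (- a / (1 + rn v ^+ 2)).
  rewrite -(pmulr_lge0 _ n0) -(pmulr_lge0 _ n0).
  have -> : forall b w : R, 1 + w != 0 ->
     ((- b / (1 + w)) ^+ 2 * w + 2 * (- b / (1 + w)) * b) * (1 + w) * (1 + w)
    = - b ^+ 2 * (w + 2) by move=> b w w0; field.
    by rewrite mulNr oppr_ge0 leNgt mulr_gt0// ltr_wpDl// sqr_ge0.
  by rewrite gt_eqF.
exists z => v; apply/eqP; rewrite eq_complex ReE eqxx/=.
have := ReE ('i *: v); rewrite phiZ innerZl.
by rewrite !ReiM => /oppr_inj ->.
Qed.
End functional.

Lemma inner_ext y z : (forall x, inner x y = inner x z) -> y = z.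
Proof.
move=> yz; apply/eqP; rewrite -subr_eq0 -normr_eq0 -sqrf_eq0 -inner_norm.
by rewrite innerDr innerNr yz subrr.
Qed.

Let rn_blin T x : rn (T x) <= Re `|T| * rn x.
Proof. by rewrite -lecR rmorphM /= !rnC opnormP. Qed.

Lemma adjoint_bound T (S : E -> E) :
  (forall x y, inner (T x) y = inner x (S y)) ->
  forall y, `|S y| <= `|T| * `|y|.
Proof.
move=> SP y; rewrite -!rnC -[`|T|]Re_norm -rmorphM lecR.
have [->|y0] := eqVneq (rn (S y)) 0; first by rewrite mulr_ge0// -ler0c Re_norm.
have y1 : 0 < rn (S y) by rewrite lt_def y0 rn_ge0.
rewrite -(ler_pM2l y1) -expr2 rn2 -SP.
rewrite (le_trans (ler_norm _))// (le_trans (cauchy_schwarz _ _))//.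
by rewrite mulrCA mulrA ler_wpM2r.
Qed.

Lemma adjoint_exists T : exists S, forall x y, inner (T x) y = inner x (S y).
Proof.
have /choice[S SP] y : exists z, forall x, inner (T x) y = inner x z.
  apply: (@riesz (fun x => inner (T x) y) _ (Re `|T| * rn y)) => [a u v|x].
    by rewrite linearP inner_linear.
  rewrite (le_trans (ler_norm _))// (le_trans (cauchy_schwarz _ _))//.
  by rewrite mulrAC ler_wpM2r.
have lS : linear S.
  move=> a u v; apply: inner_ext => x.
  by rewrite -SP !innerDr !innerZr !SP.
suff bS : S \in is_blin by exists (Blin bS).
by apply/asboolP; split=> //; exists `|T|; exact: adjoint_bound.
Qed.

End riesz.

(* [star] is only an operation here; its laws are proved for operators below. *)
HB.mixin Record hasStar A := { star : A -> A }.

#[short(type="starRingType")]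
HB.structure Definition StarRing := {A of GRing.PzRing A & hasStar A}.

Section adjoint.
Context {R : realType} {E : complexHilbertType R}.
Implicit Types S T : blin E E.

Definition adjoint T : blin E E := sval (cid (adjoint_exists T)).

Lemma adjointP T x y : inner (T x) y = inner x (adjoint T y).
Proof. by rewrite /adjoint; case: cid. Qed.

HB.instance Definition _ := hasStar.Build (blin E E) adjoint.

Lemma starP T x y : inner (T x) y = inner x (star T y).
Proof. exact: adjointP. Qed.

Lemma starPr T x y : inner (star T x) y = inner x (T y).
Proof. by rewrite inner_conj -starP -inner_conj. Qed.

Lemma star_unique S T :
  (forall x y, inner (T x) y = inner x (S y)) -> S = star T.
Proof.
by move=> ST; apply: blin_ext => y; apply: inner_ext => x; rewrite -starP ST.
Qed.

Lemma star_conj_linear k S T :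
  star (k *: S + T) = (k^*)%C *: star S + star T.
Proof.
apply/esym/star_unique => x y; rewrite innerDl innerZl innerDr innerZr.
by rewrite conjcK !starP.
Qed.

Lemma starK T : star (star T) = T.
Proof. by apply/esym/star_unique => x y; rewrite starPr. Qed.

Lemma starM S T : star (S * T) = star T * star S.
Proof. by apply/esym/star_unique => x y; rewrite /= !starP. Qed.

Lemma norm_star T : `|star T| <= `|T|.
Proof.
apply: opnorm_le => x x1; rewrite (le_trans (adjoint_bound (starP T) x))//.
by rewrite ler_piMr.
Qed.

Lemma blin_scalerMl k S T : (k *: S) * T = k *: (S * T).
Proof. exact: blin_ext. Qed.

Lemma blin_scalerMr k S T : S * (k *: T) = k *: (S * T).
Proof. by apply: blin_ext => x; rewrite /= linearZ. Qed.

Lemma blin_normrM S T : `|S * T| <= `|S| * `|T|.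
Proof.
apply: opnorm_le => x x1 /=; rewrite (le_trans (opnormP _ _))//.
by rewrite ler_wpM2l ?opnorm_ge0// opnorm_ub1.
Qed.
End adjoint.

Section subalgebra.
Context {R : realType} {E : complexHilbertType R}.
Local Notation B := (blin E E).
Implicit Types (S T : B) (A M : set B).

(* Subalgebras are unital: they contain the identity operator. *)
Record star_subalgebra A : Prop := {
  star_subalgebra1 : A 1;
  star_subalgebraP : forall (k : R[i]) S T, A S -> A T -> A (k *: S + T);
  star_subalgebraM : forall S T, A S -> A T -> A (S * T);
  star_subalgebra_star : forall T, A T -> A (star T) }.

Definition cstar_subalgebra A := star_subalgebra A /\ closed A.

Definition commutant M : set B := [set S | forall T, M T -> S * T = T * S].

Definition von_neumann_algebra M :=
  (forall T, M T -> M (star T)) /\ commutant (commutant M) = M.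

Lemma commutant_star M : (forall T, M T -> M (star T)) ->
  forall S, commutant M S -> commutant M (star S).
Proof.
move=> Mstar S MS T /Mstar MT.
by rewrite -[T]starK -!starM MS.
Qed.

Lemma commutant_cstar M : (forall T, M T -> M (star T)) ->
  cstar_subalgebra (commutant M).
Proof.
move=> Mstar; split.
  split; last exact: commutant_star.
  - by move=> T _; rewrite mul1r mulr1.
  - move=> k S T MS MT U MU.
    by rewrite mulrDl mulrDr blin_scalerMl blin_scalerMr MS// MT.
  - by move=> S T MS MT U MU; rewrite -mulrA MT// mulrA MS// mulrA.
move=> S clS T MT; apply/eqP; rewrite -subr_eq0 -normr_le0.
apply/ler_addgt0Pl => e e0.
have t0 : 0 < 2 * `|T| + 1 by rewrite ltr_wpDl// mulr_ge0.
have d0 : 0 < e / (2 * `|T| + 1) by rewrite divr_gt0.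
have [U [MU SU]] := clS _ (nbhsx_ballx S _ d0).
have {SU} SU : `|S - U| <= e / (2 * `|T| + 1).
  by move: SU; rewrite -ball_normE /ball_/= => /ltW.
have -> : S * T - T * S = (S - U) * T - T * (S - U).
  by rewrite mulrBl mulrBr (MU _ MT) opprB addrA subrK.
rewrite addr0 (le_trans (ler_normB _ _))//.
apply: (@le_trans _ _ (2 * `|T| * `|S - U|)).
  rewrite -mulrA mulr_natl mulr2n lerD ?blin_normrM//.
  by rewrite (le_trans (blin_normrM _ _))// mulrC.
apply: (@le_trans _ _ ((2 * `|T| + 1) * `|S - U|)).
  by rewrite ler_wpM2r// lerDl.
by rewrite -ler_pdivlMl// mulrC.
Qed.

Lemma von_neumann_cstar M : von_neumann_algebra M -> cstar_subalgebra M.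
Proof.
by move=> [Mstar <-]; apply/commutant_cstar/commutant_star.
Qed.

Lemma smallest_star_subalgebra (C : set B -> Prop) (G : set B) :
  (forall A, C A -> star_subalgebra A) -> star_subalgebra (smallest C G).
Proof.
move=> CA; split.
- by move=> A [/CA[]].
- move=> k S T GS GT A CGA; have [/CA[_ + _ _] _] := CGA.
  by apply; [exact: GS|exact: GT].
- move=> S T GS GT A CGA; have [/CA[_ _ + _] _] := CGA.
  by apply; [exact: GS|exact: GT].
- move=> T GT A CGA; have [/CA[_ _ _ +] _] := CGA.
  by apply; exact: GT.
Qed.

Lemma smallest_cstar_vn (G : set B) :
  smallest cstar_subalgebra G `<=` smallest von_neumann_algebra G.
Proof.
move=> T GT M [/von_neumann_cstar cM GM]; exact: GT.
Qed.

Record starSubalg := StarSubalg {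
  carrier :> set B; carrierP : star_subalgebra carrier }.

(* The intersection of all C*-subalgebras (resp. von Neumann algebras) of B(E)
   that contain G. *)
Definition cstar_generated (G : set B) : starSubalg :=
  StarSubalg (smallest_star_subalgebra G
    (fun A (cA : cstar_subalgebra A) => cA.1)).

Definition von_neumann_generated (G : set B) : starSubalg :=
  StarSubalg (smallest_star_subalgebra G
    (fun A (vA : von_neumann_algebra A) => (von_neumann_cstar vA).1)).

End subalgebra.
Arguments starSubalg {R} E.

Section elt.
Context {R : realType} {E : complexHilbertType R}.
Variable A : starSubalg E.
Local Notation B := (blin E E).

Definition in_subalg : {pred B} := fun T => T \in carrier A.

Lemma in_subalgP T : reflect (carrier A T) (T \in in_subalg).
Proof. by apply: (iffP idP); rewrite unfold_in /in_subalg in_setE. Qed.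

Lemma in_subalg_submod : GRing.submod_closed in_subalg.
Proof.
have [A1 AP _ _] := carrierP A; split=> [|k S T].
  apply/in_subalgP; rewrite -(addNr (1 : B)) -scaleN1r; exact: AP.
by move=> /in_subalgP SA /in_subalgP TA; apply/in_subalgP/AP.
Qed.

HB.instance Definition _ :=
  GRing.isSubmodClosed.Build R[i] B in_subalg in_subalg_submod.

(* The algebra A as a type, with the structure inherited from B(E). *)
Record elt := Elt { elt_val :> B; eltP : elt_val \in in_subalg }.

HB.instance Definition _ := [isSub for elt_val].
HB.instance Definition _ := [Choice of elt by <:].
HB.instance Definition _ := [SubChoice_isSubLmodule of elt by <:].

Lemma elt_normD (x y : elt) : `|val (x + y)| <= `|val x| + `|val y|.
Proof. exact: ler_normD. Qed.
Lemma elt_normZ (k : R[i]) (x : elt) : `|val (k *: x)| = `|k| * `|val x|.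
Proof. exact: normrZ. Qed.
Lemma elt_norm0 (x : elt) : `|val x| = 0 -> x = 0.
Proof. by move=> /normr0_eq0 x0; apply: val_inj. Qed.

HB.instance Definition _ := Lmodule_isNormed.Build R[i] elt
  elt_normD elt_normZ elt_norm0.

Lemma elt1P : 1 \in in_subalg.
Proof. by apply/in_subalgP; case: (carrierP A). Qed.
Lemma eltMP (x y : elt) : val x * val y \in in_subalg.
Proof.
apply/in_subalgP; have [_ _ + _] := carrierP A.
by apply; apply/in_subalgP/eltP.
Qed.
Lemma elt_starP (x : elt) : star (val x) \in in_subalg.
Proof.
apply/in_subalgP; have [_ _ _ +] := carrierP A.
by apply; apply/in_subalgP/eltP.
Qed.

Definition elt_one := Elt elt1P.
Definition elt_mul x y := Elt (eltMP x y).
Definition elt_star x := Elt (elt_starP x).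

Lemma elt_mulA : associative elt_mul.
Proof. by move=> x y z; apply/val_inj/mulrA. Qed.
Lemma elt_mul1l : left_id elt_one elt_mul.
Proof. by move=> x; apply/val_inj/mul1r. Qed.
Lemma elt_mul1r : right_id elt_one elt_mul.
Proof. by move=> x; apply/val_inj/mulr1. Qed.
Lemma elt_mulDl : left_distributive elt_mul +%R.
Proof. by move=> x y z; apply/val_inj/mulrDl. Qed.
Lemma elt_mulDr : right_distributive elt_mul +%R.
Proof. by move=> x y z; apply/val_inj/mulrDr. Qed.

HB.instance Definition _ := GRing.Zmodule_isPzRing.Build elt
  elt_mulA elt_mul1l elt_mul1r elt_mulDl elt_mulDr.
HB.instance Definition _ := hasStar.Build elt elt_star.

End elt.

Definition dual_space (R : realType) (V : normedModType R[i]) := blin V R[i]^o.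
HB.instance Definition _ (R : realType) (V : normedModType R[i]) :=
  NormedModule.copy (dual_space V) (blin V R[i]^o).

Definition bidual (R : realType) (V : normedModType R[i]) := dual_space (dual_space V).
HB.instance Definition _ (R : realType) (V : normedModType R[i]) :=
  NormedModule.copy (bidual V) (dual_space (dual_space V)).

Section mk_blin.
Context {R : realType} {V W : normedModType R[i]}.
Variables (f : V -> W) (M : R[i]).
Hypotheses (lf : linear f) (fM : forall x, `|f x| <= M * `|x|).

Lemma mk_blin_subproof : f \in is_blin.
Proof. by apply/asboolP; split=> //; exists M. Qed.
Definition mk_blin : blin V W := Blin mk_blin_subproof.

Lemma mk_blin_norm : 0 <= M -> `|mk_blin| <= M.
Proof.
by move=> M0; apply: opnorm_le => x x1; rewrite (le_trans (fM x))// ler_piMr.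
Qed.
End mk_blin.

(* The second dual of A as a *-algebra: for a, b in A, phi in A^*, xi, eta in
   A^**,
     (phi . a)(b)    = phi (a b)             dual_mul
     (eta . phi)(a)  = eta (phi . a)         bidual_act
     (xi eta)(phi)   = xi (eta . phi)        arens (first Arens product)
     phi^*(a)        = conj (phi (a^* ))     dual_star
     xi^*(phi)       = conj (xi (phi^* ))    bidual_star
   When A is a C*-algebra, both Arens products agree and these operations make
   A^** the enveloping von Neumann algebra of A (Sherman-Takeda). *)
Section arens.
Context {R : realType} {E : complexHilbertType R} {A : starSubalg E}.
Local Notation A' := (dual_space (elt A)).
Local Notation A'' := (bidual (elt A)).
Implicit Types (a b : elt A) (phi psi : A') (xi eta zeta : A'').

Lemma elt_normM a b : `|a * b| <= `|a| * `|b|.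
Proof. exact: blin_normrM. Qed.
Lemma elt_scalerMl (k : R[i]) a b : (k *: a) * b = k *: (a * b).
Proof. exact/val_inj/blin_scalerMl. Qed.
Lemma elt_scalerMr (k : R[i]) a b : a * (k *: b) = k *: (a * b).
Proof. exact/val_inj/blin_scalerMr. Qed.
Lemma elt_starD (k : R[i]) a b : star (k *: a + b) = (k^*)%C *: star a + star b.
Proof. exact/val_inj/star_conj_linear. Qed.
Lemma elt_norm_star a : `|star a| <= `|a|.
Proof. exact: norm_star. Qed.

Definition embed_fun a phi : R[i]^o := phi a.
Lemma embed_linear a : linear (embed_fun a). Proof. by []. Qed.
Lemma embed_bound a phi : `|embed_fun a phi| <= `|a| * `|phi|.
Proof. by rewrite mulrC; exact: opnormP. Qed.
Definition bidual_embed a : A'' := mk_blin (embed_linear a) (embed_bound a).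

Definition dual_mul_fun phi a b : R[i]^o := phi (a * b).
Lemma dual_mul_linear phi a : linear (dual_mul_fun phi a).
Proof.
by move=> k b c; rewrite /dual_mul_fun mulrDr elt_scalerMr linearP.
Qed.
Lemma dual_mul_bound phi a b : `|dual_mul_fun phi a b| <= `|phi| * `|a| * `|b|.
Proof.
rewrite (le_trans (opnormP phi _))// -mulrA ler_wpM2l ?opnorm_ge0//.
exact: elt_normM.
Qed.
Definition dual_mul phi a : A' :=
  mk_blin (dual_mul_linear phi a) (dual_mul_bound phi a).
Lemma dual_mul_norm phi a : `|dual_mul phi a| <= `|phi| * `|a|.
Proof. by apply: mk_blin_norm; rewrite mulr_ge0. Qed.

Definition bidual_act_fun eta phi a : R[i]^o := eta (dual_mul phi a).
Lemma bidual_act_linear eta phi : linear (bidual_act_fun eta phi).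
Proof.
move=> k a b; rewrite /bidual_act_fun -linearP; congr (eta _).
apply: blin_ext => c; rewrite /= /dual_mul_fun mulrDl elt_scalerMl.
exact: linearP.
Qed.
Lemma bidual_act_bound eta phi a :
  `|bidual_act_fun eta phi a| <= `|eta| * `|phi| * `|a|.
Proof.
rewrite (le_trans (opnormP eta _))// -mulrA ler_wpM2l ?opnorm_ge0//.
exact: dual_mul_norm.
Qed.
Definition bidual_act eta phi : A' :=
  mk_blin (bidual_act_linear eta phi) (bidual_act_bound eta phi).
Lemma bidual_act_norm eta phi : `|bidual_act eta phi| <= `|eta| * `|phi|.
Proof. by apply: mk_blin_norm; rewrite mulr_ge0. Qed.

Definition arens_fun xi eta phi : R[i]^o := xi (bidual_act eta phi).
Lemma arens_linear xi eta : linear (arens_fun xi eta).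
Proof.
move=> k phi psi; rewrite /arens_fun -linearP; congr (xi _).
apply: blin_ext => a; rewrite /= /bidual_act_fun -[RHS]linearP.
by congr (eta _); apply: blin_ext.
Qed.
Lemma arens_bound xi eta phi :
  `|arens_fun xi eta phi| <= `|xi| * `|eta| * `|phi|.
Proof.
rewrite (le_trans (opnormP xi _))// -mulrA ler_wpM2l ?opnorm_ge0//.
exact: bidual_act_norm.
Qed.
Definition arens xi eta : A'' :=
  mk_blin (arens_linear xi eta) (arens_bound xi eta).

Lemma arensA : associative arens.
Proof.
move=> xi eta zeta; apply: blin_ext => phi; congr (xi _).
apply: blin_ext => a; congr (eta _); apply: blin_ext => b; congr (zeta _).
by apply: blin_ext => c; rewrite /= /dual_mul_fun /= /dual_mul_fun mulrA.
Qed.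
Lemma arens1l : left_id (bidual_embed 1) arens.
Proof.
move=> xi; apply: blin_ext => phi; congr (xi _); apply: blin_ext => a.
by rewrite /= /dual_mul_fun mul1r.
Qed.
Lemma arens1r : right_id (bidual_embed 1) arens.
Proof.
move=> xi; apply: blin_ext => phi; congr (xi _); apply: blin_ext => a.
by rewrite /= /bidual_act_fun /= /embed_fun /= /dual_mul_fun mulr1.
Qed.
Lemma arensDl : left_distributive arens +%R.
Proof. by move=> xi eta zeta; apply: blin_ext. Qed.
Lemma arensDr : right_distributive arens +%R.
Proof.
move=> xi eta zeta; apply: blin_ext => phi.
rewrite /= /arens_fun.
have -> : bidual_act (eta + zeta) phi = bidual_act eta phi + bidual_act zeta phi.
  exact: blin_ext.
exact: linearD.
Qed.

HB.instance Definition _ := GRing.Zmodule_isPzRing.Build A''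
  arensA arens1l arens1r arensDl arensDr.

Definition dual_star_fun phi a : R[i]^o := ((phi (star a))^*)%C.
Lemma dual_star_linear phi : linear (dual_star_fun phi).
Proof.
move=> k a b; rewrite /dual_star_fun elt_starD linearP rmorphD rmorphM.
by rewrite /= conjcK.
Qed.
Lemma dual_star_bound phi a : `|dual_star_fun phi a| <= `|phi| * `|a|.
Proof.
rewrite /dual_star_fun normcJ (le_trans (opnormP phi _))//.
by rewrite ler_wpM2l ?opnorm_ge0// elt_norm_star.
Qed.
Definition dual_star phi : A' :=
  mk_blin (dual_star_linear phi) (dual_star_bound phi).
Lemma dual_star_norm phi : `|dual_star phi| <= `|phi|.
Proof. exact: mk_blin_norm. Qed.

Definition bidual_star_fun xi phi : R[i]^o := ((xi (dual_star phi))^*)%C.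
Lemma bidual_star_linear xi : linear (bidual_star_fun xi).
Proof.
move=> k phi psi; rewrite /bidual_star_fun.
have -> : dual_star (k *: phi + psi) = (k^*)%C *: dual_star phi + dual_star psi.
  by apply: blin_ext => a; rewrite /= /dual_star_fun rmorphD rmorphM.
by rewrite linearP rmorphD rmorphM /= conjcK.
Qed.
Lemma bidual_star_bound xi phi : `|bidual_star_fun xi phi| <= `|xi| * `|phi|.
Proof.
rewrite /bidual_star_fun normcJ (le_trans (opnormP xi _))//.
by rewrite ler_wpM2l ?opnorm_ge0// dual_star_norm.
Qed.
Definition bidual_star xi : A'' :=
  mk_blin (bidual_star_linear xi) (bidual_star_bound xi).

HB.instance Definition _ := hasStar.Build A'' bidual_star.
End arens.

(* Positivity in M_n(A): matrices of the form N^* N with N in M_n(A). *)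
Definition positive_mx (A : starRingType) n (P : 'M[A]_n) :=
  exists N : 'M[A]_n, P = (map_mx star N)^T *m N.

Definition completely_positive (A B : starRingType) (Phi : A -> B) :=
  forall n (P : 'M[A]_n), positive_mx P -> positive_mx (map_mx Phi P).

Section complementation.
Context {R : realType} {E : complexHilbertType R} (A M : starSubalg E).
Hypothesis AM : A `<=` M.

Lemma elt_incl_subproof (a : elt A) : val a \in in_subalg M.
Proof. exact/in_subalgP/AM/in_subalgP/eltP. Qed.
Definition elt_incl (a : elt A) : elt M := Elt (elt_incl_subproof a).

Definition weakly_cp_complemented :=
  exists Phi : {linear elt M -> bidual (elt A)},
    [/\ Phi 1 = 1, completely_positive Phi &
        forall a, Phi (elt_incl a) = bidual_embed a].
End complementation.

(* (x, y) stands for x + i y. *)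
Definition complexification {R : realType} (V : lmodType R) := (V * V)%type.

Section complexification.
Context {R : realType} {V : lmodType R}.
Local Notation Re := complex.Re.
Local Notation Im := complex.Im.

HB.instance Definition _ := GRing.Zmodule.copy (complexification V) (V * V)%type.

Definition complexification_scale (k : R[i]) (u : complexification V) :
    complexification V :=
  (Re k *: u.1 - Im k *: u.2, Re k *: u.2 + Im k *: u.1).

Lemma complexification_scaleA k l u :
  complexification_scale k (complexification_scale l u) =
  complexification_scale (k * l) u.
Proof.
case: k l u => [a b] [c d] [x y]; rewrite /complexification_scale /=.
rewrite !scalerDr !scalerN !scalerA !scalerDl !scaleNr !opprD.
by congr pair; rewrite [X in _ + X = _]addrC addrACA.
Qed.
Lemma complexification_scale1 : left_id 1 complexification_scale.
Proof.
by case=> x y; rewrite /complexification_scale /= !scale1r !scale0r subr0 addr0.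
Qed.
Lemma complexification_scaleDr : right_distributive complexification_scale +%R.
Proof.
move=> k [x y] [z t]; rewrite /complexification_scale /=.
by congr pair; rewrite !scalerDr ?opprD addrACA.
Qed.
Lemma complexification_scaleDl u :
  {morph complexification_scale^~ u : k l / k + l}.
Proof.
case: u => x y [a b] [c d]; rewrite /complexification_scale /=.
by congr pair; rewrite !scalerDl ?opprD addrACA.
Qed.

HB.instance Definition _ := GRing.Zmodule_isLmodule.Build R[i]
  (complexification V) complexification_scaleA complexification_scale1
  complexification_scaleDr complexification_scaleDl.
End complexification.

Definition complex_inner {R : realType} {H : realHilbertType R}
    (u v : complexification H) : R[i] :=
  (inner u.1 v.1 + inner u.2 v.2) +i* (inner u.2 v.1 - inner u.1 v.2).

Definition inversions n (s : 'S_n) :=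
  #|[pred p : 'I_n * 'I_n | (p.1 < p.2)%N && (s p.2 < s p.1)%N]|.

(* Words h = [:: h_1; ...; h_n] stand for elementary tensors h_1 (x) ... (x) h_n,
   and the empty word for the vacuum vector. *)
Definition q_inner {R : realType} {H : realHilbertType R} (q : R)
    (h g : seq (complexification H)) : R[i] :=
  if size h == size g then
    \sum_(s : 'S_(size h)) (q ^+ inversions s)%:C *
      \prod_(i < size h) complex_inner h`_i g`_(s i)
  else 0.

(* A Hilbert space completion of the algebraic direct sum of the algebraic tensor
   powers of H_C for the q-inner product: a complex Hilbert space with an
   isometric linear map of dense range from that direct sum.  By the universal
   property of tensor powers the linear map is given by its values [tens] on
   words, which have to be linear in each letter.  Such a completion is unique up
   to a unitary that fixes the elementary tensors. *)
Record qFock {R : realType} (H : realHilbertType R) (q : R) := QFock {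
  fock :> complexHilbertType R;
  tens : seq (complexification H) -> fock;
  tens_linear : forall h g, linear (fun x => tens (h ++ x :: g));
  tens_inner : forall h g, inner (tens h) (tens g) = q_inner q h g;
  tens_dense : dense (range (fun c : seq (R[i] * seq (complexification H)) =>
    \sum_(p <- c) p.1 *: tens p.2)) }.

Section gaussian.
Context {R : realType} {H : realHilbertType R} {q : R} (F : qFock H q).

(* The bounded operator that prepends h to elementary tensors; density of their
   span makes it unique. *)
Definition creation (h : complexification H) : blin F F :=
  xget 0 [set T : blin F F | forall u, T (tens F u) = tens F (h :: u)].

Definition gaussian (f : H) : blin F F :=
  creation (f, 0) + star (creation (f, 0)).

Definition C_q : starSubalg F := cstar_generated (range gaussian).
Definition Gamma_q : starSubalg F := von_neumann_generated (range gaussian).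

Lemma C_q_sub_Gamma_q : C_q `<=` Gamma_q.
Proof. exact: smallest_cstar_vn. Qed.
End gaussian.

Arguments C_q_sub_Gamma_q {R H q} F.

(* Main.v *)
Require Import Defs.
From HB Require Import structures.
From mathcomp Require Import all_boot all_order all_algebra perm complex ring lra zify.
From mathcomp Require Import boolp classical_sets reals topology normedtype sequences.

Import Order.TTheory GRing.Theory Num.Theory.
Import numFieldNormedType.Exports.

Set Implicit Arguments.
Unset Strict Implicit.
Unset Printing Implicit Defensive.

Local Open Scope ring_scope.

(** For 0 <= r < 1 let T_r be the second quantization of r: on the word w of
length n it multiplies the Wick operator L_w by r^n. The Wick formula and the
Krein-type bound on q-symmetrizers give |L_xi| <= (n + 1) C |xi| for xi of
degree n, so T_r x = sum_n r^n L_(p_n (x Omega)) converges in norm: T_r maps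
Gamma_q into C_q. Positivity of T_r is tested on vectors produced by right
Gaussians, which commute with Gamma_q; there the matrix of T_r is the Gram
matrix of words in two copies of the alphabet with correlation r. Since T_r is
unital and contractive, T_r a tends to a in norm for a in C_q as r tends to 1.

Phi is an ultralimit of the T_r in the second dual of C_q. Its complete
positivity amounts to the following: a matrix P over the second dual A^** with
P = P^* and |1 - P| <= 1 for the norm dual to that of matrices over A^* has
the form N^* N. The square root N is the limit of a polynomial recursion, and
N = N^* because the involution of A^** reverses products, that is, because A is
Arens regular: by Hahn-Banach |phi(ab)|^2 <= C |a|^2 f(b^* b) with f positive,
so b |-> phi(ab) lies in the Hilbert space of f, where the order of the two
limits can be exchanged. *)

(** * Positive semidefinite kernels *)

(** T_r is realized as a bounded map P from the Fock space to operators, evaluated at x Om. The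
    direct estimate of its norm is a multiple of (1 - r)^-2; the bound uniform in r that the
    ultralimit requires comes only from positivity. Positivity is checked on Gaussian words, where
    it is an identity between q-forms. The combinatorics is therefore done for formal real
    combinations of words over an arbitrary alphabet with a positive semidefinite kernel: the
    doubled alphabet is then one more instance, and words with letters in H span a dense subspace
    and have real q-inner products.

    On the other side, the target of Phi is given only as a second dual with its Arens product,
    where positivity means a factorization N^* N. Positivity of T_r is a statement about vectors of
    the Fock space, and a factorization does not pass to a weak limit. What does pass is a norm
    bound tested against fixed functionals. So positivity of each T_r is turned into |1 - T_r(P) /
    K| <= 1, the limit is taken in this form, and a square root is then built inside the matrices
    over A^**. *)

Lemma log_convex_growth (R : realType) (a : nat -> R) (b S K : R) :
  0 <= b -> 0 <= S -> 0 <= a 1%N -> (forall m, a m ^+ 2 <= b * a (2 * m)%N) ->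
  (forall m, a m <= K * S ^+ m) -> a 1%N <= S * b.
Proof.
move=> b0 S0 a0 cvx gr; rewrite leNgt; apply/negP => lt.
have K0 : 0 < K * S.
  by have := gr 1%N; rewrite expr1; apply: lt_le_trans; apply: le_lt_trans lt; rewrite mulr_ge0.
have b_gt0 : 0 < b.
  rewrite lt_def b0 andbT; apply/eqP => bE.
  have := cvx 1%N; rewrite bE mul0r => h.
  have : a 1%N == 0 by rewrite -sqrf_eq0 eq_le h sqr_ge0.
  by move/eqP => a10; move: lt; rewrite bE mulr0 a10 ltxx.
have S_gt0 : 0 < S.
  by rewrite lt_def S0 andbT; apply: contraTneq K0 => ->; rewrite mulr0 ltxx.
(* Iterated doubling. With the growth bound it gives t^(2^N) <= K / b for t = a 1 / (b S), which is
   impossible for all N if t > 1: the constant K disappears. This is how crude bounds become sharp,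
   both for unshuffles and for the contractivity of T_r. *)
have key N : a 1%N ^+ (2 ^ N) <= b ^+ (2 ^ N).-1 * a (2 ^ N)%N.
  elim: N => [|N IH]; first by rewrite expn0 expr1 expr0 mul1r.
  have e : (2 ^ N.+1 = (2 ^ N) * 2)%N by rewrite expnSr.
  rewrite e exprM; apply: (@le_trans _ _ ((b ^+ (2 ^ N).-1 * a (2 ^ N)%N) ^+ 2)).
    by rewrite lerXn2r// ?nnegrE ?exprn_ge0// (le_trans _ IH)// exprn_ge0.
  rewrite exprMn -exprM.
  have -> : (2 ^ N * 2).-1 = ((2 ^ N).-1 * 2 + 1)%N.
    by have := expn_gt0 2 N; case: (2 ^ N)%N => // k _; rewrite mulSn add2n addn1.
  rewrite exprD expr1 -mulrA ler_wpM2l ?exprn_ge0//.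
  by rewrite mulnC.
pose t := a 1%N / (b * S).
have t1 : 1 < t by rewrite ltr_pdivlMr ?mulr_gt0// mul1r mulrC.
have bnd N : t ^+ (2 ^ N) <= K / b.
  rewrite expr_div_n ler_pdivrMr ?exprn_gt0 ?mulr_gt0//.
  apply: (le_trans (key N)); apply: (le_trans (ler_wpM2l _ (gr _))).
    by rewrite exprn_ge0.
  rewrite exprMn.
  have -> : b ^+ (2 ^ N) = b ^+ (2 ^ N).-1 * b.
    by rewrite -exprSr prednK// expn_gt0.
  by rewrite le_eqVlt; apply/orP; left; apply/eqP; field; rewrite gt_eqF.
have bern n : 1 + (t - 1) *+ n <= t ^+ n.
  elim: n => [|n IH]; first by rewrite mulr0n addr0 expr0.
  rewrite exprS mulrS; apply: (@le_trans _ _ (t * (1 + (t - 1) *+ n))); last first.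
    by rewrite ler_pM2l// (lt_trans ltr01).
  have : 0 <= (t - 1) *+ n by rewrite mulrn_wge0// subr_ge0 ltW.
  move: (_ *+ n) => w w0; have : 0 < t - 1 by rewrite subr_gt0.
  nra.
have [N hN] : exists N : nat, K / b / (t - 1) < N%:R.
  exists (Num.bound (K / b / (t - 1))).
  by apply/archi_boundP/divr_ge0/ltW; rewrite ?subr_gt0// divr_ge0// ltW// -(pmulr_lgt0 _ S_gt0).
have := bnd N; rewrite leNgt => /negP; apply.
apply: lt_le_trans (bern _); move: hN; rewrite ltr_pdivrMr ?subr_gt0// mulr_natl => hN.
apply: (lt_le_trans hN); rewrite -[leLHS]add0r lerD//.
rewrite ler_pMn2l ?subr_gt0//; apply: ltnW; exact: ltn_expl.
Qed.

Lemma quadratic_nonneg_discr (R : realFieldType) (x y z : R) :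
  0 <= z -> (forall t, 0 <= x + 2 * t * y + t ^+ 2 * z) -> y ^+ 2 <= x * z.
Proof.
move=> z0 h; have [zE|zN0] := eqVneq z 0.
  have [->|y0] := eqVneq y 0; first by rewrite zE mulr0 expr0n.
  have := h (- (x + 1) / (2 * y)); rewrite zE mulr0 addr0.
  have -> : 2 * (- (x + 1) / (2 * y)) * y = - (x + 1) by field.
  by rewrite opprD addrA subrr sub0r oppr_ge0 ler10.
have z1 : 0 < z by rewrite lt_def zN0.
have := h (- y / z); rewrite -(pmulr_lge0 _ z1).
have -> : (x + 2 * (- y / z) * y + (- y / z) ^+ 2 * z) * z = x * z - y ^+ 2.
  by field.
by rewrite subr_ge0.
Qed.

(** Formal sums are plain lists, neither normalized nor quotiented; two of them count as equal when
    [ev F] agrees on them for every F. *)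
Definition comb (R : realType) (T : Type) := seq (R * T).

Section kernels.
Context {R : realType}.

Definition ev T (F : T -> R) (c : comb R T) := \sum_(p <- c) p.1 * F p.2.
Definition form T (K : T -> T -> R) (c d : comb R T) :=
  ev (fun x => ev (K x) d) c.
Definition psd T (K : T -> T -> R) :=
  (forall x y, K x y = K y x) /\ forall c, 0 <= form K c c.

Definition scale_comb T (a : R) (c : comb R T) : comb R T :=
  [seq (a * p.1, p.2) | p <- c].
Definition cbind T U (g : T -> comb R U) (c : comb R T) : comb R U :=
  flatten [seq scale_comb p.1 (g p.2) | p <- c].

Lemma ev_nil T (F : T -> R) : ev F [::] = 0. Proof. exact: big_nil. Qed.
Lemma ev_cons T (F : T -> R) p c : ev F (p :: c) = p.1 * F p.2 + ev F c.
Proof. exact: big_cons. Qed.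
Lemma ev_cat T (F : T -> R) c d : ev F (c ++ d) = ev F c + ev F d.
Proof. exact: big_cat. Qed.
Lemma ev_scale T (F : T -> R) a c : ev F (scale_comb a c) = a * ev F c.
Proof. by rewrite /ev big_map mulr_sumr; apply: eq_bigr => p _; rewrite mulrA. Qed.
Lemma ev_cbind T U (F : U -> R) (g : T -> comb R U) c :
  ev F (cbind g c) = ev (fun x => ev F (g x)) c.
Proof.
rewrite /cbind; elim: c => [|p c IH]; first by rewrite !ev_nil.
by rewrite /= ev_cat ev_cons IH ev_scale.
Qed.
Lemma ev_map T U (F : U -> R) (h : T -> U) c :
  ev F [seq (p.1, h p.2) | p <- c] = ev (F \o h) c.
Proof. by rewrite /ev big_map. Qed.
Lemma eq_ev T (F G : T -> R) c : F =1 G -> ev F c = ev G c.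
Proof. by move=> FG; apply: eq_bigr => p _; rewrite FG. Qed.
Lemma evD T (F G : T -> R) c : ev (fun x => F x + G x) c = ev F c + ev G c.
Proof. by rewrite /ev -big_split; apply: eq_bigr => p _; rewrite mulrDr. Qed.
Lemma evZ T (F : T -> R) a c : ev (fun x => a * F x) c = a * ev F c.
Proof. by rewrite /ev mulr_sumr; apply: eq_bigr => p _; rewrite mulrCA. Qed.
Lemma ev_exchange T U (F : T -> U -> R) c d :
  ev (fun x => ev (F x) d) c = ev (fun y => ev (F^~ y) c) d.
Proof.
rewrite /ev (eq_bigr (fun p => \sum_(p' <- d) p.1 * (p'.1 * F p.2 p'.2))); last first.
  by move=> p _; rewrite mulr_sumr.
rewrite exchange_big; apply: eq_bigr => p _; rewrite mulr_sumr.
by apply: eq_bigr => p' _; rewrite mulrCA.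
Qed.
Lemma ev_sum T I (s : seq I) (F : I -> T -> R) c :
  ev (fun x => \sum_(i <- s) F i x) c = \sum_(i <- s) ev (F i) c.
Proof.
by rewrite /ev exchange_big; apply: eq_bigr => p _; rewrite mulr_sumr.
Qed.

Section form.
Context {T : Type} (K : T -> T -> R).
Lemma formDl c d e : form K (c ++ d) e = form K c e + form K d e.
Proof. exact: ev_cat. Qed.
Lemma formZl a c d : form K (scale_comb a c) d = a * form K c d.
Proof. exact: ev_scale. Qed.
Lemma form_cbindl U (g : U -> comb R T) c d :
  form K (cbind g c) d = ev (fun x => form K (g x) d) c.
Proof. exact: ev_cbind. Qed.
Lemma formC c d : (forall x y, K x y = K y x) -> form K c d = form K d c.
Proof.
by move=> sK; rewrite /form ev_exchange; apply: eq_ev => y; apply: eq_ev => x.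
Qed.
Lemma formDr c d e : form K e (c ++ d) = form K e c + form K e d.
Proof. by rewrite /form -evD; apply: eq_ev => x; rewrite ev_cat. Qed.
Lemma formZr a c d : form K d (scale_comb a c) = a * form K d c.
Proof. by rewrite /form -evZ; apply: eq_ev => x; rewrite ev_scale. Qed.

Hypothesis psdK : psd K.

Lemma form_cauchy_schwarz c d : form K c d ^+ 2 <= form K c c * form K d d.
Proof.
have [sK pK] := psdK.
have q t : 0 <= form K c c + 2 * t * form K c d + t ^+ 2 * form K d d.
  have := pK (c ++ scale_comb t d).
  rewrite formDl !formDr !formZl !formZr (formC d c sK).
  by rewrite expr2; move: (form _ _ _) (form _ _ _) (form _ _ _) => x y z; lra.
exact: quadratic_nonneg_discr (pK d) q.
Qed.
End form.

Lemma psd_rescale T (K : T -> T -> R) (h : T -> R) :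
  psd K -> psd (fun x y => h x * h y * K x y).
Proof.
move=> [sK pK]; split=> [x y|c]; first by rewrite sK [h y * h x]mulrC.
have := pK [seq (p.1 * h p.2, p.2) | p <- c].
congr (0 <= _); rewrite /form /ev big_map; apply: eq_bigr => p _ /=.
rewrite -mulrA; congr (_ * _); rewrite big_map mulr_sumr.
by apply: eq_bigr => p' _ /=; ring.
Qed.

Lemma psd_comp T U (K : U -> U -> R) (h : T -> comb R U) :
  psd K -> psd (fun x y => form K (h x) (h y)).
Proof.
move=> [sK pK]; split=> [x y|c]; first exact: formC.
have := pK (cbind h c); rewrite form_cbindl; congr (0 <= _).
apply: eq_ev => x; rewrite formC// form_cbindl; apply: eq_ev => y.
exact: formC.
Qed.

Lemma psd_pull T U (K : U -> U -> R) (h : T -> U) :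
  psd K -> psd (fun x y => K (h x) (h y)).
Proof.
move=> /(psd_comp (fun x => [:: (1, h x)])) [sK pK]; split=> [x y|c].
  by have := sK x y; rewrite /form /ev !big_cons !big_nil /= !addr0 !mul1r.
have := pK c; congr (0 <= _); apply: eq_ev => x; apply: eq_ev => y.
by rewrite /form /ev !big_cons !big_nil /= !addr0 !mul1r.
Qed.

Lemma psd_const T (a : R) : 0 <= a -> psd (fun _ _ : T => a).
Proof.
move=> a0; split=> // c; rewrite /form.
have -> : ev (fun _ => ev (fun _ => a) c) c = a * (\sum_(p <- c) p.1) ^+ 2.
  rewrite /ev -!mulr_suml; ring.
by rewrite mulr_ge0// sqr_ge0.
Qed.

Lemma psdD T (K L : T -> T -> R) : psd K -> psd L -> psd (fun x y => K x y + L x y).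
Proof.
move=> [sK pK] [sL pL]; split=> [x y|c]; first by rewrite sK sL.
rewrite (_ : form _ c c = form K c c + form L c c) ?addr_ge0//.
by rewrite /form -evD; apply: eq_ev => x; rewrite evD.
Qed.

(* Pivoting, as in a Cholesky decomposition. *)
Lemma psd_gram T (K : T -> T -> R) (s : seq T) : psd K ->
  exists gs : seq (T -> R), forall x y,
    List.In x s -> List.In y s -> K x y = \sum_(h <- gs) h x * h y.
Proof.
elim: s K => [|x s IH] K psdK; first by exists [::].
have [sK pK] := psdK.
have K1 y z : form K [:: (1, y)] [:: (1, z)] = K y z.
  by rewrite /form /ev !big_cons !big_nil /= !addr0 !mul1r.
have Kge0 y : 0 <= K y y by rewrite -K1 pK.
have K0 y z : K y y = 0 -> K y z = 0.
  move=> y0; apply/eqP; rewrite -sqrf_eq0 eq_le sqr_ge0 andbT.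
  by have := form_cauchy_schwarz psdK [:: (1, y)] [:: (1, z)]; rewrite !K1 y0 mul0r.
(* If K x x = 0, then h is 0 because the inverse of 0 is 0; by [K0] the row of x vanishes in that
   case, so nothing has to be subtracted. *)
pose h y := K y x / Num.sqrt (K x x).
pose K' y z := K y z - h y * h z.
have hh y z : h y * h z = K y x * K x z / K x x.
  rewrite /h mulf_div -expr2 sqr_sqrtr// (sK z); congr (_ / _); ring.
have psdK' : psd K'.
  split=> [y z|c]; first by rewrite /K' sK [h y * _]mulrC.
  pose b := form K c [:: (1, x)].
  have hc : ev h c = b / Num.sqrt (K x x).
    rewrite /b /form /ev mulr_suml; apply: eq_bigr => p _.
    by rewrite big_cons big_nil /= addr0 mul1r mulrA.
  have -> : form K' c c = form K c c - b ^+ 2 / K x x.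
    have -> : b ^+ 2 / K x x = ev h c ^+ 2.
      by rewrite hc expr_div_n sqr_sqrtr.
    rewrite /form expr2 -mulrN mulrC -evZ -evD; apply: eq_ev => y.
    by rewrite mulrC mulrN -mulNr -evZ -evD; apply: eq_ev => z; rewrite mulNr.
  have := form_cauchy_schwarz psdK c [:: (1, x)]; rewrite -/b K1 => CS.
  rewrite subr_ge0; have [->|x0] := eqVneq (K x x) 0.
    by rewrite invr0 mulr0.
  by rewrite ler_pdivrMr// lt_def x0 Kge0.
have K'x y : K' x y = 0.
  rewrite /K' hh; have [x0|x0] := eqVneq (K x x) 0.
    by rewrite (K0 x y x0) mulr0 mul0r subrr.
  by rewrite mulrAC divff// mul1r subrr.
have [gs gsP] := IH K' psdK'.
have sK' : forall y z, K' y z = K' z y by have [] := psdK'.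
(* The induction controls the functions g only on s, and x need not lie in s. Setting them to 0
   where K' y y = 0 settles y = x, and there K' vanishes by Cauchy-Schwarz. *)
exists (h :: [seq (fun y => if K' y y == 0 then 0 else g y) | g <- gs]) => y z ys zs.
rewrite big_cons big_map -[LHS](subrK (h y * h z)) -/(K' y z) addrC; congr (_ + _).
have K'0 u w : K' u u = 0 -> K' u w = 0.
  move=> u0; apply/eqP; rewrite -sqrf_eq0 eq_le sqr_ge0 andbT.
  have := form_cauchy_schwarz psdK' [:: (1, u)] [:: (1, w)].
  by rewrite /form /ev !big_cons !big_nil /= !addr0 !mul1r u0 mul0r.
have [y0|y0] := eqVneq (K' y y) 0.
  by rewrite (K'0 _ _ y0) big1// => g _; rewrite mul0r.
have [z0|z0] := eqVneq (K' z z) 0.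
  by rewrite sK' (K'0 _ _ z0) big1// => g _; rewrite mulr0.
apply: gsP; [case: ys => // xy|case: zs => // xz].
  by move: y0; rewrite -xy K'x eqxx.
by move: z0; rewrite -xz K'x eqxx.
Qed.

Definition kprod T U (K : T -> T -> R) (L : U -> U -> R) (x y : T * U) :=
  K x.1 y.1 * L x.2 y.2.

Lemma eq_ev_in T (F G : T -> R) c :
  (forall x, List.In x [seq p.2 | p <- c] -> F x = G x) -> ev F c = ev G c.
Proof.
elim: c => [|p c IH] FG; rewrite ?ev_nil// !ev_cons FG; last by left.
by rewrite IH// => x xc; apply: FG; right.
Qed.

Lemma psdM T (K L : T -> T -> R) : psd K -> psd L -> psd (fun x y => K x y * L x y).
Proof.
move=> psdK psdL; have [sK _] := psdK; have [sL _] := psdL.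
split=> [x y|c]; first by rewrite sK sL.
have [gs gsP] := psd_gram [seq p.2 | p <- c] psdK.
have -> : form (fun x y => K x y * L x y) c c =
    \sum_(g <- gs) form (fun x y => g x * g y * L x y) c c.
  rewrite /form -ev_sum; apply: eq_ev_in => x xc; rewrite -ev_sum.
  by apply: eq_ev_in => y yc; rewrite gsP// mulr_suml.
by rewrite sumr_ge0// => g _; exact: (psd_rescale g psdL).2.
Qed.

Lemma psd_kprod T U (K : T -> T -> R) (L : U -> U -> R) :
  psd K -> psd L -> psd (kprod K L).
Proof. by move=> pK pL; apply: psdM; apply: psd_pull. Qed.

Lemma psd_prod T I (s : seq I) (K : I -> T -> T -> R) : (forall i, psd (K i)) ->
  psd (fun x y => \prod_(i <- s) K i x y).
Proof.
move=> pK; elim: s => [|i s IH].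
  have := @psd_const T 1 ler01; congr psd; apply/funext => x; apply/funext => y.
  by rewrite big_nil.
have := psdM (pK i) IH; congr psd; apply/funext => x; apply/funext => y.
by rewrite big_cons.
Qed.

Lemma sum_cauchy_schwarz I (s : seq I) (f g : I -> R) :
  (\sum_(i <- s) f i * g i) ^+ 2 <= (\sum_(i <- s) f i ^+ 2) * (\sum_(i <- s) g i ^+ 2).
Proof.
apply: quadratic_nonneg_discr => [|t]; first by apply: sumr_ge0 => i _; exact: sqr_ge0.
rewrite !mulr_sumr -!big_split /=.
apply: sumr_ge0 => i _; have := sqr_ge0 (f i + t * g i).
by congr (0 <= _); ring.
Qed.

Section contraction.
Context {T1 T2 T3 : Type}.
Variables (K1 : T1 -> T1 -> R) (K2 : T2 -> T2 -> R) (K3 : T3 -> T3 -> R).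
Hypotheses (p1 : psd K1) (p2 : psd K2) (p3 : psd K3).

Definition contract (z : comb R (T1 * T2)) (y : comb R (T2 * T3)) :
    comb R (T1 * T3) :=
  [seq (p.1 * l.1 * K2 p.2.2 l.2.1, (p.2.1, l.2.2)) | p <- z, l <- y].

Lemma ev_contract F z y :
  ev F (contract z y) = ev (fun a => ev (fun b => K2 a.2 b.1 * F (a.1, b.2)) y) z.
Proof.
rewrite /contract; elim: z => [|p z IH] /=; first by rewrite !ev_nil.
rewrite ev_cat ev_cons IH; congr (_ + _).
rewrite /ev big_map mulr_sumr; apply: eq_bigr => l _ /=.
by rewrite !mulrA.
Qed.

(* With Gram vectors for the three kernels, [contract] is a product of matrices,
   whose Hilbert-Schmidt norm is submultiplicative. *)
Lemma contract_bound z y :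
  form (kprod K1 K3) (contract z y) (contract z y) <=
  form (kprod K1 K2) z z * form (kprod K2 K3) y y.
Proof.
have [g1 g1P] := psd_gram [seq p.2.1 | p <- z] p1.
have [g2 g2P] := psd_gram ([seq p.2.2 | p <- z] ++ [seq p.2.1 | p <- y]) p2.
have [g3 g3P] := psd_gram [seq p.2.2 | p <- y] p3.
have inz1 x : List.In x [seq p.2 | p <- z] -> List.In x.1 [seq p.2.1 | p <- z].
  by elim: z {g1P g2P} => //= p z IH [<-|/IH]; [left|right].
have inz2 x : List.In x [seq p.2 | p <- z] ->
    List.In x.2 ([seq p.2.2 | p <- z] ++ [seq p.2.1 | p <- y]).
  by elim: z {g1P g2P inz1} => //= p z IH [<-|/IH]; [left|right].
have iny1 x : List.In x [seq p.2 | p <- y] ->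
    List.In x.1 ([seq p.2.2 | p <- z] ++ [seq p.2.1 | p <- y]).
  move=> xy; elim: z {g1P g2P inz1 inz2} => /= [|p z IH]; last by right.
  by elim: y xy {g3P} => //= p y IH [<-|/IH]; [left|right].
have iny2 x : List.In x [seq p.2 | p <- y] -> List.In x.2 [seq p.2.2 | p <- y].
  by elim: y {g3P g2P inz2 iny1} => //= p y IH [<-|/IH]; [left|right].
pose Z (a : T1 -> R) (b : T2 -> R) := ev (fun x => a x.1 * b x.2) z.
pose Y (b : T2 -> R) (c : T3 -> R) := ev (fun x => b x.1 * c x.2) y.
have sq T (s : comb R T) (F : T -> R) :
    ev F s ^+ 2 = ev (fun x => ev (fun x' => F x * F x') s) s.
  by rewrite expr2 -evZ; apply: eq_ev => x; rewrite mulrC -evZ.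
have -> : form (kprod K1 K2) z z = \sum_(a <- g1) \sum_(b <- g2) Z a b ^+ 2.
  rewrite /form; under [RHS]eq_bigr do under eq_bigr do rewrite sq.
  under [RHS]eq_bigr do rewrite -ev_sum; rewrite -ev_sum.
  apply: eq_ev_in => x xz; under [RHS]eq_bigr do rewrite -ev_sum; rewrite -ev_sum.
  apply: eq_ev_in => x' xz'; rewrite /kprod (g1P _ _ (inz1 _ xz) (inz1 _ xz')) (g2P _ _ (inz2 _ xz) (inz2 _ xz')) mulr_suml.
  by apply: eq_bigr => a _; rewrite mulr_sumr; apply: eq_bigr => b _; ring.
have -> : form (kprod K2 K3) y y = \sum_(b <- g2) \sum_(c <- g3) Y b c ^+ 2.
  rewrite /form; under [RHS]eq_bigr do under eq_bigr do rewrite sq.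
  under [RHS]eq_bigr do rewrite -ev_sum; rewrite -ev_sum.
  apply: eq_ev_in => x xy; under [RHS]eq_bigr do rewrite -ev_sum; rewrite -ev_sum.
  apply: eq_ev_in => x' xy'; rewrite /kprod (g2P _ _ (iny1 _ xy) (iny1 _ xy')) (g3P _ _ (iny2 _ xy) (iny2 _ xy')) mulr_suml.
  by apply: eq_bigr => a _; rewrite mulr_sumr; apply: eq_bigr => b _; ring.
have -> : form (kprod K1 K3) (contract z y) (contract z y) =
    \sum_(a <- g1) \sum_(c <- g3) (\sum_(b <- g2) Z a b * Y b c) ^+ 2.
  have ZY a c : \sum_(b <- g2) Z a b * Y b c =
      ev (fun x => a x.1 * c x.2) (contract z y).
    rewrite ev_contract /Z.
    under eq_bigr do rewrite mulrC -evZ.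
    rewrite -ev_sum; apply: eq_ev_in => x xz.
    under eq_bigr do rewrite mulrC -evZ.
    rewrite -ev_sum; apply: eq_ev_in => x' xy /=.
    by rewrite (g2P _ _ (inz2 _ xz) (iny1 _ xy)) mulr_suml; apply: eq_bigr => b _; ring.
  under [RHS]eq_bigr do under eq_bigr do rewrite ZY sq.
  under [RHS]eq_bigr do rewrite -ev_sum; rewrite -ev_sum.
  rewrite /form !ev_contract; apply: eq_ev_in => u uz; apply: eq_ev_in => v vy.
  congr (_ * _); under [RHS]eq_bigr do rewrite -ev_sum; rewrite -ev_sum.
  rewrite !ev_contract; apply: eq_ev_in => u' uz'; apply: eq_ev_in => v' vy'.
  congr (_ * _); rewrite /kprod /= (g1P _ _ (inz1 _ uz) (inz1 _ uz')) (g3P _ _ (iny2 _ vy) (iny2 _ vy')) mulr_suml.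
  by apply: eq_bigr => a _; rewrite mulr_sumr; apply: eq_bigr => b _; ring.
rewrite mulr_suml; apply: ler_sum => a _.
rewrite [X in _ <= _ * X]exchange_big mulr_sumr; apply: ler_sum => c _.
exact: sum_cauchy_schwarz.
Qed.
End contraction.
End kernels.

(** * The q-form on words *)

Section words.
Context {R : realType} {X : eqType} (k : X -> X -> R) (q : R).
Implicit Types (f g x : X) (u v w : seq X) (F : seq X -> R) (c : comb R (seq X)).

(* [rm f w] is the q-annihilation operator applied to the tensor w: the letter w_i is
   removed with weight q^i k(f, w_i). [rmr] removes letters from the right, and [ush m w]
   lists the ways to split w into a subword of length m and its complement, weighted
   by q to the number of crossings. *)
Fixpoint rm f w : comb R (seq X) :=
  if w is x :: w' then (k f x, w') :: [seq (q * p.1, x :: p.2) | p <- rm f w'] else [::].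

Fixpoint rmr f w : comb R (seq X) :=
  if w is x :: w' then
    (q ^+ size w' * k f x, w') :: [seq (p.1, x :: p.2) | p <- rmr f w']
  else [::].

Fixpoint ush m w : comb R (seq X * seq X) :=
  match m, w with
  | 0%N, _ => [:: (1, ([::], w))]
  | m'.+1, [::] => [::]
  | m'.+1, x :: w' => [seq (p.1, (x :: p.2.1, p.2.2)) | p <- ush m' w'] ++
                      [seq (q ^+ m * p.1, (p.2.1, x :: p.2.2)) | p <- ush m w']
  end.

(** The q-inner product, computed by annihilating w with the letters of u one after the other. The
    inductions rely on this form; [qf_perm] recovers the sum over permutations. *)
Fixpoint qf u w : R := if u is f :: u' then ev (qf u') (rm f w) else (nilp w)%:R.

Lemma ev_rm F f x w :
  ev F (rm f (x :: w)) = k f x * F w + q * ev (fun w' => F (x :: w')) (rm f w).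
Proof.
by rewrite ev_cons /= /ev big_map mulr_sumr; congr (_ + _); apply: eq_bigr => p _; rewrite mulrA.
Qed.

Lemma ev_rmr F f x w : ev F (rmr f (x :: w)) =
  q ^+ size w * k f x * F w + ev (fun w' => F (x :: w')) (rmr f w).
Proof. by rewrite ev_cons /= /ev big_map. Qed.

Lemma ev_ushS (G : seq X * seq X -> R) m x w : ev G (ush m.+1 (x :: w)) =
  ev (fun s => G (x :: s.1, s.2)) (ush m w) +
  q ^+ m.+1 * ev (fun s => G (s.1, x :: s.2)) (ush m.+1 w).
Proof.
rewrite [ush _ _]/= ev_cat; congr (_ + _); first by rewrite /ev big_map.
by rewrite /ev big_map mulr_sumr; apply: eq_bigr => p _; rewrite mulrA.
Qed.

Lemma ev_ush0 (G : seq X * seq X -> R) w : ev G (ush 0 w) = G ([::], w).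
Proof. by case: w => [|x w]; rewrite /= ev_cons ev_nil mul1r addr0. Qed.

Lemma ev_ush_nil (G : seq X * seq X -> R) m : ev G (ush m.+1 [::]) = 0.
Proof. exact: ev_nil. Qed.

Lemma size_rm f w p : p \in rm f w -> (size p.2).+1 = size w.
Proof.
elim: w p => //= x w IH p; rewrite inE => /predU1P[->//|/mapP[p' /IH <- ->]//].
Qed.

Lemma ush_perm m w p : p \in ush m w -> size p.2.1 = m /\ perm_eq (p.2.1 ++ p.2.2) w.
Proof.
elim: w m p => [|x w IH] [|m] p //=; try by rewrite inE => /eqP ->; split.
rewrite mem_cat => /orP[] /mapP[p' /IH[<- pw] ->]; split => //=.
  by rewrite perm_cons.
by rewrite -[x :: p'.2.2]cat1s perm_catCA /= perm_cons.
Qed.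

Lemma eq_ev_mem (T : eqType) (F G : T -> R) (c : comb R T) :
  (forall p, p \in c -> F p.2 = G p.2) -> ev F c = ev G c.
Proof. by move=> FG; apply: eq_big_seq => p /FG ->. Qed.

Lemma ev0 (T : Type) (c : comb R T) : ev (fun=> 0) c = 0.
Proof. by rewrite /ev big1// => p _; rewrite mulr0. Qed.

Lemma qf_size u w : size u != size w -> qf u w = 0.
Proof.
elim: u w => [|f u IH] w /=; first by case: w.
move=> uw; rewrite (eq_ev_mem (G := fun=> 0)) ?ev0//.
by move=> p /size_rm pw; apply: IH; rewrite -(inj_eq succn_inj) pw.
Qed.

(** The two removals interact only if the letter met by f stands to the left of the letter met by g.
    In that case whichever is removed second has one letter fewer to cross, so both orders carry the
    same power of q. *)
Lemma rm_rmrC F f g w :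
  ev (fun w' => ev F (rmr f w')) (rm g w) = ev (fun w' => ev F (rm g w')) (rmr f w).
Proof.
elim: w F => [|x w IH] F; first by rewrite !ev_nil.
rewrite ev_rm ev_rmr.
under [X in q * X]eq_ev do rewrite ev_rmr.
under [X in _ = _ + X]eq_ev do rewrite ev_rm.
have H : q * ev (fun w' => q ^+ size w' * k f x * F w') (rm g w) =
    q ^+ size w * k f x * ev F (rm g w).
  rewrite -!evZ; apply: eq_ev_mem => p /size_rm <-; rewrite exprS; ring.
by rewrite !evD !evZ IH mulrDr H addrCA.
Qed.

(** The letter taken by f is chosen either before the other m letters or together with them. Its
    crossings with the complement account for the difference between its position in w and its
    position in the subword. *)
Lemma ush_rm (G : seq X * seq X -> R) m f w :
  ev (fun w' => ev G (ush m w')) (rm f w) =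
  ev (fun s => ev (fun t => G (t, s.2)) (rm f s.1)) (ush m.+1 w).
Proof.
elim: w m G => [|x w IH] m G; first by rewrite !ev_nil.
rewrite ev_rm ev_ushS.
under [X in _ = X + _]eq_ev do rewrite ev_rm.
rewrite evD evZ evZ -addrA; congr (_ + _).
  by congr (_ * _); apply: eq_ev => -[].
case: m => [|m].
  rewrite [ev _ (ush 0 w)]ev_ush0 [ev _ (rm f _.1)]ev_nil mulr0 add0r expr1; congr (_ * _).
  under eq_ev do rewrite ev_ush0; have := IH 0%N (fun s => G (s.1, x :: s.2)).
  by under eq_ev do rewrite ev_ush0.
under eq_ev do rewrite ev_ushS; rewrite evD evZ mulrDr mulrA -exprS IH; congr (_ + _).
by rewrite (IH m.+1 (fun s => G (s.1, x :: s.2))).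
Qed.

(** On both sides the letter met by f is charged for the letters of the complement before it and for
    the letters of the subword after it. *)
Lemma ush_rmr (G : seq X * seq X -> R) m f w :
  ev (fun s => ev (fun t => G (s.1, t)) (rm f s.2)) (ush m w) =
  ev (fun s => ev (fun t => G (t, s.2)) (rmr f s.1)) (ush m.+1 w).
Proof.
elim: w m G => [|x w IH] m G.
  by case: m => [|m]; rewrite ?ev_ush0 ?ev_ush_nil //= ev_nil.
rewrite ev_ushS.
under [X in _ = X + _]eq_ev do rewrite ev_rmr.
rewrite [X in _ = X + _](@eq_ev_mem _ _ (fun s => q ^+ m * k f x * G s +
   ev (fun w' => G (x :: w', s.2)) (rmr f s.1))); last first.
  by move=> [a [s t]] /ush_perm[/= -> _].
rewrite evD evZ; case: m => [|m].
  rewrite !ev_ush0 /= ev_rm expr0 mul1r ev_nil addr0 expr1; congr (_ + _ * _).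
  by have := IH 0%N (fun s => G (s.1, x :: s.2)); rewrite ev_ush0.
rewrite ev_ushS; under [X in _ + _ * X = _]eq_ev do rewrite ev_rm.
rewrite evD !evZ mulrDr /= (IH m (fun s => G (x :: s.1, s.2))) (IH m.+1 (fun s => G (s.1, x :: s.2))).
rewrite [ev (fun s => G (s.1, s.2)) _](@eq_ev _ _ _ G); last by case.
by rewrite [q ^+ m.+2]exprSr; ring.
Qed.

(** The factorization of the q-symmetrizer of a concatenation as a tensor product of two smaller
    symmetrizers times a sum over unshuffles. *)
Lemma qf_cat u v w :
  qf (u ++ v) w = ev (fun s => qf u s.1 * qf v s.2) (ush (size u) w).
Proof.
elim: u w => [|f u IH] w; first by rewrite ev_ush0 /= mul1r.
rewrite /= (eq_ev _ (IH)) ush_rm; apply: eq_ev => s /=.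
by rewrite mulrC -evZ; apply: eq_ev => t; rewrite mulrC.
Qed.

Lemma qf_rcons u f w : qf (rcons u f) w = ev (qf u) (rmr f w).
Proof.
elim: u w => [|g u IH] w /=; last first.
  by under eq_ev do rewrite IH; rewrite rm_rmrC.
elim: w => [|x w IH]; first by rewrite !ev_nil.
rewrite ev_rm ev_rmr /= (ev0 (rm f w)) (ev0 (rmr f w)) mulr0 !addr0.
by case: w {IH} => [|y w]; rewrite ?mul1r// !mulr0.
Qed.

Lemma ev_rm_rcons F f x w : ev F (rm f (rcons w x)) =
  ev (fun w' => F (rcons w' x)) (rm f w) + q ^+ size w * k f x * F w.
Proof.
elim: w F => [|y w IH] F; first by rewrite /= ev_cons !ev_nil expr0 mul1r addr0 add0r.
by rewrite rcons_cons !ev_rm IH mulrDr addrA exprS !mulrA.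
Qed.

Lemma ev_rmr_rev F f w : ev F (rm f (rev w)) = ev (F \o rev) (rmr f w).
Proof.
elim: w F => [|x w IH] F; first by rewrite !ev_nil.
rewrite rev_cons ev_rm_rcons ev_rmr IH addrC size_rev; congr (_ * _ + _).
by apply: eq_ev => u /=; rewrite rev_cons.
Qed.

Lemma qf_rev u w : qf (rev u) (rev w) = qf u w.
Proof.
elim: u w => [|f u IH] w; first by case: w => //= x w; rewrite rev_cons; case: rev.
rewrite rev_cons qf_rcons /= -{2}[w]revK ev_rmr_rev.
by apply: eq_ev => t /=; rewrite -{1}[t]revK IH.
Qed.

Hypothesis kC : forall f g, k f g = k g f.

Lemma qfC u w : qf u w = qf w u.
Proof.
move: {2}(size u + size w)%N (leqnn (size u + size w)) => n.
elim: n u w => [|n IH] [|f u] [|g w] //= uw.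
- by rewrite ev_nil.
- by rewrite ev_nil.
rewrite !ev_rm kC; congr (_ + q * _).
  rewrite IH//; lia.
rewrite (@eq_ev_mem _ _ (fun w' => ev (fun u' => qf w' u') (rm g u))); last first.
  move=> [a t] /size_rm /= pw; have /IH -> // : (size u + size (g :: t) <= n)%N.
  by rewrite /=; lia.
rewrite ev_exchange; apply: eq_ev_mem => -[a t] /size_rm /= pu.
have := IH w (f :: t); rewrite /= => -> //; last by lia.
by apply: eq_ev_mem => -[b t'] /size_rm /= pw; apply: IH; lia.
Qed.

Lemma ev_rm_nth F f x0 w : ev F (rm f w) =
  \sum_(i < size w) q ^+ i * k f (nth x0 w i) * F (take i w ++ drop i.+1 w).
Proof.
elim: w F => [|x w IH] F; first by rewrite ev_nil big_ord0.
rewrite ev_rm big_ord_recl /= expr0 mul1r drop0 IH mulr_sumr; congr (_ + _).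
by apply: eq_bigr => i _; rewrite exprS !mulrA.
Qed.

Lemma inversionsE n (s : 'S_n) :
  inversions s = (\sum_(i < n) \sum_(j < n) ((i < j) && (s j < s i))%N)%N.
Proof.
rewrite /inversions -sum1_card pair_big /= big_mkcond /=.
by apply: eq_bigr => p _; rewrite inE; case: (_ && _).
Qed.

Lemma sum_bump_lt n (j : 'I_n.+1) : (\sum_(c < n) (lift j c < j)%N = j)%N.
Proof.
rewrite (eq_bigr (fun c : 'I_n => ((c < j)%N : nat))); last first.
  by move=> c _; rewrite /= /bump; case: (leqP j c); lia.
have jn : (j <= n)%N by rewrite -ltnS.
rewrite -[RHS]card_ord -[in RHS]sum1_card (big_ord_widen n (fun=> 1%N) jn).
by rewrite [RHS]big_mkcond; apply: eq_bigr => c _; case: ltnP.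
Qed.

Lemma inversions_lift n (j : 'I_n.+1) (s : 'S_n) :
  inversions (lift_perm ord0 j s) = (j + inversions s)%N.
Proof.
rewrite !inversionsE big_ord_recl lift_perm_id; congr (_ + _)%N.
  rewrite big_ord_recl ltnn add0n -[RHS](@sum_bump_lt n j).
  rewrite [RHS](reindex_inj (@perm_inj _ s)).
  by apply: eq_bigr => b _; rewrite lift_perm_lift.
apply: eq_bigr => a _; rewrite big_ord_recl ltn0 add0n.
apply: eq_bigr => b _; rewrite !lift_perm_lift.
congr (nat_of_bool (_ && _)); rewrite /= /bump.
by case: (leqP j (s a)); case: (leqP j (s b)); lia.
Qed.

Definition perm_form x0 n u w :=
  \sum_(s : 'S_n) q ^+ inversions s * \prod_(i < n) k (nth x0 u i) (nth x0 w (s i)).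

Lemma nth_remove x0 w i j :
  nth x0 (take j w ++ drop j.+1 w) i = nth x0 w (bump j i).
Proof.
rewrite nth_cat size_take_min /bump; case: (ltnP i (minn j (size w))) => h.
  by rewrite nth_take; [congr nth|]; lia.
case: (leqP j (size w)) => jw; last first.
  by rewrite !nth_default ?size_drop//; lia.
by rewrite nth_drop; congr nth; lia.
Qed.

Lemma perm_formS x0 n f u w : perm_form x0 n.+1 (f :: u) w =
  \sum_(j < n.+1) q ^+ j * k f (nth x0 w j) *
     perm_form x0 n u (take j w ++ drop j.+1 w).
Proof.
rewrite {1}/perm_form (partition_big (fun s : 'S_n.+1 => s ord0) xpredT) //=.
apply: eq_bigr => j0 _; set i0 : 'I_n.+1 := ord0.
(* Permutations of n + 1 letters sending 0 to j0 correspond to permutations of n letters, as in the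
   expansion of a determinant along a row; sending 0 to j0 creates j0 inversions. *)
rewrite (reindex (lift_perm i0 j0)); last first.
  pose ulsf i (s : 'S_n.+1) k := odflt k (unlift (s i) (s (lift i k))).
  have ulsfK i (s : 'S_n.+1) m: lift (s i) (ulsf i s m) = s (lift i m).
    rewrite /ulsf; have:= neq_lift i m.
    by rewrite -(can_eq (permK s)) => /unlift_some[] ? ? ->.
  have inj_ulsf: injective (ulsf i0 _).
    move=> s; apply: can_inj (ulsf (s i0) s^-1%g) _ => k'.
    by rewrite {1}/ulsf ulsfK !permK liftK.
  exists (fun s => perm (inj_ulsf s)) => [s _ | s].
    by apply/permP=> k'; rewrite permE /ulsf lift_perm_lift lift_perm_id liftK.
  move/(s _ =P _) => si0; apply/permP=> m.
  case: (unliftP i0 m) => [k'|] ->; rewrite ?lift_perm_id //.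
  by rewrite lift_perm_lift -si0 permE ulsfK.
rewrite mulr_sumr; apply: eq_big => [s|s _]; first by rewrite lift_perm_id eqxx.
rewrite inversions_lift exprD big_ord_recl lift_perm_id /= -!mulrA.
congr (_ * _); rewrite mulrCA; congr (_ * (_ * _)).
apply: eq_bigr => i _; rewrite lift_perm_lift; congr (k _ _).
by rewrite nth_remove.
Qed.

Lemma qf_perm x0 u w : size u = size w -> qf u w = perm_form x0 (size u) u w.
Proof.
elim: u w => [|f u IH] w uw.
  have s1 (s : 'S_0) : s = 1%g by apply/permP => -[].
  rewrite /perm_form (bigD1 (1%g : 'S_0))//= [X in _ + X]big1 => [|s]; last first.
    by rewrite (s1 s) eqxx.
  rewrite big_ord0 mulr1 addr0 inversionsE big_ord0 expr0.
  by case: w uw.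
rewrite /= perm_formS (ev_rm_nth _ _ x0) -uw; apply: eq_bigr => j _.
rewrite IH// size_cat size_take_min size_drop -uw; move: (ltn_ord j); rewrite /=; lia.
Qed.

Lemma inversions_div n (s t : 'S_n) : inversions (s^-1 * t) =
  (\sum_(i < n) \sum_(j < n) (((i < j) && ((s i < s j) != (t i < t j)))%N : nat))%N.
Proof.
pose f i j : nat := ((s i < s j) && (t j < t i))%N.
rewrite inversionsE (reindex_inj (@perm_inj _ s)).
under eq_bigr => i _ do rewrite (reindex_inj (@perm_inj _ s)) /=.
under eq_bigr => i _ do under eq_bigr => j _ do rewrite !permM !permK.
transitivity (\sum_(i < n) \sum_(j < n) ((i < j) * f i j + (j < i) * f i j))%N.
  apply: eq_bigr => i _; apply: eq_bigr => j _; rewrite -mulnDl.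
  by case: (ltngtP i j) => [_|_|/val_inj->]; rewrite ?mul1n// /f ltnn.
under eq_bigr => i _ do rewrite big_split /=.
rewrite big_split /= [X in (_ + X)%N]exchange_big -big_split /=.
apply: eq_bigr => i _; rewrite -big_split; apply: eq_bigr => j _ /=.
rewrite -mulnDr; case: (ltngtP i j) => //= ij; rewrite mul1n /f.
have /negP sij : s i != s j by rewrite (inj_eq perm_inj) neq_ltn ij.
have /negP tij : t i != t j by rewrite (inj_eq perm_inj) neq_ltn ij.
case: (ltngtP (s i) (s j)) => [_|_|/val_inj/eqP//];
by case: (ltngtP (t i) (t j)) => [_|_|/val_inj/eqP//].
Qed.

Hypothesis q1 : -1 <= q <= 1.

(* The 2-by-2 kernel is ((1 + q) + (1 - q) e e') / 2 with e, e' = 1 or -1. *)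
Lemma psd_bool T (h : T -> bool) : psd (fun a b => if h a != h b then q else 1).
Proof.
have [q1' q1''] := andP q1.
have p1 : psd (fun _ _ : T => (1 + q) / 2).
  by apply: psd_const; rewrite divr_ge0// -lerBlDl sub0r.
have p2 : psd (fun _ _ : T => (1 - q) / 2).
  by apply: psd_const; rewrite divr_ge0// subr_ge0.
have := psdD p1 (psd_rescale (fun a => (-1) ^+ h a) p2).
congr psd; apply/funext => a; apply/funext => b.
by case: (h a); case: (h b); rewrite /= ?expr1 ?expr0; field.
Qed.

(* The exponent of q in the kernel is the number of pairs ordered differently by
   s and t, so this kernel is a product of [psd_bool] kernels. *)
Lemma psd_inversions n : psd (fun s t : 'S_n => q ^+ inversions (s^-1 * t)).
Proof.
have H (i j : 'I_n) : psd (fun s t : 'S_n =>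
    if (i < j)%N then if (s i < s j)%N != (t i < t j)%N then q else 1 else 1).
  case: (i < j)%N; last exact: psd_const.
  exact: (psd_bool (fun s : 'S_n => (s i < s j)%N)).
have := psd_prod (index_enum 'I_n) (fun i => psd_prod (index_enum 'I_n) (H i)).
congr psd; apply/funext => s; apply/funext => t.
rewrite inversions_div expr_sum; apply: eq_bigr => i _.
rewrite expr_sum; apply: eq_bigr => j _.
by case: ifP => //= _; case: ifP => _; rewrite ?expr0 ?expr1.
Qed.

Hypothesis pk : psd k.

(** Averaging over a second permutation makes the single sum the Gram kernel, up to 1 / n!, of the
    sums of all pairs (s, u). The kernel on such pairs is a Schur product of the inversion kernel
    and n pullbacks of k. *)
Lemma psd_perm_form x0 n : psd (perm_form x0 n).
Proof.
have pL : psd (fun a b : 'S_n * seq X => q ^+ inversions (a.1^-1 * b.1) *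
    \prod_(i < n) k (nth x0 a.2 (a.1 i)) (nth x0 b.2 (b.1 i))).
  apply: psdM; first exact: psd_pull (@psd_inversions n).
  apply: psd_prod => i.
  exact: (psd_pull (fun a : 'S_n * seq X => nth x0 a.2 (a.1 i)) pk).
have := psdM (@psd_const _ (seq X) (n`!%:R^-1) _)
  (psd_comp (fun u => [seq (1, (s, u)) | s <- index_enum 'S_n]) pL).
have n0 : 0 <= n`!%:R^-1 :> R by rewrite invr_ge0.
move/(_ n0); congr psd; apply/funext => u; apply/funext => w.
have E (s : 'S_n) : ev (fun b => q ^+ inversions (s^-1 * b.1) *
    \prod_(i < n) k (nth x0 u (s i)) (nth x0 b.2 (b.1 i)))
    [seq (1, (t, w)) | t <- index_enum 'S_n] = perm_form x0 n u w.
  rewrite /ev big_map (reindex_inj (mulgI s)) /=; apply: eq_bigr => t _.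
  rewrite mul1r mulKg [in RHS](reindex_inj (@perm_inj _ s)); congr (_ * _).
  by apply: eq_bigr => i _; rewrite permM.
rewrite /form [ev _ _]big_map (eq_bigr (fun=> perm_form x0 n u w)) => [|s _]; last first.
  by rewrite mul1r E.
rewrite sumr_const card_Sn -[X in _ * X = _]mulr_natl mulrA mulVf ?mul1r//.
by rewrite pnatr_eq0 -lt0n fact_gt0.
Qed.

Lemma psd_qf : psd qf.
Proof.
split; first exact: qfC.
move=> c; have [->|[p pc]] : c = [::] \/ exists p, p \in c.
  by case: c => [|p c]; [left|right; exists p; rewrite mem_head].
  by rewrite /form ev_nil.
(* [perm_form] needs a default letter; over an empty alphabet the empty word is the only word, and
   the form is constant. *)
have [x0|X0] := pselect (inhabited X); last first.
  have wE (w : seq X) : w = [::] by case: w => // x; case: X0.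
  have -> : form qf c c = form (fun _ _ => 1) c c.
    by apply: eq_ev => u; apply: eq_ev => w; rewrite [u]wE [w]wE.
  exact: (psd_const _ ler01).2.
case: x0 => x0; pose N := (\max_(p <- c) size p.2).+1.
have szN p' : p' \in c -> (size p'.2 < N)%N.
  by move=> pc'; rewrite ltnS (big_rem p' pc') /= leq_maxl.
have -> : form qf c c = \sum_(n < N) form (fun u w => (size u == n)%:R *
    (size w == n)%:R * perm_form x0 n u w) c c.
  rewrite /form -ev_sum; apply: eq_ev_mem => u uc.
  rewrite -ev_sum; apply: eq_ev => w.
  rewrite (bigD1 (Ordinal (szN _ uc)))//= eqxx mul1r big1 ?addr0.
    have [uw|uw] := eqVneq (size u.2) (size w); first by rewrite mul1r (qf_perm x0 uw).
    by rewrite mul0r qf_size.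
  move=> i iu; case: eqP => [e|]; last by rewrite !mul0r.
  by case/eqP: iu; apply: val_inj.
by apply: sumr_ge0 => n _; exact: (psd_rescale _ (psd_perm_form x0 n)).2.
Qed.
End words.

(** * Norm estimates on words *)

Section estimates.
Context {R : realType} {X : eqType} (k : X -> X -> R) (q : R).
Hypotheses (pk : psd k) (q1 : `|q| < 1).
Implicit Types (f g x : X) (u v w : seq X) (F : seq X -> R) (c : comb R (seq X)).
Local Notation rm := (rm k q).
Local Notation ush := (@ush R X q).
Local Notation qf := (qf k q).
Local Notation p := `|q|.

Let q1' : -1 <= q <= 1.
Proof. by rewrite -ler_norml ltW. Qed.

Let kC f g : k f g = k g f. Proof. exact: pk.1. Qed.

Let psdq : psd qf. Proof. exact: psd_qf. Qed.

Definition l1 (T : Type) (c : comb R T) := \sum_(a <- c) `|a.1|.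

(** The sum of |q| to the number of crossings over all subwords of length m is a Gaussian binomial
    coefficient at |q|; this product bounds it uniformly in the length of the word. *)
Definition qprod m := \prod_(i < m) (1 - p ^+ i.+1)^-1.

Let p_lt1 i : 0 < 1 - p ^+ i.+1.
Proof. by rewrite subr_gt0 exprn_ilt1. Qed.

Lemma qprod_ge1 m : 1 <= qprod m.
Proof.
rewrite /qprod; elim: m => [|m IH]; first by rewrite big_ord0.
rewrite big_ord_recr /= -[leLHS]mul1r ler_pM// invf_ge1//.
by rewrite gerBl exprn_ge0.
Qed.

Lemma qprodS m : qprod m.+1 = qprod m + p ^+ m.+1 * qprod m.+1.
Proof. by rewrite /qprod big_ord_recr /=; field; rewrite gt_eqF. Qed.

Lemma qprod_le m n : (m <= n)%N -> qprod m <= qprod n.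
Proof.
elim: n => [|n IH]; first by rewrite leqn0 => /eqP ->.
rewrite leq_eqVlt => /predU1P[->//|]; rewrite ltnS => /IH mn.
apply: (le_trans mn); rewrite [leRHS]qprodS lerDl mulr_ge0 ?exprn_ge0//.
exact: le_trans (qprod_ge1 _).
Qed.

Lemma l1_ush m w : l1 (ush m w) <= qprod m.
Proof.
elim: w m => [|x w IH] [|m].
- by rewrite /l1 big_cons big_nil /= normr1 addr0 qprod_ge1.
- by rewrite /l1 big_nil (le_trans ler01)// qprod_ge1.
- by rewrite /l1 big_cons big_nil /= normr1 addr0 qprod_ge1.
rewrite /l1 /= big_cat !big_map /= qprodS lerD//.
  exact: IH.
under eq_bigr => a _ do rewrite normrM normrX.
by rewrite -mulr_sumr ler_wpM2l ?exprn_ge0//; exact: IH.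
Qed.

(* Weierstrass: once p + p^2 + ... is small from some index on, the tail of the product
   of the 1 - p^i is at least one half. *)
Lemma qprod_bounded : exists2 C, 1 <= C & forall m, qprod m <= C.
Proof.
have p0 : 0 <= p by [].
have gp N n : (1 - p) * (\sum_(i < n) p ^+ (N + i)) <= p ^+ N.
  suff -> : (1 - p) * (\sum_(i < n) p ^+ (N + i)) = p ^+ N - p ^+ (N + n).
    by rewrite gerBl exprn_ge0.
  elim: n => [|n IH]; first by rewrite big_ord0 mulr0 addn0 subrr.
  by rewrite big_ord_recr /= mulrDr IH addnS exprS; ring.
have p1 : 0 < 1 - p by rewrite subr_gt0.
have [N hN] : exists N, p ^+ N.+1 <= (1 - p) / 2.
  have e0 : 0 < (1 - p) / 2 by rewrite divr_gt0.
  have := cvg_expr q1 => /cvgrPdist_lt /(_ _ e0)[N _ /(_ N.+1 (leqnSn N))].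
  by rewrite /= sub0r normrN normrX => /ltW; exists N.
have tail n : 1 / 2 <= \prod_(i < n) (1 - p ^+ (N.+1 + i)).
  have : 1 - \sum_(i < n) p ^+ (N.+1 + i) <= \prod_(i < n) (1 - p ^+ (N.+1 + i)).
    elim: n => [|n IH]; first by rewrite !big_ord0 subr0.
    rewrite !big_ord_recr /=.
    have P1 : \prod_(i < n) (1 - p ^+ (N.+1 + i)) <= 1.
      elim: (n) => [|m IHm]; first by rewrite big_ord0.
      rewrite big_ord_recr /= mulr_ile1//.
      - by apply: prodr_ge0 => i _; rewrite subr_ge0 exprn_ile1// ltW.
      - by rewrite subr_ge0 exprn_ile1// ltW.
      - by rewrite gerBl exprn_ge0.
    have e : 0 <= p ^+ (N.+1 + n) by rewrite exprn_ge0.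
    rewrite -subr_ge0 in P1; have := mulr_ge0 e P1.
    by move: IH; move: (\prod_(i < n) _) (\sum_(i < n) _) (p ^+ _) => P S e'; lra.
  apply: le_trans; suff : \sum_(i < n) p ^+ (N.+1 + i) <= 1 / 2 by lra.
  by rewrite -(ler_pM2l p1) (le_trans (gp _ _))// (le_trans hN)// mul1r.
exists (qprod N * 2) => [|m].
  by have := qprod_ge1 N; lra.
apply: (le_trans (qprod_le (leq_addl N m))).
rewrite /qprod big_split_ord /= ler_wpM2l//.
  by apply: prodr_ge0 => i _; rewrite invr_ge0 ltW.
rewrite prodfV -[leRHS]invrK lef_pV2 ?posrE//.
- by rewrite -[_^-1]mul1r; exact: tail.
- by apply: prodr_gt0 => i _; exact: p_lt1.
- by rewrite invr_gt0.
Qed.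

Lemma l1_scale (T : Type) a (c : comb R T) : l1 (scale_comb a c) = `|a| * l1 c.
Proof. by rewrite /l1 big_map mulr_sumr; apply: eq_bigr => b _; rewrite normrM. Qed.

Lemma l1_cbind (T U : Type) (h : T -> comb R U) (D : R) (c : comb R T) :
  (forall t, l1 (h t) <= D) -> l1 (cbind h c) <= D * l1 c.
Proof.
move=> hD; elim: c => [|a c IH]; first by rewrite /l1 !big_nil mulr0.
rewrite /l1 [cbind _ _]/= big_cat big_cons /= mulrDr lerD//.
by rewrite -/(l1 _) l1_scale mulrC ler_wpM2r.
Qed.

Definition concat (T : Type) (z : comb R (seq T * seq T)) : comb R (seq T) :=
  [seq (a.1, a.2.1 ++ a.2.2) | a <- z].

Lemma ev_concat F z : ev F (concat z) = ev (fun s => F (s.1 ++ s.2)) z.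
Proof. by rewrite /ev big_map. Qed.

Definition split_form m u w := qf (take m u) (take m w) * qf (drop m u) (drop m w).
Definition unshuffle m w : comb R (seq X) := concat (ush m w).
(** A word with fewer than m letters cannot be cut after m letters, so the factorization of [qf]
    through [split_form] holds only once such words are discarded. *)
Definition long_form m u w := if (m <= size u)%N then qf u w else 0.

Lemma psd_split m : psd (split_form m).
Proof.
exact: (psd_pull (fun u => (take m u, drop m u)) (psd_kprod psdq psdq)).
Qed.

Lemma psd_long m : psd (long_form m).
Proof.
have := psd_rescale (fun u => (m <= size u)%:R) psdq.
congr psd; apply/funext => u; apply/funext => w; rewrite /long_form.
have [->|uw] := eqVneq (size u) (size w); last by rewrite qf_size// mulr0 if_same.
by case: leqP; rewrite ?mulr1 ?mul1r ?mul0r.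
Qed.

Lemma form_long_le m c : form (long_form m) c c <= form qf c c.
Proof.
have := psd_rescale (fun u => (size u < m)%:R) psdq => -[_ /(_ c)].
rewrite -(lerD2l (form (long_form m) c c)) addr0; congr (_ <= _).
rewrite /form -evD; apply: eq_ev => u; rewrite -evD; apply: eq_ev => w.
rewrite /long_form.
have [->|uw] := eqVneq (size u) (size w); last by rewrite qf_size// mulr0 if_same addr0.
by case: leqP; rewrite ?mulr1 ?mul1r ?mul0r ?addr0 ?add0r.
Qed.

Lemma split_unshuffle m u w : long_form m u w = ev (split_form m u) (unshuffle m w).
Proof.
rewrite ev_concat /long_form; case: leqP => um.
  rewrite -{1}[u](cat_take_drop m) qf_cat size_takel//; apply: eq_ev_mem.
  move=> [a [s t]] /ush_perm[/= <- _].
  by rewrite /split_form /= take_size_cat// drop_size_cat.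
rewrite (eq_ev_mem (G := fun=> 0)) ?ev0// => -[a [s t]] /ush_perm[/= sm _].
rewrite /split_form /= (take_size_cat _ sm) qf_size; first by rewrite mul0r.
by rewrite sm take_oversize 1?ltnW// neq_ltn um.
Qed.

Lemma form_unshuffle m c d :
  form (split_form m) c (cbind (unshuffle m) d) = form (long_form m) c d.
Proof.
rewrite /form; apply: eq_ev => u; rewrite ev_cbind; apply: eq_ev => w.
by rewrite -split_unshuffle.
Qed.

Lemma unshuffle_sym m c d :
  form (split_form m) (cbind (unshuffle m) c) d =
  form (split_form m) c (cbind (unshuffle m) d).
Proof.
rewrite form_unshuffle formC; last exact: (psd_split m).1.
rewrite form_unshuffle formC//; exact: (psd_long m).1.
Qed.

(* The operator [unshuffle m] is symmetric for the form [split_form m], and its powers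
   grow at most like those of its l^1 norm, which is at most [qprod m]. *)
Lemma long_le_split m c :
  form (long_form m) c c <= qprod m * form (split_form m) c c.
Proof.
have pB := psd_split m; pose Rc j := iter j (cbind (unshuffle m)) c.
have q0 : 0 <= qprod m := le_trans ler01 (qprod_ge1 m).
have sym i j : form (split_form m) (Rc (i + j)%N) c = form (split_form m) (Rc i) (Rc j).
  elim: j i => [|j IH] i; first by rewrite addn0.
  by rewrite addnS -addSn IH /= unshuffle_sym.
rewrite -form_unshuffle formC; last exact: pB.1.
(* All words in the iterates are permutations of words of c. The constant sums over this finite set,
   so that the form is controlled by the l^1 norm of the iterate. *)
apply: (@log_convex_growth _ (fun j => form (split_form m) (Rc j) c) _ _
  (\sum_(w <- flatten [seq permutations a.2 | a <- c]) `|form (split_form m) [:: (1, w)] c| * l1 c)) => //.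
- exact: pB.2.
- rewrite /Rc /= formC; last exact: pB.1.
  by rewrite form_unshuffle (psd_long m).2.
- move=> j; apply: (le_trans (form_cauchy_schwarz pB _ _)).
  by rewrite mulrC mul2n -addnn sym.
move=> j; set S := flatten _.
have [RS lR] : (forall a, a \in Rc j -> a.2 \in S) /\ l1 (Rc j) <= qprod m ^+ j * l1 c.
  elim: j => [|j [IH1 IH2]].
    split; last by rewrite expr0 mul1r.
    move=> a ac; apply/flattenP; exists (permutations a.2); first exact: map_f.
    by rewrite mem_permutations.
  split; last first.
    rewrite exprS -mulrA; apply: (le_trans (l1_cbind (D := qprod m) _ _)).
      by move=> w; rewrite /l1 big_map; exact: l1_ush.
    by rewrite ler_wpM2l.
  move=> a /flattenP[l /mapP[b /IH1 /flattenP[l' /mapP[b' bc' ->]]]].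
  rewrite mem_permutations => bb' -> /mapP[d /mapP[e eu ->]] -> /=.
  apply/flattenP; exists (permutations b'.2); first exact: map_f.
  by rewrite mem_permutations (perm_trans (ush_perm eu).2).
apply: (le_trans (ler_norm _)); rewrite -mulr_suml.
rewrite -mulrA [l1 c * _]mulrC; apply: le_trans (ler_wpM2l _ lR); last first.
  by apply: sumr_ge0.
rewrite mulr_sumr; apply: (le_trans (ler_norm_sum _ _ _)).
rewrite big_seq [leRHS]big_seq; apply: ler_sum => a /RS aS.
rewrite normrM mulrC ler_wpM2r// (big_rem _ aS) /= /form ev_cons ev_nil mul1r addr0.
by rewrite lerDl sumr_ge0.
Qed.

Lemma form_concat m (z : comb R (seq X * seq X)) :
  (forall a, a \in z -> size a.2.1 = m) ->
  form qf (concat z) (concat z) <= qprod m * form (kprod qf qf) z z.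
Proof.
move=> zm; have -> : form (kprod qf qf) z z = form (split_form m) (concat z) (concat z).
  rewrite /form ev_concat; apply: eq_ev_mem => a /zm am.
  rewrite ev_concat; apply: eq_ev_mem => b /zm bm.
  by rewrite /split_form !take_size_cat// !drop_size_cat.
apply: le_trans (long_le_split m _).
rewrite le_eqVlt; apply/orP; left; apply/eqP; rewrite /form.
rewrite !ev_concat; apply: eq_ev_mem => a /zm am; apply: eq_ev => w.
by rewrite /long_form size_cat am leq_addr.
Qed.

(** By [qf_cat], [ush m] is the adjoint of concatenation, hence has the same norm. Concretely, with
    d the unshuffle of c and x its split form, Cauchy-Schwarz gives x^2 <= qprod m * x * form qf c
    c, and one x is cancelled. *)
Lemma form_ush m c :
  form (kprod qf qf) (cbind (ush m) c) (cbind (ush m) c) <= qprod m * form qf c c.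
Proof.
set z := cbind _ c; have zm a : a \in z -> size a.2.1 = m.
  by move=> /flattenP[l /mapP[b _ ->] /mapP[d /ush_perm[<- _] ->]].
have zE : concat z = cbind (unshuffle m) c.
  rewrite /concat /z /cbind map_flatten -map_comp; congr flatten.
  by apply: eq_map => b /=; rewrite /unshuffle /scale_comb -!map_comp.
have q0 : 0 <= qprod m := le_trans ler01 (qprod_ge1 m).
have -> : form (kprod qf qf) z z = form (split_form m) (concat z) (concat z).
  rewrite /form ev_concat; apply: eq_ev_mem => a /zm am.
  rewrite ev_concat; apply: eq_ev_mem => b /zm bm.
  by rewrite /split_form !take_size_cat// !drop_size_cat.
apply: (@le_trans _ _ (qprod m * form (long_form m) c c)); last first.
  by rewrite ler_wpM2l// form_long_le.
rewrite zE; set d := cbind _ c; set x := form _ d d.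
have x0 : 0 <= x by exact: (psd_split m).2.
have xE : x = form (long_form m) d c by rewrite /x form_unshuffle.
have := form_cauchy_schwarz (psd_long m) d c; rewrite -xE => xx.
have := long_le_split m d; rewrite -/x => dx.
have := (psd_long m).2 c => c0.
have [->|xN0] := eqVneq x 0; first by rewrite mulr_ge0.
have xp : 0 < x by rewrite lt_def xN0.
rewrite -(ler_pM2l xp) -expr2 (le_trans xx)// mulrA ler_wpM2r//.
by rewrite (le_trans dx)// mulrC.
Qed.

(* Wick product of two words: a final part of w is contracted against an initial part of
   v, in all possible ways; [wick_part n j] is the part with j contractions. *)
Definition contractw (s : seq X * seq X) v : comb R (seq X) :=
  cbind (fun t => [:: (qf (rev s.2) t.1, s.1 ++ t.2)]) (ush (size s.2) v).

Definition wick w v : comb R (seq X) :=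
  flatten [seq cbind (contractw^~ v) (ush i w) | i <- iota 0 (size w).+1].

Definition wick_part n j (c d : comb R (seq X)) : comb R (seq X) :=
  concat (contract qf
    [seq (a.1, (a.2.1, rev a.2.2)) | a <- cbind (ush (n - j)) c]
    (cbind (ush j) d)).

Let S (G : seq X * seq X -> R) w := \sum_(i < (size w).+1) ev G (ush i w).

Let ush_oversize m w : (size w < m)%N -> ush m w = [::].
Proof.
elim: w m => [|x w IH] [|m] //=; rewrite ltnS => wm.
by rewrite IH// IH// ltnW.
Qed.

Lemma ev_contractw F s v : ev F (contractw s v) =
  ev (fun t => qf (rev s.2) t.1 * F (s.1 ++ t.2)) (ush (size s.2) v).
Proof.
by rewrite ev_cbind; apply: eq_ev => t; rewrite ev_cons ev_nil addr0.
Qed.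

Let ev_wick F w v : ev F (wick w v) = S (fun s => ev F (contractw s v)) w.
Proof.
rewrite /wick /S; have -> : forall ss, ev F (flatten ss) = \sum_(s <- ss) ev F s.
  by elim=> [|s ss IH]; rewrite ?ev_nil ?big_nil// big_cons /= ev_cat IH.
rewrite big_map -{1}[(size w).+1]subn0 -/(index_iota _ _) big_mkord.
by apply: eq_bigr => i _; rewrite ev_cbind.
Qed.

Let S_cons G f w : S G (f :: w) =
  S (fun s => G (f :: s.1, s.2)) w + S (fun s => q ^+ size s.1 * G (s.1, f :: s.2)) w.
Proof.
rewrite /S [size (f :: w)]/= big_ord_recl ev_ush0.
under eq_bigr => i _ do rewrite lift0 ev_ushS.
rewrite big_split /= addrCA; congr (_ + _).
rewrite [RHS]big_ord_recl ev_ush0 /= expr0 mul1r; congr (_ + _).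
rewrite big_ord_recr /= ush_oversize ?ltnSn// ev_nil mulr0 addr0.
apply: eq_bigr => i _; rewrite -evZ; apply: eq_ev_mem => a /ush_perm[-> _].
by rewrite ?lift0.
Qed.

Let S_rm G f w : ev (S G) (rm f w) = S (fun s => ev (fun t => G (t, s.2)) (rm f s.1)) w.
Proof.
rewrite {2}/S big_ord_recl ev_ush0 ev_nil add0r.
under eq_bigr => i _ do rewrite lift0 -ush_rm.
rewrite -ev_sum; apply: eq_ev_mem => -[a t] /size_rm /= tw.
by rewrite /S tw.
Qed.

Let eq_S G G' w : G =1 G' -> S G w = S G' w.
Proof. by move=> GG; apply: eq_bigr => i _; apply: eq_ev. Qed.

Lemma ev_rm_cat F f u v : ev F (rm f (u ++ v)) =
  ev (fun t => F (t ++ v)) (rm f u) + q ^+ size u * ev (fun t => F (u ++ t)) (rm f v).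
Proof.
elim: u F => [|x u IH] F; first by rewrite ev_nil expr0 add0r mul1r.
by rewrite cat_cons !ev_rm IH mulrDr addrA exprS mulrA.
Qed.

Lemma wick_nil F v : ev F (wick [::] v) = F v.
Proof.
rewrite ev_wick /S big_ord_recl big_ord0 addr0 ev_ush0 ev_contractw ev_ush0 /=.
by rewrite mul1r.
Qed.

(** The operator identity L_(f w) = G(f) L_w - L_(a(f) w). When f annihilates a letter of L_w v,
    that letter comes either from w, and the last term removes this contribution, or from v, and
    this is a new contraction. *)
Lemma wick_cons F f w v : ev F (wick (f :: w) v) =
  ev (fun u => F (f :: u)) (wick w v) + ev (fun u => ev F (rm f u)) (wick w v)
  - ev (fun w' => ev F (wick w' v)) (rm f w).
Proof.
rewrite [in LHS]ev_wick [ev _ (wick w v)]ev_wick [ev (fun u => ev F _) _]ev_wick.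
under [X in _ - X]eq_ev do rewrite ev_wick.
rewrite S_rm S_cons -addrA; congr (_ + _).
  by apply: eq_S => s; rewrite !ev_contractw.
apply/eqP; rewrite eq_sym subr_eq; apply/eqP.
rewrite /S -big_split; apply: eq_bigr => i _ /=; rewrite -evD; apply: eq_ev => s.
rewrite !ev_contractw /=.
under eq_ev do rewrite ev_rm_cat mulrDr; rewrite evD addrC; congr (_ + _).
  pose G (t : seq X * seq X) := qf (rev s.2) t.1 * F (s.1 ++ t.2).
  transitivity (q ^+ size s.1 *
      ev (fun t => ev (fun u => G (t.1, u)) (rm f t.2)) (ush (size s.2) v)).
    by rewrite -evZ /G; apply: eq_ev => t /=; rewrite [in RHS]evZ mulrCA.
  rewrite (ush_rmr k q G); congr (_ * _); apply: eq_ev => t.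
  rewrite rev_cons qf_rcons mulrC -evZ; apply: eq_ev => u.
  by rewrite mulrC.
under [RHS]eq_ev do rewrite ev_contractw.
by rewrite /= [RHS]ev_exchange; apply: eq_ev => t /=; rewrite -evZ.
Qed.

Lemma ev_wick_part F n c d : (forall a, a \in c -> size a.2 = n) ->
  ev (fun w => ev (fun v => ev F (wick w v)) d) c =
  \sum_(j < n.+1) ev F (wick_part n j c d).
Proof.
move=> cn; have partE j : ev F (wick_part n j c d) = ev (fun w =>
    ev (fun v => ev (fun s => ev (fun t => qf (rev s.2) t.1 * F (s.1 ++ t.2))
      (ush j v)) (ush (n - j) w)) d) c.
  rewrite /wick_part ev_concat ev_contract.
  rewrite [LHS](ev_map _ (fun s : seq X * seq X => (s.1, rev s.2))) ev_cbind.
  apply: eq_ev => w; rewrite ev_exchange; apply: eq_ev => s /=.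
  by rewrite ev_cbind.
under eq_bigr => j _ do rewrite partE.
rewrite -ev_sum; apply: eq_ev_mem => a ac.
rewrite -ev_sum; apply: eq_ev => v; rewrite ev_wick /S (cn _ ac).
rewrite [LHS](reindex_inj rev_ord_inj); apply: eq_bigr => j _ /=.
rewrite subSS; apply: eq_ev_mem => b bw; rewrite ev_contractw.
have [sb /perm_size] := ush_perm bw; rewrite size_cat sb (cn _ ac) => sb2.
suff -> : size b.2.2 = j by [].
by have := ltn_ord j; lia.
Qed.

(** One factor C is due to the concatenation and one to each of the two unshuffles; the contraction
    costs nothing, and reversing the contracted letters preserves the form. *)
Lemma wick_part_bound n j C c d : (j <= n)%N -> (forall m, qprod m <= C) ->
  (forall a, a \in c -> size a.2 = n) ->
  form qf (wick_part n j c d) (wick_part n j c d) <=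
  C ^+ 3 * (form qf c c * form qf d d).
Proof.
move=> jn qC cn; rewrite /wick_part; set z := map _ _; set y := cbind _ d.
have q0 m : 0 <= qprod m := le_trans ler01 (qprod_ge1 m).
have p1 := psd_kprod psdq psdq.
have C0 : 0 <= C := le_trans (q0 0%N) (qC 0%N).
apply: (le_trans (form_concat (m := n - j) _)).
  move=> a /flattenP[l /mapP[b bz ->] /mapP[e _ ->]] /=.
  move: bz => /mapP[b' /flattenP[l' /mapP[b'' _ ->] /mapP[e' /ush_perm[<- _] ->]] ->] //.
apply: (@le_trans _ _ (C * (form (kprod qf qf) z z * form (kprod qf qf) y y))).
  apply: ler_pM => //; first exact: p1.2.
  exact: contract_bound.
rewrite 2!exprS -!mulrA ler_wpM2l// [leRHS]mulrA [leRHS]mulrACA.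
have -> : form (kprod qf qf) z z =
    form (kprod qf qf) (cbind (ush (n - j)) c) (cbind (ush (n - j)) c).
  pose h (s : seq X * seq X) := (s.1, rev s.2).
  rewrite /form {2}/z [LHS](ev_map _ h); apply: eq_ev => a; rewrite /z [LHS](ev_map _ h); apply: eq_ev => b /=.
  by rewrite /kprod /= qf_rev.
rewrite expr1; apply: ler_pM; try exact: p1.2.
  apply: (le_trans (form_ush _ _)); rewrite ler_wpM2r//; exact: psdq.2.
apply: (le_trans (form_ush _ _)); rewrite ler_wpM2r//; exact: psdq.2.
Qed.

End estimates.

Local Open Scope classical_set_scope.
Local Open Scope complex_scope.

(** * Sequential completeness and extension by density *)

Section seq_complete.
Context {R : realType}.

Definition cauchy_seq (W : normedModType R[i]) (u : nat -> W) :=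
  forall e : R[i], 0 < e -> exists N, forall m n, (N <= m)%N -> (N <= n)%N -> `|u m - u n| <= e.
Definition seq_lim (W : normedModType R[i]) (u : nat -> W) (l : W) :=
  forall e : R[i], 0 < e -> exists N, forall n, (N <= n)%N -> `|u n - l| <= e.
(** Completeness in this form passes from W to [blin V W]; it is used for the operators on the Fock
    space and for the second dual. *)
Definition seq_complete (W : normedModType R[i]) :=
  forall u : nat -> W, cauchy_seq u -> exists l, seq_lim u l.

Lemma seq_complete_cnm (W : completeNormedModType R[i]) : seq_complete W.
Proof.
move=> u cu; have /cauchy_cvg/cvg_ex[l ul] : cauchy (u @ \oo).
  apply: cauchy_exP => e e0; have e2 : 0 < e / 2 by rewrite divr_gt0.
  have [N uN] := cu _ e2; exists (u N), N => // n /= Nn.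
  rewrite -ball_normE /ball_/=; apply: le_lt_trans (uN N n _ Nn) _ => //.
  by rewrite ltr_pdivrMr// ltr_pMr// ltr1n.
exists l => e e0.
have /ul [N _ uN] : nbhs l (ball l e) by exact: nbhsx_ballx.
exists N => n /uN /=; rewrite -ball_normE /ball_/= distrC; exact: ltW.
Qed.

Lemma seq_complete_scalar : seq_complete (R[i]^o).
Proof.
move=> u cu.
have key (h : R[i] -> R) : (forall a b, h (a - b) = h a - h b) ->
    (forall a : R[i], `|h a|%:C <= `|a|) ->
    exists l : R, forall e : R, 0 < e -> exists N, forall n, (N <= n)%N -> `|h (u n) - l| <= e.
  move=> hB hle; have /cauchy_cvg/cvg_ex[l ul] : cauchy (fmap (h \o u) \oo).
    apply: cauchy_exP => e e0; have e2 : 0 < (e / 2)%:C by rewrite ltcR divr_gt0.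
    have [N uN] := cu _ e2; exists (h (u N)), N => // n /= Nn.
    rewrite -ball_normE /ball_/= -hB; apply: (@le_lt_trans _ _ (e / 2)).
      by rewrite -lecR; apply: le_trans (hle _) (uN N n _ Nn).
    by rewrite ltr_pdivrMr// ltr_pMr// ltr1n.
  exists l => e e0.
  have /ul [N _ uN] : nbhs l (ball l e) by exact: nbhsx_ballx.
  exists N => n /uN /=; rewrite -ball_normE /ball_/= distrC; exact: ltW.
have normIm (a : R[i]) : `|complex.Im a|%:C <= `|a|.
  by rewrite normc_def lecR -sqrtr_sqr ler_wsqrtr// lerDr sqr_ge0.
have [a ha] := key (@complex.Re R) (fun a b => raddfB _ a b) (@normc_ge_Re _).
have [b hb] := key (@complex.Im R) (fun a b => raddfB _ a b) normIm.
exists (a +i* b) => e e0.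
have er : e = (complex.Re e)%:C by rewrite RRe_real// gtr0_real.
have e2 : 0 < complex.Re e / 2 by rewrite divr_gt0// -ltcR -er.
have [N1 h1] := ha _ e2; have [N2 h2] := hb _ e2.
exists (maxn N1 N2) => n; rewrite geq_max => /andP[n1 n2].
have -> : u n - (a +i* b) = (complex.Re (u n) - a)%:C + 'i * (complex.Im (u n) - b)%:C.
  by case: (u n) => x y; apply/eqP; rewrite eq_complex /= !mul0r !mul1r; apply/andP; split; apply/eqP; ring.
apply: (le_trans (ler_normD _ _)); rewrite normrM.
have nr (x : R) : `|x%:C| = `|x|%:C.
  by rewrite normc_def /= expr0n addr0 sqrtr_sqr.
have ni : `|'i : R[i]| = 1 by rewrite normc_def /= expr0n expr1n add0r sqrtr1.
rewrite ni mul1r !nr -rmorphD er lecR (splitr (complex.Re e)).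
by rewrite lerD ?h1 ?h2.
Qed.

Lemma limit_norm_le (W : normedModType R[i]) (u : nat -> W) l (y : W) (M : R[i]) N :
  seq_lim u l -> (forall n, (N <= n)%N -> `|u n - y| <= M) -> `|l - y| <= M.
Proof.
move=> ul uM; apply/ler_addgt0Pl => e /ul[N' uN'].
have := uN' _ (leq_maxr N N'); have := uM _ (leq_maxl N N').
set n := maxn _ _ => h1 h2; have -> : l - y = (u n - y) - (u n - l).
  by rewrite opprB [RHS]addrC addrA subrK.
by rewrite [leRHS]addrC (le_trans (ler_normB _ _))// lerD//.
Qed.

Lemma seq_lim_unique (W : normedModType R[i]) (u : nat -> W) l m :
  seq_lim u l -> seq_lim u m -> l = m.
Proof.
move=> ul um; apply/eqP; rewrite -subr_eq0 -normr_le0; apply/ler_addgt0Pl => e e0.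
have [N uN] := um _ e0; rewrite addr0; exact: limit_norm_le ul uN.
Qed.

Lemma mul_div1_le (M e : R[i]) : 0 <= M -> 0 < e -> M * (e / (M + 1)) <= e.
Proof.
move=> M0 e0; rewrite mulrCA ler_piMr//; first exact: ltW.
by rewrite ler_pdivrMr ?ltr_wpDl// mul1r lerDl.
Qed.

Lemma seq_lim_lin (W : normedModType R[i]) (a : R[i]) (u v : nat -> W) l m :
  seq_lim u l -> seq_lim v m -> seq_lim (fun n => a *: u n + v n) (a *: l + m).
Proof.
move=> ul vm e e0; have a0 : 0 < `|a| + 1 by rewrite ltr_wpDl.
have a2 : 0 < 2 * (`|a| + 1) by rewrite mulr_gt0.
have e2 : 0 < e / 2 by rewrite divr_gt0.
have [N1 h1] := ul _ (divr_gt0 e0 a2); have [N2 h2] := vm _ e2.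
exists (maxn N1 N2) => n; rewrite geq_max => /andP[n1 n2].
rewrite opprD addrACA -scalerBr (le_trans (ler_normD _ _))// normrZ.
rewrite [leRHS]splitr lerD ?h2//; apply: (le_trans (ler_wpM2l _ (h1 _ n1))) => //.
by rewrite invfM [e * _]mulrA mul_div1_le//.
Qed.

Lemma seq_lim_norm (W : normedModType R[i]) (u : nat -> W) l M :
  seq_lim u l -> (forall n, `|u n| <= M) -> `|l| <= M.
Proof.
move=> ul uM; rewrite -[l]subr0; apply: (limit_norm_le (N := 0) ul) => n _.
by rewrite subr0.
Qed.

Lemma seq_lim_blin (V W : normedModType R[i]) (T : blin V W) (u : nat -> V) l :
  seq_lim u l -> seq_lim (T \o u) (T l).
Proof.
move=> ul e e0; have T0 : 0 < `|T| + 1 by rewrite ltr_wpDl.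
have [N h] := ul _ (divr_gt0 e0 T0); exists N => n /h hn.
rewrite /= -linearB (le_trans (opnormP _ _))//.
apply: (le_trans (ler_wpM2l (opnorm_ge0 T) hn)); exact: mul_div1_le (opnorm_ge0 T) e0.
Qed.

Lemma cauchy_bounded (W : normedModType R[i]) (u : nat -> W) :
  cauchy_seq u -> exists M : R[i], forall n, `|u n| <= M.
Proof.
move=> /(_ _ ltr01)[N uN]; exists (1 + `|u N| + \sum_(i < N) `|u i|) => n.
case: (leqP N n) => nN.
  rewrite (@le_trans _ _ (1 + `|u N|)) ?lerDl ?sumr_ge0//.
  by rewrite -[u n](subrK (u N)) (le_trans (ler_normD _ _))// lerD// uN.
by rewrite (bigD1 (Ordinal nN))//= addrCA lerDl !addr_ge0// sumr_ge0.
Qed.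

Lemma blin_seq_complete (V W : normedModType R[i]) :
  seq_complete W -> seq_complete (blin V W).
Proof.
move=> cW u cu.
have cx x : cauchy_seq (fun n => u n x).
  move=> e e0; have x0 : 0 < `|x| + 1 by rewrite ltr_wpDl.
  have [N uN] := cu (e / (`|x| + 1)) (divr_gt0 e0 x0).
  exists N => m n Nm Nn; rewrite (_ : u m x - u n x = (u m - u n) x)//.
  rewrite (le_trans (opnormP _ _))// (le_trans (ler_wpM2r _ (uN _ _ Nm Nn)))//.
  by rewrite mulrC mul_div1_le//.
have /choice[L LP] x : exists l, seq_lim (fun n => u n x) l by exact/cW/cx.
have lL : linear L.
  move=> a x y; apply: (seq_lim_unique (LP _)).
  have := seq_lim_lin a (LP x) (LP y); congr (seq_lim _ _).
  by apply/funext => n; rewrite linearP.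
have [M uM] := cauchy_bounded cu.
have LM x : `|L x| <= M * `|x|.
  apply: (seq_lim_norm (LP x)) => n.
  by rewrite (le_trans (opnormP _ _))// ler_wpM2r//; exact: uM.
exists (mk_blin lL LM) => e e0; have [N uN] := cu _ e0.
exists N => n Nn; rewrite distrC; apply: opnorm_le => x x1.
rewrite (_ : (mk_blin lL LM - u n) x = L x - u n x)//.
apply: (limit_norm_le (N := N) (LP x)) => m Nm.
rewrite (_ : u m x - u n x = (u m - u n) x)// (le_trans (opnormP _ _))//.
by rewrite -[leRHS]mulr1 ler_pM ?opnorm_ge0// uN.
Qed.
Lemma seq_lim_inv_succ (W : normedModType R[i]) (u : nat -> W) l :
  (forall n, `|u n - l| <= n.+1%:R^-1) -> seq_lim u l.
Proof.
move=> ul e e0; have er : e = (complex.Re e)%:C by rewrite RRe_real// gtr0_real.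
have r0 : 0 < complex.Re e by rewrite -ltcR -er.
exists (Num.bound (complex.Re e)^-1) => n Nn; apply: (le_trans (ul n)).
rewrite er -[n.+1%:R](rmorph_nat (@real_complex R)) -fmorphV lecR.
rewrite -[leRHS]invrK lef_pV2 ?posrE ?invr_gt0//.
rewrite ltW// (lt_le_trans (archi_boundP _)) ?invr_ge0 1?ltW//.
by rewrite ltr_nat ltnS.
Qed.
End seq_complete.

Section extension.
Context {R : realType} {T : Type}.

Definition evc (V : lmodType R[i]) (g : T -> V) (c : seq (R[i] * T)) :=
  \sum_(p <- c) p.1 *: g p.2.

Lemma evc_cat (V : lmodType R[i]) (g : T -> V) c d : evc g (c ++ d) = evc g c + evc g d.
Proof. exact: big_cat. Qed.
Definition scalec (a : R[i]) (c : seq (R[i] * T)) := [seq (a * p.1, p.2) | p <- c].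
Lemma evc_scale (V : lmodType R[i]) (g : T -> V) a c : evc g (scalec a c) = a *: evc g c.
Proof.
by rewrite /evc big_map scaler_sumr; apply: eq_bigr => p _; rewrite scalerA.
Qed.
Lemma evc_linear (V W : lmodType R[i]) (h : {linear V -> W}) (g : T -> V) c :
  h (evc g c) = evc (h \o g) c.
Proof. by rewrite /evc raddf_sum; apply: eq_bigr => p _ /=; rewrite linearZZ. Qed.

Context {V : normedModType R[i]} (t : T -> V).
Hypothesis dense_t : forall x (e : R[i]), 0 < e -> exists c, `|evc t c - x| <= e.

Lemma approx_seq x : exists c : nat -> seq (R[i] * T), seq_lim (fun n => evc t (c n)) x.
Proof.
have /choice[c cP] (n : nat) : exists c, `|evc t c - x| <= n.+1%:R^-1.
  by apply: dense_t; rewrite invr_gt0.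
by exists c; exact: seq_lim_inv_succ.
Qed.

Lemma blin_ext_dense (W : normedModType R[i]) (S S' : blin V W) :
  (forall w, S (t w) = S' (t w)) -> S = S'.
Proof.
move=> SS; apply: blin_ext => x; have [c cx] := approx_seq x.
apply: (seq_lim_unique (seq_lim_blin S cx)).
have := seq_lim_blin S' cx; congr (seq_lim _ _); apply/funext => n /=.
rewrite !evc_linear; apply: eq_bigr => p _ /=; by rewrite SS.
Qed.

(** The estimate for all formal sums yields well-definedness along with boundedness: the vectors t w
    may satisfy any linear relations, and g has to satisfy them too. *)
Lemma blin_extend (W : normedModType R[i]) (g : T -> W) (M : R[i]) :
  seq_complete W -> 0 <= M -> (forall c, `|evc g c| <= M * `|evc t c|) ->
  exists S : blin V W, (forall w, S (t w) = g w) /\ forall x, `|S x| <= M * `|x|.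
Proof.
move=> cW M0 gM.
have cg c x : seq_lim (fun n => evc t (c n)) x -> cauchy_seq (fun n => evc g (c n)).
  move=> cx e e0; have M1 : 0 < M + M + 1 by rewrite ltr_wpDl// addr_ge0.
  have [N h] := cx (e / (M + M + 1)) (divr_gt0 e0 M1).
  exists N => m n Nm Nn; rewrite -scaleN1r -evc_scale -evc_cat (le_trans (gM _))//.
  rewrite evc_cat evc_scale scaleN1r -[evc t (c m)](subrK x) -addrA.
  rewrite (le_trans (ler_wpM2l M0 (ler_normD _ _)))// [`|x - _|]distrC mulrDr.
  apply: (le_trans (lerD (ler_wpM2l M0 (h _ Nm)) (ler_wpM2l M0 (h _ Nn)))).
  by rewrite -mulrDl mul_div1_le// addr_ge0.
have /choice[S SP] x : exists y, exists c,
    seq_lim (fun n => evc t (c n)) x /\ seq_lim (fun n => evc g (c n)) y.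
  have [c cx] := approx_seq x; have [y yP] := cW _ (cg _ _ cx).
  by exists y, c.
have SU x c : seq_lim (fun n => evc t (c n)) x -> seq_lim (fun n => evc g (c n)) (S x).
  move=> cx; have [d [dx dS]] := SP x; have [y cy] := cW _ (cg _ _ cx).
  suff -> : S x = y by [].
  have cd : seq_lim (fun n => evc t (scalec (-1) (c n) ++ d n)) 0.
    have := seq_lim_lin (-1) cx dx; rewrite scaleN1r addNr; congr (seq_lim _ _).
    by apply/funext => n; rewrite evc_cat evc_scale.
  have : seq_lim (fun n => evc g (scalec (-1) (c n) ++ d n)) (S x - y).
    have := seq_lim_lin (-1) cy dS; rewrite scaleN1r addrC; congr (seq_lim _ _).
    by apply/funext => n; rewrite evc_cat evc_scale.
  move=> gcd; apply/eqP; rewrite -subr_eq0; apply/eqP/(seq_lim_unique gcd) => e e0.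
  have M1 : 0 < M + 1 by rewrite ltr_wpDl.
  have [N h] := cd _ (divr_gt0 e0 M1); exists N => n /h; rewrite !subr0 => hn.
  by rewrite (le_trans (gM _))// (le_trans (ler_wpM2l M0 hn))// mul_div1_le//.
have lS : linear S.
  move=> a x y; have [c [cx cS]] := SP x; have [d [dy dS]] := SP y.
  have /SU : seq_lim (fun n => evc t (scalec a (c n) ++ d n)) (a *: x + y).
    have := seq_lim_lin a cx dy; congr (seq_lim _ _).
    by apply/funext => n; rewrite evc_cat evc_scale.
  move=> /seq_lim_unique; apply; have := seq_lim_lin a cS dS; congr (seq_lim _ _).
  by apply/funext => n; rewrite evc_cat evc_scale.
have bS x : `|S x| <= M * `|x|.
  have [c [cx cS]] := SP x; apply/ler_addgt0Pl => e e0.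
  have M1 : 0 < M + 1 by rewrite ltr_wpDl.
  have [N h] := cx _ (divr_gt0 e0 M1).
  rewrite -[S x]subr0; apply: (limit_norm_le (N := N) cS) => n /h hn.
  rewrite subr0 (le_trans (gM _))// -[evc t (c n)](subrK x).
  rewrite (le_trans (ler_wpM2l M0 (ler_normD _ _)))// mulrDr lerD2r.
  by rewrite (le_trans (ler_wpM2l M0 hn))// mul_div1_le//.
exists (mk_blin lS bS); split=> // w.
have tw : seq_lim (fun _ : nat => evc t [:: (1, w)]) (t w).
  move=> e e0; exists 0%N => n _.
  by rewrite /evc big_cons big_nil addr0 scale1r subrr normr0 ltW.
apply: (seq_lim_unique (SU _ _ tw)) => e e0; exists 0%N => n _.
by rewrite /evc big_cons big_nil addr0 scale1r subrr normr0 ltW.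
Qed.
End extension.

Section complex_facts.
Context {R : realType}.
Local Notation Re := complex.Re.
Local Notation Im := complex.Im.

Lemma normC (x : R) : `|x%:C| = `|x|%:C.
Proof. by rewrite normc_def /= expr0n addr0 sqrtr_sqr. Qed.

Lemma normCi : `|'i : R[i]| = 1.
Proof. by rewrite normc_def /= expr0n expr1n add0r sqrtr1. Qed.

Lemma complexE (z : R[i]) : z = (Re z)%:C + 'i * (Im z)%:C.
Proof.
case: z => x y; apply/eqP; rewrite eq_complex /=; apply/andP; split; apply/eqP; ring.
Qed.

Lemma conjcC (x : R) : ((x%:C)^*)%C = x%:C. Proof. by rewrite /= oppr0. Qed.

Lemma ReC (z : R[i]) : 0 <= z -> z = (Re z)%:C.
Proof. by move=> z0; rewrite RRe_real// ger0_real. Qed.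

Definition evC (T : Type) (V : lmodType R[i]) (g : T -> V) (c : comb R T) :=
  \sum_(p <- c) (p.1)%:C *: g p.2.

(** The bridge from formal identities to vectors and operators: testing with indicator functions
    shows that c and d have the same total coefficient at every point. *)
Lemma evC_transfer (T : eqType) (V : lmodType R[i]) (g : T -> V) (c d : comb R T) :
  (forall F : T -> R, ev F c = ev F d) -> evC g c = evC g d.
Proof.
move=> cd; pose s := undup [seq p.2 | p <- c ++ d].
have E (e : comb R T) : {subset [seq p.2 | p <- e] <= s} ->
    evC g e = \sum_(t <- s) (ev (fun x => (x == t)%:R) e)%:C *: g t.
  move=> es; rewrite /ev; under [RHS]eq_bigr do rewrite rmorph_sum scaler_suml.
  rewrite exchange_big /evC; apply: eq_big_seq => p pe /=.
  have ps : p.2 \in s by apply/es/map_f.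
  rewrite (bigD1_seq p.2)//= ?undup_uniq// eqxx mulr1 big1 ?addr0// => t tp.
  by rewrite eq_sym (negPf tp) mulr0 scale0r.
rewrite !E; first by apply: eq_bigr => t _; rewrite cd.
- by move=> t; rewrite mem_undup map_cat mem_cat orbC => ->.
- by move=> t; rewrite mem_undup map_cat mem_cat => ->.
Qed.

Section evC.
Context {T : Type} {V : lmodType R[i]}.
Implicit Types (g : T -> V) (c d : comb R T).
Lemma evC_nil g : evC g [::] = 0. Proof. exact: big_nil. Qed.
Lemma evC_cons g p c : evC g (p :: c) = (p.1)%:C *: g p.2 + evC g c.
Proof. exact: big_cons. Qed.
Lemma evC_cat g c d : evC g (c ++ d) = evC g c + evC g d.
Proof. exact: big_cat. Qed.
Lemma evC_scale g a c : evC g (scale_comb a c) = a%:C *: evC g c.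
Proof.
by rewrite /evC big_map scaler_sumr; apply: eq_bigr => p _; rewrite rmorphM scalerA.
Qed.
Lemma evC_cbind U (h : U -> comb R T) g (c : comb R U) :
  evC g (cbind h c) = evC (fun x => evC g (h x)) c.
Proof.
elim: c => [|p c IH]; first by rewrite /evC !big_nil.
by rewrite /cbind /= evC_cat -/(cbind h c) IH evC_scale [RHS]/evC big_cons.
Qed.
Lemma eq_evC g g' c : g =1 g' -> evC g c = evC g' c.
Proof. by move=> gg; apply: eq_bigr => p _; rewrite gg. Qed.
Lemma evC_map U (h : U -> T) g (c : comb R U) : evC g [seq (p.1, h p.2) | p <- c] = evC (g \o h) c.
Proof. by rewrite /evC big_map. Qed.
Lemma evC_linear (W : lmodType R[i]) (h : {linear V -> W}) g c :
  h (evC g c) = evC (h \o g) c.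
Proof. by rewrite /evC raddf_sum; apply: eq_bigr => p _ /=; rewrite linearZZ. Qed.
Lemma evC_evc g c : evC g c = evc g [seq ((p.1)%:C, p.2) | p <- c].
Proof. by rewrite /evc big_map. Qed.

Definition rec (c : seq (R[i] * T)) : comb R T := [seq (Re p.1, p.2) | p <- c].
Definition imc (c : seq (R[i] * T)) : comb R T := [seq (Im p.1, p.2) | p <- c].
Lemma evc_reim g (c : seq (R[i] * T)) : evc g c = evC g (rec c) + 'i *: evC g (imc c).
Proof.
rewrite /evC !big_map scaler_sumr -big_split; apply: eq_bigr => p _ /=.
by rewrite {1}[p.1]complexE scalerDl scalerA.
Qed.
End evC.

Lemma le_norm_sqr (V W : normedModType R[i]) (x : V) (y : W) (M : R) :
  0 <= M -> `|x| ^+ 2 <= (M ^+ 2)%:C * `|y| ^+ 2 -> `|x| <= M%:C * `|y|.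
Proof.
move=> M0 h; have M0' : 0 <= M%:C by rewrite lecR.
by rewrite -(@ler_sqr _ `|x|) ?nnegrE ?mulr_ge0// exprMn -rmorphXn.
Qed.
End complex_facts.

Section inner_facts.
Context {R : realType} {E : complexHilbertType R}.
Implicit Types x y z : E.

Lemma inner0r x : inner x 0 = 0.
Proof. by rewrite inner_conj inner0l conjc0. Qed.
Lemma inner_sumr I (s : seq I) (f : I -> E) x :
  inner x (\sum_(i <- s) f i) = \sum_(i <- s) inner x (f i).
Proof.
elim: s => [|i s IH]; first by rewrite !big_nil inner0r.
by rewrite !big_cons innerDr IH.
Qed.
Lemma inner_suml I (s : seq I) (f : I -> E) x :
  inner (\sum_(i <- s) f i) x = \sum_(i <- s) inner (f i) x.
Proof.
elim: s => [|i s IH]; first by rewrite !big_nil inner0l.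
by rewrite !big_cons innerDl IH.
Qed.

Lemma inner_evCr T (g : T -> E) c x :
  inner x (evC g c) = \sum_(p <- c) (p.1)%:C * inner x (g p.2).
Proof. by rewrite inner_sumr; apply: eq_bigr => p _; rewrite innerZr conjcC. Qed.
Lemma inner_evCl T (g : T -> E) c x :
  inner (evC g c) x = \sum_(p <- c) (p.1)%:C * inner (g p.2) x.
Proof. by rewrite inner_suml; apply: eq_bigr => p _; rewrite innerZl. Qed.

Lemma inner_le x y : `|inner x y| <= `|x| * `|y|.
Proof.
have [->|a0] := eqVneq (inner x y) 0; first by rewrite normr0 mulr_ge0.
pose u := ((inner x y)^*)%C / `|inner x y|.
have uE : u * inner x y = `|inner x y|.
  rewrite /u mulrAC [(_^*)%C * _]mulrC -sqr_normc expr2 mulfK// normr_eq0//.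
have u1 : `|u| = 1 by rewrite normrM normfV normr_id normcJ divff// normr_eq0.
have := cauchy_schwarz (u *: x) y; rewrite innerZl uE normrZ u1 mul1r.
rewrite -lecR rmorphM /= !Re_norm => /(le_trans _); apply.
by rewrite -[leLHS]Re_norm lecR ler_norm.
Qed.

Lemma seq_lim_innerl (u : nat -> E) l y :
  seq_lim u l -> seq_lim (fun n => inner (u n) y : R[i]^o) (inner l y).
Proof.
move=> ul e e0; have y0 : 0 < `|y| + 1 by rewrite ltr_wpDl.
have [N h] := ul _ (divr_gt0 e0 y0); exists N => n /h hn.
rewrite -innerNl -innerDl (le_trans (inner_le _ _))// mulrC.
by rewrite (le_trans (ler_wpM2l _ hn))// mul_div1_le.
Qed.
End inner_facts.

(** * Words with real letters in the q-Fock space *)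

Section fock.
Context {R : realType} {H : realHilbertType R} {q : R} (F : qFock H q).
Hypothesis q1 : `|q| < 1.
Implicit Types (f g : H) (u v w : seq H).
Local Notation C := R[i].

Definition kH f g : R := inner f g.

Lemma psd_kH : psd kH.
Proof.
split=> [f g|c]; first by rewrite /kH inner_conj.
have innerD x y z : inner (x + y) z = inner x z + inner y z :> R.
  by have := inner_linear z 1 x y; rewrite scale1r mul1r.
have inner0 z : inner 0 z = 0 :> R.
  by have := inner_linear z (-1) 0 0; rewrite scaler0 addr0 mulN1r addNr.
have innerZ a x z : inner (a *: x) z = a * inner x z :> R.
  by have := inner_linear z a x 0; rewrite addr0 inner0 addr0.
have suml d z : inner (\sum_(p <- d) p.1 *: p.2) z = ev (fun f => kH f z) d.
  elim: d => [|p d IH]; first by rewrite big_nil inner0 ev_nil.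
  by rewrite big_cons innerD innerZ IH ev_cons.
have -> : form kH c c = inner (\sum_(p <- c) p.1 *: p.2) (\sum_(p <- c) p.1 *: p.2).
  rewrite suml /form; apply: eq_ev => f.
  by rewrite /kH inner_conj suml; apply: eq_ev => g; rewrite /kH inner_conj.
by rewrite inner_norm exprn_ge0.
Qed.

Local Notation qfH := (qf kH q).

Let kHC f g : kH f g = kH g f. Proof. exact: psd_kH.1. Qed.
Let q11 : -1 <= q <= 1. Proof. by rewrite -ler_norml ltW. Qed.

Lemma psd_qfH : psd qfH. Proof. exact: psd_qf psd_kH. Qed.

(** Gaussians involve only letters of H, and by multilinearity words in such letters span all
    elementary tensors; their q-inner products are real. *)
Definition real_word w : seq (complexification H) := [seq (f, 0 : H) | f <- w].
Definition tw w : F := tens F (real_word w).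

Lemma inner_tw u w : inner (tw u) (tw w) = (qfH u w)%:C.
Proof.
rewrite tens_inner /q_inner !size_map.
have [uw|uw] := eqVneq (size u) (size w); last by rewrite qf_size.
rewrite (qf_perm _ _ 0 uw) /perm_form rmorph_sum.
apply: eq_bigr => s _; rewrite rmorphM rmorph_prod; congr (_ * _).
apply: eq_bigr => i _; rewrite (nth_map 0) ?(nth_map 0) -?uw//.
rewrite /complex_inner /=.
have inner0 (z : H) : inner 0 z = 0 :> R.
  by have := inner_linear z (-1) 0 0; rewrite scaler0 addr0 mulN1r addNr.
by rewrite !inner0 [inner _ 0]inner_conj inner0 /= subrr addr0.
Qed.

Lemma inner_tw_evC u c : inner (tw u) (evC tw c) = (ev (qfH u) c)%:C.
Proof.
rewrite inner_evCr /ev rmorph_sum; apply: eq_bigr => p _.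
by rewrite inner_tw rmorphM.
Qed.

Lemma inner_evC c d : inner (evC tw c) (evC tw d) = (form qfH c d)%:C.
Proof.
rewrite inner_evCl /form /ev rmorph_sum; apply: eq_bigr => p _.
by rewrite inner_tw_evC rmorphM.
Qed.

Lemma norm_evC c : `|evC tw c| ^+ 2 = (form qfH c c)%:C.
Proof. by rewrite -inner_norm inner_evC. Qed.

Lemma norm_evc (c : seq (C * seq H)) :
  `|evc tw c| ^+ 2 = `|evC tw (rec c)| ^+ 2 + `|evC tw (imc c)| ^+ 2.
Proof.
rewrite evc_reim -!inner_norm innerDl !innerDr !innerZl !innerZr !inner_evC.
rewrite [form qfH (imc c) (rec c)]formC; last exact: (qfC q kHC).
move: (form _ _ _) (form _ _ _) (form _ _ _) => a b d.
by apply/eqP; rewrite eq_complex /=; apply/andP; split; apply/eqP; ring.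
Qed.

Lemma le_sqr_re (a b d : C) : 0 <= a -> 0 <= b -> 0 <= d -> d ^+ 2 = a ^+ 2 + b ^+ 2 ->
  a <= d /\ b <= d.
Proof.
move=> a0 b0 d0 E; split; rewrite -ler_sqr ?nnegrE// E.
  by rewrite lerDl exprn_ge0.
by rewrite lerDr exprn_ge0.
Qed.

Lemma norm_rec (c : seq (C * seq H)) :
  `|evC tw (rec c)| <= `|evc tw c| /\ `|evC tw (imc c)| <= `|evc tw c|.
Proof. by apply: le_sqr_re => //; exact: norm_evc. Qed.

Lemma tens_span (h : seq (complexification H)) w :
  exists c, tens F (real_word w ++ h) = evc tw c.
Proof.
elim: h w => [|x h IH] w.
  by exists [:: (1, w)]; rewrite cats0 /evc big_cons big_nil addr0 scale1r.
have [c1 c1E] := IH (rcons w x.1); have [c2 c2E] := IH (rcons w x.2).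
have rE f : real_word (rcons w f) ++ h = real_word w ++ (f, 0) :: h.
  by rewrite /real_word map_rcons cat_rcons.
exists (scalec 'i c2 ++ c1); rewrite evc_cat evc_scale -c1E -c2E !rE.
rewrite -(tens_linear F); congr (tens F (_ ++ _ :: _)).
case: x {c1 c2 c1E c2E} => a b; rewrite /GRing.scale /= /complexification_scale /=.
by congr pair; rewrite /= ?scale0r ?scaler0 ?scale1r ?subrr ?addr0 ?add0r ?sub0r ?oppr0 ?add0r.
Qed.

Lemma dense_tw (x : F) (e : C) : 0 < e -> exists c, `|evc tw c - x| <= e.
Proof.
move=> e0; have [y] := @tens_dense _ _ _ F (ball x e) (ex_intro _ x (ballxx x e0)) (ball_open x e).
move=> [xy [c _ cE]].
have [d dE] : exists d, evc tw d = y.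
  rewrite -cE; elim: c {cE} => [|p c [d dE]].
    by exists [::]; rewrite /evc !big_nil.
  have [b bE] := tens_span p.2 [::].
  by exists (scalec p.1 b ++ d); rewrite big_cons evc_cat evc_scale dE -bE.
exists d; rewrite dE distrC; apply: ltW.
by move: xy; rewrite -ball_normE.
Qed.

Lemma inner_ext_tw (y z : F) : (forall w, inner (tw w) y = inner (tw w) z) -> y = z.
Proof.
move=> yz; apply: inner_ext => x; have [c cx] := approx_seq dense_tw x.
apply: (@seq_lim_unique _ (R[i]^o) _ _ _ (seq_lim_innerl y cx)).
have := seq_lim_innerl z cx; congr (seq_lim _ _); apply/funext => n.
by rewrite /evc !inner_suml; apply: eq_bigr => p _; rewrite !innerZl yz.
Qed.

Lemma blin_ext_tw (W : normedModType C) (S T : blin F W) :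
  (forall w, S (tw w) = T (tw w)) -> S = T.
Proof. by move=> ST; apply: (blin_ext_dense dense_tw). Qed.

End fock.

(** * Gaussian operators *)

Section formal_gaussian.
Context {R : realType} {X : eqType} (k : X -> X -> R) (q : R).
Hypothesis kC : forall f g, k f g = k g f.
Implicit Types (f g : X) (u v w : seq X) (c d : comb R (seq X)).
Local Notation qf := (qf k q).

Definition gl f w : comb R (seq X) := (1, f :: w) :: rm k q f w.
Definition gr f w : comb R (seq X) := (1, rcons w f) :: rmr k q f w.

Lemma ev_gl F f w : ev F (gl f w) = F (f :: w) + ev F (rm k q f w).
Proof. by rewrite ev_cons mul1r. Qed.
Lemma ev_gr F f w : ev F (gr f w) = F (rcons w f) + ev F (rmr k q f w).
Proof. by rewrite ev_cons mul1r. Qed.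

Lemma gl_adj f u w : ev (qf u) (gl f w) = ev (qf w) (gl f u).
Proof.
rewrite !ev_gl -/(qf (f :: u) w) -/(qf (f :: w) u) addrC.
by rewrite (qfC q kC (f :: u)) (qfC q kC u).
Qed.

Lemma gr_adj f u w : ev (qf u) (gr f w) = ev (qf w) (gr f u).
Proof.
rewrite !ev_gr -!qf_rcons addrC.
by rewrite (qfC q kC (rcons u f)) (qfC q kC u).
Qed.

Lemma form_gl f c d : form qf (cbind (gl f) c) d = form qf c (cbind (gl f) d).
Proof.
rewrite form_cbindl /form; apply: eq_ev => u.
rewrite ev_cbind ev_exchange; apply: eq_ev => v.
by rewrite gl_adj; apply: eq_ev => t; rewrite (qfC q kC).
Qed.

Lemma form_gr f c d : form qf (cbind (gr f) c) d = form qf c (cbind (gr f) d).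
Proof.
rewrite form_cbindl /form; apply: eq_ev => u.
rewrite ev_cbind ev_exchange; apply: eq_ev => v.
by rewrite gr_adj; apply: eq_ev => t; rewrite (qfC q kC).
Qed.

(** Apart from the commuting removals, each operator can annihilate the letter just created by the
    other. These two terms are q^n k(f, g) and q^n k(g, f), with n the length of w. *)
Lemma gl_grC F f g w :
  ev F (cbind (gl f) (gr g w)) = ev F (cbind (gr g) (gl f w)).
Proof.
rewrite !ev_cbind ev_gr ev_gl ev_gl ev_gr /= ev_rm_rcons ev_rmr.
under [X in _ + X = _]eq_ev do rewrite ev_gl.
under [X in _ = _ + X]eq_ev do rewrite ev_gr.
by rewrite !evD rm_rmrC kC; ring.
Qed.
End formal_gaussian.

Section gaussian_ops.
Context {R : realType} {H : realHilbertType R} {q : R} (F : qFock H q).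
Hypothesis q1 : `|q| < 1.
Implicit Types (f g : H) (u v w : seq H).
Local Notation C := R[i].
Local Notation k := (@kH R H).
Local Notation tw := (tw F).
Local Notation qfH := (qf k q).

Let kC f g : k f g = k g f. Proof. exact: psd_kH.1. Qed.
Let psdq : psd qfH. Proof. exact: psd_qfH. Qed.

Lemma complete_fock : seq_complete F.
Proof. exact: seq_complete_cnm. Qed.

Lemma rec_map (T U : Type) (h : T -> U) (c : seq (C * T)) :
  rec [seq (p.1, h p.2) | p <- c] = [seq (p.1, h p.2) | p <- rec c].
Proof. by rewrite /rec -!map_comp. Qed.
Lemma imc_map (T U : Type) (h : T -> U) (c : seq (C * T)) :
  imc [seq (p.1, h p.2) | p <- c] = [seq (p.1, h p.2) | p <- imc c].
Proof. by rewrite /imc -!map_comp. Qed.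

(* The q-form of words with letters in H is real, so real and imaginary parts can be
   estimated separately. *)
Lemma word_map_bound (h : seq H -> seq H) (M : R) : 0 <= M ->
  (forall c, form qfH [seq (p.1, h p.2) | p <- c] [seq (p.1, h p.2) | p <- c] <=
     M ^+ 2 * form qfH c c) ->
  forall c, `|evc (tw \o h) c| <= M%:C * `|evc tw c|.
Proof.
move=> M0 hM c; apply: le_norm_sqr => //.
have -> : evc (tw \o h) c = evc tw [seq (p.1, h p.2) | p <- c].
  by rewrite /evc big_map.
rewrite !norm_evc (rec_map h) (imc_map h) !norm_evC mulrDr -!rmorphM lerD//.
  by rewrite lecR.
by rewrite lecR.
Qed.

Lemma word_map_blin (h : seq H -> seq H) (M : R) : 0 <= M ->
  (forall c, form qfH [seq (p.1, h p.2) | p <- c] [seq (p.1, h p.2) | p <- c] <=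
     M ^+ 2 * form qfH c c) ->
  exists S : blin F F, forall w, S (tw w) = tw (h w).
Proof.
move=> M0 hM; have M0' : 0 <= M%:C by rewrite lecR.
have [S [SE _]] := blin_extend (@dense_tw _ _ _ F) complete_fock M0' (word_map_bound M0 hM).
by exists S.
Qed.

Lemma creation_word f : exists S : blin F F, forall w, S (tw w) = tw (f :: w).
Proof.
(* [qprod q 1] = 1 / (1 - |q|) is the constant of [form_concat] for a first factor of one letter. *)
apply: (@word_map_blin (cons f) (Num.sqrt (qprod q 1 * k f f))) => [|c].
  exact: sqrtr_ge0.
have kff : 0 <= k f f by rewrite /kH inner_norm exprn_ge0.
have q0 : 0 <= qprod q 1 := le_trans ler01 (qprod_ge1 q1 1).
rewrite sqr_sqrtr ?mulr_ge0//.
pose z : comb R (seq H * seq H) := [seq (p.1, ([:: f], p.2)) | p <- c].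
have -> : [seq (p.1, f :: p.2) | p <- c] = concat z by rewrite /concat /z -map_comp.
have zm a : a \in z -> size a.2.1 = 1%N by move=> /mapP[b _ ->].
apply: (le_trans (form_concat psd_kH q1 zm)); rewrite -mulrA ler_wpM2l//.
rewrite le_eqVlt; apply/orP; left; apply/eqP.
pose h u : seq H * seq H := ([:: f], u).
rewrite /form (ev_map _ h) -evZ; apply: eq_ev => u; rewrite /= (ev_map _ h) -evZ.
apply: eq_ev => v; rewrite /kprod /= ev_cons ev_nil /= mulr1 addr0.
by [].
Qed.

(** [creation] selects an operator that is correct on all complex words, so a candidate known on
    real words must be extended letter by letter. *)
Lemma creationE f (S : blin F F) : (forall w, S (tw w) = tw (f :: w)) ->
  forall h, S (tens F h) = tens F ((f, 0) :: h).
Proof.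
move=> SE h; suff H0 w : S (tens F (real_word w ++ h)) =
    tens F ((f, 0) :: real_word w ++ h) by exact: (H0 [::]).
elim: h w => [|x h IH] w; first by rewrite cats0; exact: SE.
have rE g : real_word (rcons w g) ++ h = real_word w ++ (g, 0) :: h.
  by rewrite /real_word map_rcons cat_rcons.
have -> : x = 'i *: ((x.2, 0) : complexification H) + (x.1, 0).
  case: x => a b; rewrite /GRing.scale /= /complexification_scale /=.
  by congr pair; rewrite /= ?scale0r ?scaler0 ?scale1r ?subrr ?addr0 ?add0r ?sub0r ?oppr0 ?add0r.
rewrite (tens_linear F) -cat_cons (tens_linear F) linearP /= -!rE !IH.
by rewrite !rE.
Qed.

Lemma creation_tw f w : creation F (f, 0) (tw w) = tw (f :: w).
Proof.
have [S SE] := creation_word f.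
pose P (T : blin F F) := forall h, T (tens F h) = tens F ((f, 0) :: h).
have exP : exists T, P T by exists S; exact: creationE SE.
exact: (xgetPex (0 : blin F F) exP (real_word w)).
Qed.

Lemma annihilation_tw f w :
  star (creation F (f, 0)) (tw w) = evC tw (rm k q f w).
Proof.
by apply: inner_ext_tw => u; rewrite -starP creation_tw inner_tw inner_tw_evC.
Qed.

Lemma gaussian_tw f w : gaussian F f (tw w) = evC tw (gl k q f w).
Proof.
rewrite evC_cons scale1r -annihilation_tw -creation_tw.
by [].
Qed.

Lemma star_gaussian f : star (gaussian F f) = gaussian F f.
Proof.
have starD (S T : blin F F) : star (S + T) = star S + star T.
  by have := star_conj_linear 1 S T; rewrite rmorph1 !scale1r.
by rewrite /gaussian starD starK addrC.
Qed.

Lemma flip_exists : exists S : blin F F, forall w, S (tw w) = tw (rev w).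
Proof.
apply: (@word_map_blin rev 1) => // c; rewrite expr1n mul1r le_eqVlt.
apply/orP; left; apply/eqP; rewrite /form (ev_map _ rev); apply: eq_ev => u.
by rewrite /= (ev_map _ rev); apply: eq_ev => v; exact: qf_rev.
Qed.

Definition flip : blin F F := sval (cid flip_exists).
Lemma flip_tw w : flip (tw w) = tw (rev w).
Proof. exact: (svalP (cid flip_exists)). Qed.
Lemma flipK : flip * flip = 1.
Proof. by apply: blin_ext_tw => w; rewrite /= !flip_tw revK. Qed.
Lemma star_flip : star flip = flip.
Proof.
apply: blin_ext_tw => w; apply: inner_ext_tw => u; rewrite -starP !flip_tw !inner_tw.
by rewrite -{1}[w]revK qf_rev.
Qed.

(** Conjugation by the reversal of words moves creation and annihilation to the right end. *)
Definition rgaussian f : blin F F := flip * gaussian F f * flip.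

Lemma star_rgaussian f : star (rgaussian f) = rgaussian f.
Proof. by rewrite /rgaussian !starM star_flip star_gaussian mulrA. Qed.

Lemma rgaussian_tw f w : rgaussian f (tw w) = evC tw (gr k q f w).
Proof.
have -> : rgaussian f (tw w) = flip (gaussian F f (flip (tw w))) by [].
rewrite flip_tw gaussian_tw evC_linear.
rewrite (eq_evC _ flip_tw) -[LHS](evC_map rev); apply: evC_transfer => G.
rewrite (ev_map _ rev) ev_gl ev_gr /= rev_cons revK; congr (_ + _).
by rewrite ev_rmr_rev; apply: eq_ev => u /=; rewrite revK.
Qed.

Lemma gaussian_rgaussianC f g : gaussian F f * rgaussian g = rgaussian g * gaussian F f.
Proof.
apply: blin_ext_tw => w.
rewrite (_ : (gaussian F f * rgaussian g) _ = gaussian F f (rgaussian g (tw w)))//.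
rewrite (_ : (rgaussian g * gaussian F f) _ = rgaussian g (gaussian F f (tw w)))//.
rewrite rgaussian_tw gaussian_tw !evC_linear.
rewrite (eq_evC _ (gaussian_tw f)) (eq_evC _ (rgaussian_tw g)) -!evC_cbind.
by apply: evC_transfer => G; exact: gl_grC.
Qed.
End gaussian_ops.

(** * Wick operators *)

Section blin_sums.
Context {R : realType} {V W : normedModType R[i]}.

Lemma blin_sumE I (s : seq I) (g : I -> blin V W) x :
  (\sum_(i <- s) g i) x = \sum_(i <- s) g i x.
Proof. by elim: s => [|i s IH]; rewrite ?big_nil// !big_cons -IH. Qed.

Lemma blin_evC T (g : T -> blin V W) c x : (evC g c) x = evC (fun t => g t x) c.
Proof. by rewrite /evC blin_sumE. Qed.

Lemma blin_evc T (g : T -> blin V W) c x : (evc g c) x = evc (fun t => g t x) c.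
Proof. by rewrite /evc blin_sumE. Qed.

Lemma opnorm_dense T (t : T -> V) (S : blin V W) (M : R[i]) :
  (forall x (e : R[i]), 0 < e -> exists c, `|evc t c - x| <= e) ->
  0 <= M -> (forall c, `|S (evc t c)| <= M * `|evc t c|) -> `|S| <= M.
Proof.
move=> dt M0 SM; apply: opnorm_le => x x1; have [c cx] := approx_seq dt x.
apply/ler_addgt0Pl => e e0; have M1 : 0 < M + 1 by rewrite ltr_wpDl.
have [N h] := cx _ (divr_gt0 e0 M1).
rewrite -[S x]subr0; apply: (limit_norm_le (N := N) (seq_lim_blin S cx)) => n /h hn.
rewrite subr0 /= (le_trans (SM _))// -[evc t (c n)](subrK x).
rewrite (le_trans (ler_wpM2l M0 (ler_normD _ _)))// mulrDr lerD//.
  by rewrite (le_trans (ler_wpM2l M0 hn))// mul_div1_le.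
by rewrite ler_piMr.
Qed.
End blin_sums.

Lemma sum_iota (V : Type) (idx : V) (op : V -> V -> V) n (f : nat -> V) :
  \big[op/idx]_(i <- iota 0 n) f i = \big[op/idx]_(i < n) f i.
Proof. by rewrite -{1}[n]subn0 -/(index_iota 0 n) big_mkord. Qed.

Section flatten_ev.
Context {R : realType} {T : Type}.
Lemma ev_flatten (F : T -> R) ss : ev F (flatten ss) = \sum_(s <- ss) ev F s.
Proof. by elim: ss => [|s ss IH]; rewrite ?ev_nil ?big_nil// big_cons /= ev_cat IH. Qed.
Lemma evC_flatten (V : lmodType R[i]) (g : T -> V) ss :
  evC g (flatten ss) = \sum_(s <- ss) evC g s.
Proof. by elim: ss => [|s ss IH]; rewrite ?evC_nil ?big_nil// big_cons /= evC_cat IH. Qed.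
End flatten_ev.

Section wick_ops.
Context {R : realType} {H : realHilbertType R} {q : R} (F : qFock H q).
Hypothesis q1 : `|q| < 1.
Implicit Types (f g : H) (u v w : seq H).
Local Notation C := R[i].
Local Notation k := (@kH R H).
Local Notation tw := (tw F).
Local Notation qfH := (qf k q).
Local Notation wick := (wick k q).
Local Notation rm := (rm k q).

Let kC f g : k f g = k g f. Proof. exact: psd_kH.1. Qed.
Let psdq : psd qfH. Proof. exact: psd_qfH. Qed.

Definition gprod w : blin F F := foldr (fun f T => gaussian F f * T) 1 w.

(** The recursion of [wick_cons], solved for L_(f w) as a polynomial in Gaussians; this is what
    places Wick operators in C_q. The number n is fuel, since the second branch recurses on words
    with a letter removed from the middle; any n >= size w gives L_w. *)
Fixpoint wcoef n w : comb R (seq H) :=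
  match n, w with
  | n'.+1, f :: w' => [seq (p.1, f :: p.2) | p <- wcoef n' w'] ++
                      scale_comb (-1) (cbind (wcoef n') (rm f w'))
  | _, _ => [:: (1, [::])]
  end.

Definition wickop w : blin F F := evC gprod (wcoef (size w) w).

Lemma wickop_nil : wickop [::] = 1.
Proof. by rewrite /wickop /= evC_cons evC_nil addr0 scale1r. Qed.

Lemma wcoefE n w v : (size w <= n)%N ->
  (evC gprod (wcoef n w)) (tw v) = evC tw (wick w v).
Proof.
have nilE : (evC gprod [:: (1, [::])]) (tw v) = evC tw (wick [::] v).
  rewrite blin_evC evC_cons evC_nil addr0 scale1r.
  transitivity (evC tw [:: (1, v)]); first by rewrite evC_cons evC_nil addr0 scale1r.
  by apply: evC_transfer => G; rewrite wick_nil ev_cons ev_nil mul1r addr0.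
elim: n w => [|n IH] [|f w] //=; rewrite ltnS => wn.
rewrite evC_cat evC_scale.
rewrite (_ : (_ + _ : blin F F) _ = (evC gprod [seq (p.1, f :: p.2) | p <- wcoef n w]) (tw v) +
   (-1)%:C *: (evC gprod (cbind (wcoef n) (rm f w))) (tw v))//.
have -> : (evC gprod [seq (p.1, f :: p.2) | p <- wcoef n w]) (tw v) =
    evC tw (cbind (gl k q f) (wick w v)).
  rewrite (evC_map (cons f)) blin_evC.
  rewrite -[LHS](evC_linear (gaussian F f)) -blin_evC IH// evC_linear evC_cbind.
  by apply: eq_evC => u; exact: gaussian_tw.
have -> : (evC gprod (cbind (wcoef n) (rm f w))) (tw v) =
    evC tw (cbind (wick^~ v) (rm f w)).
  rewrite !evC_cbind blin_evC; apply: eq_big_seq => p /size_rm pw.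
  by rewrite IH// -ltnS pw ltnW.
rewrite -evC_scale -evC_cat; apply: evC_transfer => G.
rewrite ev_cat ev_scale !ev_cbind wick_cons mulN1r; congr (_ - _).
by rewrite -evD; apply: eq_ev => u; rewrite ev_gl.
Qed.

Lemma wickop_tw w v : wickop w (tw v) = evC tw (wick w v).
Proof. exact: wcoefE. Qed.

Lemma wickop_vac w : wickop w (tw [::]) = tw w.
Proof.
rewrite wickop_tw; transitivity (evC tw [:: (1, w)]); last first.
  by rewrite evC_cons evC_nil addr0 scale1r.
apply: evC_transfer => G; rewrite ev_cons ev_nil addr0 mul1r.
have [n] := ubnP (size w); elim: n w G => // n IH [|f w] G; first by rewrite wick_nil.
rewrite ltnS /= => wn; rewrite wick_cons IH// IH// [X in _ - X](eq_ev_mem (G := G)).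
  by rewrite addrK.
by move=> p /size_rm pw; rewrite IH// pw ltnW.
Qed.

Lemma norm_wick_part n j (K : R) c d : (j <= n)%N -> (forall m, qprod q m <= K) ->
  (forall a, a \in c -> size a.2 = n) ->
  `|evC tw (wick_part k q n j c d)| <= (K ^+ 2)%:C * (`|evC tw c| * `|evC tw d|).
Proof.
move=> jn qK cn; have K1 : 1 <= K := le_trans (qprod_ge1 q1 0) (qK 0%N).
have K0 : 0 <= K := le_trans ler01 K1.
rewrite -ler_sqr ?nnegrE ?mulr_ge0 ?lecR ?exprn_ge0//.
rewrite !exprMn !norm_evC -rmorphXn -!rmorphM lecR -exprM.
apply: (le_trans (wick_part_bound psd_kH q1 d jn qK cn)).
apply: ler_wpM2r; first by rewrite mulr_ge0 ?psdq.2.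
(* [wick_part_bound] gives K^3 for the squared norm; raising it to K^4 = (K^2)^2 avoids a square
   root. *)
by rewrite (ler_weXn2l K1).
Qed.

Lemma norm_wickop_homogeneous n (K : R) c d : (forall m, qprod q m <= K) ->
  (forall a, a \in c -> size a.2 = n) ->
  `|(evC wickop c) (evC tw d)| <= (n.+1%:R * K ^+ 2)%:C * (`|evC tw c| * `|evC tw d|).
Proof.
move=> qK cn.
have -> : (evC wickop c) (evC tw d) =
    \sum_(j < n.+1) evC tw (wick_part k q n j c d).
  transitivity (evC tw (flatten [seq wick_part k q n j c d | j <- iota 0 n.+1])).
    rewrite blin_evC; transitivity (evC tw (cbind (fun w => cbind (wick w) d) c)).
      rewrite evC_cbind; apply: eq_evC => w; rewrite evC_linear evC_cbind.
      by apply: eq_evC => v; exact: wickop_tw.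
    apply: evC_transfer => G; rewrite [RHS]ev_flatten [RHS]big_map sum_iota.
    rewrite -ev_wick_part// ev_cbind.
    by apply: eq_ev => w; rewrite ev_cbind.
  by rewrite evC_flatten big_map sum_iota.
rewrite (le_trans (ler_norm_sum _ _ _))//.
rewrite rmorphM rmorph_nat -mulrA mulr_natl -[in leRHS](card_ord n.+1) -sumr_const.
apply: ler_sum => j _; apply: norm_wick_part => //.
by rewrite -ltnS.
Qed.

Lemma norm_filter (P : pred nat) c :
  `|evC tw [seq p <- c | P (size p.2)]| <= `|evC tw c|.
Proof.
rewrite -ler_sqr ?nnegrE// !norm_evC lecR.
have E : forall G : seq H -> R, ev G [seq p <- c | P (size p.2)] =
    ev (fun w => (P (size w))%:R * G w) c.
  move=> G; rewrite /ev big_filter big_mkcond; apply: eq_bigr => p _.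
  by case: ifP => _; rewrite ?mul1r// mul0r mulr0.
have := psd_rescale (fun w => (~~ P (size w))%:R) psdq => -[_ /(_ c)].
rewrite -(lerD2l (form qfH [seq p <- c | P (size p.2)] [seq p <- c | P (size p.2)])).
rewrite addr0; congr (_ <= _); rewrite /form E -evD; apply: eq_ev => u.
rewrite E -evZ -evD; apply: eq_ev => v.
have [->|uv] := eqVneq (size u) (size v); last by rewrite qf_size// !mulr0 addr0.
by case: (P _); rewrite ?mulr1 ?mul1r ?mul0r ?addr0 ?add0r.
Qed.

Lemma sum_arith_geom (r : R) N : 0 <= r < 1 ->
  \sum_(n < N) n.+1%:R * r ^+ n <= ((1 - r) ^+ 2)^-1.
Proof.
move=> /andP[r0 r1]; have r2 : 0 < (1 - r) ^+ 2 by rewrite exprn_gt0// subr_gt0.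
rewrite -[leRHS]mul1r ler_pdivlMr//.
suff -> : (\sum_(n < N) n.+1%:R * r ^+ n) * (1 - r) ^+ 2 =
    1 - (1 + N%:R * (1 - r)) * r ^+ N.
  rewrite gerBl mulr_ge0 ?exprn_ge0// addr_ge0// mulr_ge0// subr_ge0 ltW//.
elim: N => [|N IH]; first by rewrite big_ord0 !mul0r addr0 mul1r expr0 subrr.
by rewrite big_ord_recr /= mulrDl IH [r ^+ N.+1]exprS -natr1; ring.
Qed.

(** Cutting c into homogeneous parts does not increase norms, and r^n makes the factors n + 1
    summable, with sum at most (1 - r)^-2. *)
Lemma norm_wickop (r K : R) c d : 0 <= r < 1 -> (forall m, qprod q m <= K) ->
  `|(evC (fun w => (r ^+ size w)%:C *: wickop w) c) (evC tw d)| <=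
  (K ^+ 2 / (1 - r) ^+ 2)%:C * (`|evC tw c| * `|evC tw d|).
Proof.
move=> r01 qK; have /andP[r0 r1] := r01.
pose N := (\max_(p <- c) size p.2).+1.
pose cn n := [seq p <- c | size p.2 == n].
have -> : evC (fun w => (r ^+ size w)%:C *: wickop w) c =
    \sum_(n < N) (r ^+ n)%:C *: evC wickop (cn n).
  transitivity (evC wickop (flatten [seq scale_comb (r ^+ n) (cn n) | n <- iota 0 N])).
    transitivity (evC wickop (cbind (fun w => [:: (r ^+ size w, w)]) c)).
      by rewrite evC_cbind; apply: eq_evC => w; rewrite evC_cons evC_nil addr0.
    apply: evC_transfer => G; rewrite [RHS]ev_flatten [RHS]big_map sum_iota.
    rewrite ev_cbind.
    under eq_bigr => n _ do rewrite ev_scale.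
    have E n : ev G (cn n) = ev (fun w => (size w == n)%:R * G w) c.
      rewrite /ev big_filter big_mkcond; apply: eq_bigr => p _.
      by case: ifP => _; rewrite ?mul1r// mul0r mulr0.
    under eq_bigr => n _ do rewrite E -evZ.
    rewrite -ev_sum; apply: eq_ev_mem => p pc; rewrite ev_cons ev_nil addr0.
    have pN : (size p.2 < N)%N by rewrite ltnS (big_rem p pc) /= leq_maxl.
    rewrite (bigD1 (Ordinal pN))//= eqxx mul1r big1 ?addr0// => n np.
    rewrite (_ : size p.2 == n = false) ?mul0r ?mulr0//.
    by apply/negbTE; apply: contraNneq np => e; apply/eqP/val_inj.
  rewrite evC_flatten big_map sum_iota.
  by apply: eq_bigr => n _; rewrite evC_scale.
rewrite blin_sumE (le_trans (ler_norm_sum _ _ _))//.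
apply: (@le_trans _ _ (\sum_(n < N) (n.+1%:R * r ^+ n)%:C * ((K ^+ 2)%:C * (`|evC tw c| * `|evC tw d|)))).
  apply: ler_sum => n _.
  rewrite (_ : (_ *: _ : blin F F) _ = (r ^+ n)%:C *: (evC wickop (cn n)) (evC tw d))//.
  rewrite normrZ normC (ger0_norm (exprn_ge0 _ r0)).
  have cnn a : a \in cn n -> size a.2 = n by rewrite mem_filter => /andP[/eqP].
  have rC : 0 <= (r ^+ n)%:C by rewrite lecR exprn_ge0.
  apply: (le_trans (ler_wpM2l rC (norm_wickop_homogeneous d qK cnn))).
  rewrite (_ : _ * ((K ^+ 2)%:C * _) =
      (r ^+ n)%:C * ((n.+1%:R * K ^+ 2)%:C * (`|evC tw c| * `|evC tw d|))).
    rewrite ler_wpM2l// ler_wpM2l//; first by rewrite lecR mulr_ge0 ?exprn_even_ge0.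
    by rewrite ler_wpM2r//; exact: (norm_filter (eq_op^~ n)).
  by rewrite ![(_ * _)%:C]rmorphM; ring.
rewrite -mulr_suml -rmorph_sum mulrA -rmorphM ler_wpM2r ?mulr_ge0// lecR mulrC.
by rewrite ler_wpM2l ?exprn_even_ge0// sum_arith_geom.
Qed.

(* [P] maps xi in the Fock space to the Wick operator of the second quantization of
   r id applied to xi. *)
Definition is_wick_map (r : R) (P : blin F (blin F F)) :=
  forall w, P (tw w) = (r ^+ size w)%:C *: wickop w.

Lemma wick_map_exists (r : R) : 0 <= r < 1 -> exists P, is_wick_map r P.
Proof.
move=> r01; have [K K1 qK] := qprod_bounded q1.
(* The factor 4 collects the real estimates for the real and imaginary parts of both arguments. *)
pose M := K ^+ 2 / (1 - r) ^+ 2 *+ 4.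
have M0 : 0 <= M%:C by rewrite lecR mulrn_wge0// divr_ge0// exprn_even_ge0.
have bound c : `|evc (fun w => (r ^+ size w)%:C *: wickop w) c| <= M%:C * `|evc tw c|.
  apply: (opnorm_dense (@dense_tw _ _ _ F)) => [|d]; first by rewrite mulr_ge0.
  set G := fun w => (r ^+ size w)%:C *: wickop w.
  have -> : (evc G c) (evc tw d) =
      ((evC G (rec c)) (evC tw (rec d)) + 'i *: (evC G (imc c)) (evC tw (rec d))) +
      'i *: ((evC G (rec c)) (evC tw (imc d)) + 'i *: (evC G (imc c)) (evC tw (imc d))).
    by rewrite [evc G c]evc_reim [evc tw d]evc_reim linearD linearZZ.
  have [c1 c2] := norm_rec F c; have [d1 d2] := norm_rec F d.
  have B c' d' : `|evC tw c'| <= `|evc tw c| -> `|evC tw d'| <= `|evc tw d| ->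
      `|(evC G c') (evC tw d')| <=
      (K ^+ 2 / (1 - r) ^+ 2)%:C * (`|evc tw c| * `|evc tw d|).
    move=> hc hd; apply: (le_trans (norm_wickop c' d' r01 qK)).
    by rewrite ler_wpM2l ?ler_pM// lecR divr_ge0// exprn_even_ge0.
  have T (V : normedModType C) (x y : V) b1 b2 : `|x| <= b1 -> `|y| <= b2 -> `|x + 'i *: y| <= b1 + b2.
    move=> hx hy; rewrite (le_trans (ler_normD _ _))// lerD//.
    by rewrite normrZ normCi mul1r.
  apply: (le_trans (T _ _ _ _ _ (T _ _ _ _ _ (B _ _ c1 d1) (B _ _ c2 d1)) (T _ _ _ _ _ (B _ _ c1 d2) (B _ _ c2 d2)))).
  by rewrite /M rmorphMn le_eqVlt; apply/orP; left; apply/eqP; ring.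
have [P [PE _]] := blin_extend (@dense_tw _ _ _ F) (blin_seq_complete (@complete_fock _ _ _ F)) M0 bound.
by exists P.
Qed.

End wick_ops.

(** * Gaussian words and two correlated copies of the alphabet *)

Section formal_words.
Context {R : realType} {X : eqType} (k : X -> X -> R) (q : R).
Implicit Types (f g : X) (u v w : seq X) (c d : comb R (seq X)).
Local Notation gl := (gl k q).
Local Notation gr := (gr k q).
Local Notation qf := (qf k q).

Definition lgauss u c := foldr (fun f d => cbind (gl f) d) c u.
Definition rgauss u c := foldr (fun f d => cbind (gr f) d) c u.
Definition vac : comb R (seq X) := [:: (1, [::])].

Lemma lgauss_cat u v c : lgauss (u ++ v) c = lgauss u (lgauss v c).
Proof. exact: foldr_cat. Qed.
Lemma rgauss_cat u v c : rgauss (u ++ v) c = rgauss u (rgauss v c).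
Proof. exact: foldr_cat. Qed.

Definition comb_eq c d := forall F : seq X -> R, ev F c = ev F d.

Lemma cbind_eq (h : seq X -> comb R (seq X)) c d :
  comb_eq c d -> comb_eq (cbind h c) (cbind h d).
Proof. by move=> cd F; rewrite !ev_cbind. Qed.

Hypothesis pk : psd k.
Let kC f g : k f g = k g f. Proof. exact: pk.1. Qed.

Lemma gl_rgaussC f w c : comb_eq (cbind (gl f) (rgauss w c)) (rgauss w (cbind (gl f) c)).
Proof.
elim: w => [|g w IH] //= F; rewrite -(cbind_eq (gr g) IH F).
by rewrite !ev_cbind; apply: eq_ev => v; rewrite -!ev_cbind; exact: gl_grC.
Qed.

Lemma lgauss_rgaussC u w c : comb_eq (lgauss u (rgauss w c)) (rgauss w (lgauss u c)).
Proof.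
elim: u => [|f u IH] //= F; rewrite (cbind_eq (gl f) IH F).
exact: gl_rgaussC.
Qed.

Lemma form_lgauss u c d : form qf (lgauss u c) d = form qf c (lgauss (rev u) d).
Proof.
elim: u d => [|f u IH] d //=; rewrite (form_gl q kC) IH rev_cons -cats1.
by rewrite lgauss_cat.
Qed.

Lemma form_rgauss u c d : form qf (rgauss u c) d = form qf c (rgauss (rev u) d).
Proof.
elim: u d => [|f u IH] d //=; rewrite (form_gr q kC) IH rev_cons -cats1.
by rewrite rgauss_cat.
Qed.
End formal_words.

Section tagged.
Context {R : realType} {X : eqType} (k : X -> X -> R) (q r : R).
Hypotheses (pk : psd k) (q1 : `|q| < 1) (r01 : 0 <= r <= 1).
Implicit Types (f g : X) (u v w : seq X) (c d : comb R (seq X)).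

(* Two copies of the alphabet, correlated by r. *)
Definition ktag (f g : X * bool) : R := (if f.2 != g.2 then r else 1) * k f.1 g.1.
Definition tag (b : bool) w : seq (X * bool) := [seq (f, b) | f <- w].
Definition tagc (b : bool) c : comb R (seq (X * bool)) := [seq (p.1, tag b p.2) | p <- c].

Lemma psd_ktag : psd ktag.
Proof.
have /andP[r0 r1] := r01; apply: psdM; last exact: (psd_pull fst pk).
apply: (psd_bool (T := X * bool) _ snd).
by rewrite r1 (le_trans _ r0)// lerN10.
Qed.

Lemma ktag_same b f g : ktag (f, b) (g, b) = k f g.
Proof. by rewrite /ktag eqxx mul1r. Qed.

Lemma rm_tag b f w : rm ktag q (f, b) (tag b w) = tagc b (rm k q f w).
Proof.
elim: w => [|x w IH] //=; rewrite ktag_same IH /tagc /=; congr (_ :: _).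
by rewrite -!map_comp.
Qed.
Lemma rmr_tag b f w : rmr ktag q (f, b) (tag b w) = tagc b (rmr k q f w).
Proof.
elim: w => [|x w IH] //=; rewrite ktag_same IH /tagc /= size_map; congr (_ :: _).
by rewrite -!map_comp.
Qed.

Lemma cbind_tag b (h : seq (X * bool) -> comb R (seq (X * bool)))
    (h' : seq X -> comb R (seq X)) c :
  (forall w, h (tag b w) = tagc b (h' w)) -> cbind h (tagc b c) = tagc b (cbind h' c).
Proof.
move=> hh; rewrite /cbind /tagc map_flatten -!map_comp; congr flatten.
by apply: eq_map => p /=; rewrite hh /scale_comb /tagc -!map_comp.
Qed.

Lemma lgauss_tag b u : lgauss ktag q (tag b u) (vac (X:=_)) = tagc b (lgauss k q u (vac (X:=_))).
Proof.
elim: u => [|f u IH] //=; rewrite IH; apply: cbind_tag => w.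
by rewrite /gl rm_tag.
Qed.
Lemma rgauss_tag b u : rgauss ktag q (tag b u) (vac (X:=_)) = tagc b (rgauss k q u (vac (X:=_))).
Proof.
elim: u => [|f u IH] //=; rewrite IH; apply: cbind_tag => w.
by rewrite /gr rmr_tag /tagc /= /tag map_rcons.
Qed.

Definition qfr u w := r ^+ size u * qf k q u w.

(** Every letter is paired with a letter of the other copy and contributes one factor r, so the
    q-form between the two copies is the form of the second quantization of r. *)
Lemma qf_tag u w : qf ktag q (tag false u) (tag true w) = qfr u w.
Proof.
rewrite /qfr; elim: u w => [|f u IH] w; first by rewrite expr0 mul1r; case: w.
have E G : ev G (rm ktag q (f, false) (tag true w)) = r * ev (G \o tag true) (rm k q f w).
  elim: w G => [|x w IHw] G; first by rewrite !ev_nil mulr0.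
  by rewrite /= -/(rm _ _ _ _) [LHS]ev_rm ev_rm IHw /ktag /=; ring.
rewrite [LHS]/= E exprS -mulrA; congr (_ * _); rewrite -evZ; apply: eq_ev => v /=.
exact: IH.
Qed.

(* The kernel is the Gram kernel of the vectors obtained by applying left Gaussian
   operators of the first copy and right Gaussian operators of the second copy. *)
Lemma psd_two_sided : psd (fun a b : seq X * seq X =>
  form qfr (lgauss k q (rev b.1 ++ a.1) (vac (X:=_))) (rgauss k q (rev a.2 ++ b.2) (vac (X:=_)))).
Proof.
pose V (a : seq X * seq X) :=
  lgauss ktag q (tag false a.1) (rgauss ktag q (tag true a.2) (vac (X:=_))).
have pt := psd_ktag.
have pq : psd (qf ktag q).
  by apply: psd_qf => //; rewrite -?ler_norml ?ltW//; exact: pt.1.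
have := psd_comp V pq; congr psd; apply/funext => a; apply/funext => b.
rewrite formC; last exact: pq.1.
rewrite {1}/V (form_lgauss q pt) -lgauss_cat formC; last exact: pq.1.
rewrite [LHS](lgauss_rgaussC q pt) [LHS](form_rgauss q pt) -rgauss_cat.
have revt t w : rev (tag t w) = tag t (rev w) by rewrite /tag map_rev.
have catt t u w : tag t u ++ tag t w = tag t (u ++ w) by rewrite /tag map_cat.
rewrite !revt !catt lgauss_tag rgauss_tag /form /tagc (ev_map _ (tag false)).
by apply: eq_ev => u; rewrite /= (ev_map _ (tag true)); apply: eq_ev => w; exact: qf_tag.
Qed.
End tagged.

(** * Commutants on the q-Fock space *)

Section algebra_facts.
Context {R : realType} {E : complexHilbertType R}.
Local Notation B := (blin E E).
Implicit Types (S T : B) (A : set B).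

Lemma closed_seq_lim A (u : nat -> B) l : closed A -> seq_lim u l -> (forall n, A (u n)) -> A l.
Proof.
move=> cA ul Au; apply: cA => U /nbhs_ballP[e /= e0 eU].
have e2 : 0 < e / 2 by rewrite divr_gt0.
have [N /(_ N (leqnn N)) uN] := ul _ e2.
exists (u N); split=> //; apply: eU; rewrite -ball_normE /ball_/= distrC.
by apply: le_lt_trans uN _; rewrite ltr_pdivrMr// ltr_pMr// ltr1n.
Qed.

Lemma star1 : star (1 : B) = 1.
Proof. by apply/esym/star_unique. Qed.

Lemma star_subalgebra_sum A I (s : seq I) (f : I -> B) (a : I -> R[i]) :
  star_subalgebra A -> (forall i, A (f i)) -> A (\sum_(i <- s) a i *: f i).
Proof.
move=> [A1 AP AM As] Af; have A0 : A 0.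
  by rewrite -(addNr (1 : B)) -scaleN1r; exact: AP.
by elim: s => [|i s IH]; rewrite ?big_nil// big_cons; exact: AP.
Qed.

Lemma von_neumann_commutant (G : set B) : (forall T, G T -> G (star T)) ->
  von_neumann_algebra (commutant G).
Proof.
move=> Gs; split; first exact: commutant_star.
apply/seteqP; split=> S SG.
  move=> T GT; apply: SG => U UG; exact/esym/UG.
by move=> T TG; apply/esym/TG.
Qed.
End algebra_facts.

Section semigroup.
Context {R : realType} {H : realHilbertType R} {q : R} (F : qFock H q).
Hypothesis q1 : `|q| < 1.
Implicit Types (f g : H) (u v w : seq H) (x y : blin F F).
Local Notation C := R[i].
Local Notation k := (@kH R H).
Local Notation tw := (tw F).
Local Notation qfH := (qf k q).
Local Notation gprod := (gprod F).
Local Notation wickop := (wickop F).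
Local Notation rg := (rgaussian F).
Local Notation flip := (flip F).

Let kC f g : k f g = k g f. Proof. exact: psd_kH.1. Qed.
Let psdq : psd qfH. Proof. exact: psd_qfH. Qed.

Definition Om : F := tw [::].
(** Everything about Gamma_q is proved in this algebra, which contains it and in which the vacuum is
    separating ([rcomm_ext]). *)
Definition rcomm : set (blin F F) := commutant (range rg).

Lemma range_rg_star x : range rg x -> range rg (star x).
Proof. by move=> [f _ <-]; exists f => //; rewrite star_rgaussian. Qed.

Lemma rcomm_cstar : cstar_subalgebra rcomm.
Proof. exact/commutant_cstar/range_rg_star. Qed.

Lemma gaussian_rcomm f : rcomm (gaussian F f).
Proof. by move=> _ [g _ <-]; exact: gaussian_rgaussianC. Qed.

Lemma Gamma_q_rcomm x : carrier (Gamma_q F) x -> rcomm x.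
Proof.
apply; split; first exact/von_neumann_commutant/range_rg_star.
by move=> _ [f _ <-]; exact: gaussian_rcomm.
Qed.

Lemma gprod_in (A : set (blin F F)) w : star_subalgebra A ->
  (forall f, A (gaussian F f)) -> A (gprod w).
Proof.
move=> [A1 _ AM _] Ag; elim: w => //= f w IH; exact: AM.
Qed.

Lemma evC_in (A : set (blin F F)) T (g : T -> blin F F) c : star_subalgebra A ->
  (forall t, A (g t)) -> A (evC g c).
Proof. by move=> sA Ag; apply: star_subalgebra_sum. Qed.

Lemma wickop_in (A : set (blin F F)) w : star_subalgebra A ->
  (forall f, A (gaussian F f)) -> A (wickop w).
Proof. by move=> sA Ag; apply: evC_in => // u; exact: gprod_in. Qed.

Lemma wick_map_in (A : set (blin F F)) r P xi : cstar_subalgebra A ->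
  (forall f, A (gaussian F f)) -> is_wick_map r P -> A (P xi).
Proof.
move=> [sA cA] Ag PE; have [c cx] := approx_seq (@dense_tw _ _ _ F) xi.
apply: (closed_seq_lim cA (seq_lim_blin P cx)) => n /=.
rewrite evc_linear; apply: star_subalgebra_sum => // p /=; rewrite PE.
have -> : (r ^+ size p.2)%:C *: wickop p.2 = evC wickop [:: (r ^+ size p.2, p.2)].
  by rewrite evC_cons evC_nil addr0.
by apply: evC_in => // w; exact: wickop_in.
Qed.

Lemma C_q_wick_map r P xi : is_wick_map r P -> carrier (C_q F) (P xi).
Proof.
move=> PE A [cA GA]; apply: (wick_map_in _ cA _ PE) => f; apply: GA; by exists f.
Qed.

Definition rgprod w : blin F F := foldr (fun f T => rg f * T) 1 w.

Lemma rgprodE w : rgprod w = flip * gprod w * flip.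
Proof.
elim: w => [|f w IH] /=; first by rewrite mulr1 flipK.
rewrite IH /rgaussian -!mulrA; congr (_ * (_ * _)).
by rewrite mulrA flipK mul1r.
Qed.

Lemma flip_vac : flip Om = Om. Proof. exact: flip_tw. Qed.

Definition rwickop w : blin F F := flip * wickop (rev w) * flip.

Lemma rwickop_vac w : rwickop w Om = tw w.
Proof.
rewrite (_ : rwickop w Om = flip (wickop (rev w) (flip Om)))//.
by rewrite flip_vac wickop_vac// flip_tw revK.
Qed.

Lemma star_gprod w : star (gprod w) = gprod (rev w).
Proof.
elim: w => [|f w IH] /=; first exact: star1.
rewrite starM star_gaussian IH rev_cons.
elim: (rev w) => [|g v IHv] /=; first by rewrite mul1r mulr1.
by rewrite -mulrA IHv.
Qed.
Lemma star_rgprod w : star (rgprod w) = rgprod (rev w).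
Proof. by rewrite !rgprodE !starM star_flip star_gprod mulrA. Qed.
Lemma gprod_cat u w : gprod (u ++ w) = gprod u * gprod w.
Proof. by elim: u => [|f u IH] /=; rewrite ?mul1r// IH mulrA. Qed.
Lemma rgprod_cat u w : rgprod (u ++ w) = rgprod u * rgprod w.
Proof. by elim: u => [|f u IH] /=; rewrite ?mul1r// IH mulrA. Qed.

Lemma gprod_vac u : gprod u Om = evC tw (lgauss k q u (vac (X:=_))).
Proof.
elim: u => [|f u IH]; first by rewrite /= evC_cons evC_nil addr0 scale1r.
rewrite (_ : gprod (f :: u) Om = gaussian F f (gprod u Om))// IH evC_linear /= evC_cbind.
by apply: eq_evC => w; exact: gaussian_tw.
Qed.
Lemma rgprod_vac u : rgprod u Om = evC tw (rgauss k q u (vac (X:=_))).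
Proof.
elim: u => [|f u IH]; first by rewrite /= evC_cons evC_nil addr0 scale1r.
rewrite (_ : rgprod (f :: u) Om = rg f (rgprod u Om))// IH evC_linear /= evC_cbind.
by apply: eq_evC => w; exact: rgaussian_tw.
Qed.

Lemma rcomm_rgprod x w : rcomm x -> x * rgprod w = rgprod w * x.
Proof.
move=> xM; elim: w => [|f w IH] /=; first by rewrite mulr1 mul1r.
by rewrite mulrA (xM (rg f)) -?mulrA ?IH//; exists f.
Qed.

Lemma rcomm_rwickop x w : rcomm x -> x * rwickop w = rwickop w * x.
Proof.
move=> xM; have -> : rwickop w = evC rgprod (wcoef (q:=q) (size (rev w)) (rev w)).
  rewrite /rwickop /wickop; set c := wcoef _ _; rewrite /evC mulr_sumr mulr_suml.
  by apply: eq_bigr => p _; rewrite blin_scalerMr blin_scalerMl rgprodE.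
rewrite /evC mulr_sumr mulr_suml; apply: eq_bigr => p _.
by rewrite blin_scalerMr blin_scalerMl rcomm_rgprod.
Qed.

(** Right Wick operators commute with x and carry the vacuum to every word, so x is determined by x
    Om. *)
Lemma rcomm_ext x y : rcomm x -> rcomm y -> x Om = y Om -> x = y.
Proof.
move=> xM yM xy; apply: blin_ext_tw => w; rewrite -rwickop_vac.
rewrite (_ : x (rwickop w Om) = (x * rwickop w) Om)//.
rewrite (_ : y (rwickop w Om) = (y * rwickop w) Om)// !rcomm_rwickop//=.
by rewrite xy.
Qed.

Lemma gprod_rcomm u : rcomm (gprod u).
Proof. exact: gprod_in rcomm_cstar.1 gaussian_rcomm. Qed.

Lemma gprod_wick u : gprod u = evC wickop (lgauss k q u (vac (X:=_))).
Proof.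
apply: rcomm_ext; first exact: gprod_rcomm.
  apply: (@evC_in rcomm) => [|w]; first exact: rcomm_cstar.1.
  by apply: wickop_in => [|f]; [exact: rcomm_cstar.1|exact: gaussian_rcomm].
rewrite gprod_vac blin_evC; apply: eq_evC => w.
by rewrite wickop_vac.
Qed.

Lemma dense_tens_span (t : seq H -> F) (c : seq H -> comb R (seq H)) :
  (forall w, tw w = evC t (c w)) ->
  forall (x : F) (e : C), 0 < e -> exists d, `|evc t d - x| <= e.
Proof.
move=> tc x e /(dense_tw x)[d de].
suff [d' dE] : exists d', evc tw d = evc t d' by exists d'; rewrite -dE.
elim: d {de} => [|p d [d' IH]]; first by exists [::]; rewrite /evc !big_nil.
exists (scalec p.1 [seq ((p.1)%:C, p.2) | p <- c p.2] ++ d').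
by rewrite evc_cat evc_scale -evC_evc -tc -IH /evc big_cons.
Qed.

Lemma dense_gprod (x : F) (e : C) : 0 < e -> exists d, `|evc (fun u => gprod u Om) d - x| <= e.
Proof.
apply: (dense_tens_span (c := fun w => wcoef (q:=q) (size w) w)) => w.
by rewrite -blin_evC -/(wickop w) wickop_vac.
Qed.

Lemma dense_rgprod (x : F) (e : C) : 0 < e -> exists d, `|evc (fun u => rgprod u Om) d - x| <= e.
Proof.
apply: (dense_tens_span (c := fun w => wcoef (q:=q) (size (rev w)) (rev w))) => w.
rewrite -blin_evC -[LHS]rwickop_vac; congr (blin_fun _ _).
rewrite /rwickop /wickop; set c := wcoef _ _; rewrite /evC mulr_sumr mulr_suml.
by apply: eq_bigr => p _; rewrite blin_scalerMr blin_scalerMl rgprodE.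
Qed.

End semigroup.

Section scalar_facts.
Context {R : realType}.
Local Notation C := R[i].
Local Notation Re := complex.Re.
Local Notation Im := complex.Im.

Lemma psd_complex T I (K : T -> T -> R) (s : seq I) (z : I -> C) (h : I -> T) : psd K ->
  0 <= \sum_(a <- s) \sum_(b <- s) z a * ((z b)^*)%C * (K (h a) (h b))%:C.
Proof.
move=> [sK pK]; pose x : comb R T := [seq (Re (z a), h a) | a <- s].
pose y : comb R T := [seq (Im (z a), h a) | a <- s].
have E (c d : I -> R) : form K [seq (c a, h a) | a <- s] [seq (d a, h a) | a <- s] =
    \sum_(a <- s) \sum_(b <- s) c a * d b * K (h a) (h b).
  rewrite /form /ev big_map; apply: eq_bigr => a _; rewrite big_map mulr_sumr.
  by apply: eq_bigr => b _; rewrite mulrA.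
have -> : \sum_(a <- s) \sum_(b <- s) z a * ((z b)^*)%C * (K (h a) (h b))%:C =
    (form K x x + form K y y)%:C + 'i * (form K y x - form K x y)%:C.
  rewrite !E -sumrB -big_split !rmorph_sum mulr_sumr -big_split; apply: eq_bigr => a _.
  rewrite -sumrB -big_split !rmorph_sum mulr_sumr -big_split; apply: eq_bigr => b _.
  case: (z a) (z b) => x1 y1 [x2 y2] /=; apply/eqP; rewrite eq_complex /=.
  by apply/andP; split; apply/eqP; ring.
by rewrite [form K x y]formC// subrr mulr0 addr0 lecR addr_ge0.
Qed.

Lemma conjcMl (t : R) (A : C) : ((t%:C * A)^*)%C = t%:C * (A^*)%C.
Proof. by case: A => a b; apply/eqP; rewrite eq_complex /=; apply/andP; split; apply/eqP; ring. Qed.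

Lemma seq_lim_ge0 (u : nat -> C) (l : C) :
  @seq_lim R (C^o) u l -> (forall n, 0 <= u n) -> 0 <= l.
Proof.
move=> ul u0; suff -> : l = `|l| by [].
apply/eqP; rewrite -subr_eq0 -normr_le0; apply/ler_addgt0Pl => e e0; rewrite addr0.
have e2 : 0 < e / 2 by rewrite divr_gt0.
have [N /(_ N (leqnn N)) uN] := ul _ e2.
have -> : l - `|l| = (l - u N) + (`|u N| - `|l|).
  by rewrite (ger0_norm (u0 N)) addrA subrK.
rewrite (le_trans (ler_normD _ _))// [leRHS]splitr lerD//; first by rewrite distrC.
apply: le_trans (ler_dist_dist _ _) _; exact: uN.
Qed.

Lemma seq_lim_sum (V : normedModType C) I (s : seq I) (u : I -> nat -> V) (l : I -> V) :
  (forall i, seq_lim (u i) (l i)) ->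
  seq_lim (fun n => \sum_(i <- s) u i n) (\sum_(i <- s) l i).
Proof.
move=> ul; elim: s => [|i s IH].
  by move=> e e0; exists 0%N => n _; rewrite !big_nil subrr normr0 ltW.
rewrite big_cons -[l i]scale1r; have := seq_lim_lin 1 (ul i) IH; congr (seq_lim _ _).
by apply/funext => n; rewrite big_cons scale1r.
Qed.

Lemma seq_lim_scale (V : normedModType C) a (u : nat -> V) l :
  seq_lim u l -> seq_lim (fun n => a *: u n) (a *: l).
Proof.
move=> ul; have z : seq_lim (fun _ : nat => 0 : V) 0.
  by move=> e e0; exists 0%N => n _; rewrite subrr normr0 ltW.
have := seq_lim_lin a ul z; rewrite addr0; congr (seq_lim _ _).
by apply/funext => n; rewrite addr0.
Qed.

Lemma seq_lim_inner2 (E : complexHilbertType R) (u v : nat -> E) l m :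
  seq_lim u l -> seq_lim v m -> @seq_lim R (C^o) (fun n => inner (u n) (v n)) (inner l m).
Proof.
move=> ul vm e e0.
have [M vM] : exists M : C, forall n, `|v n| <= M.
  apply: cauchy_bounded => d d0; have d2 : 0 < d / 2 by rewrite divr_gt0.
  have [N h] := vm _ d2; exists N => i j Ni Nj.
  rewrite -[v i](subrK m) -addrA (le_trans (ler_normD _ _))// [leRHS]splitr.
  by rewrite lerD ?h// distrC h.
have M0 : 0 <= M by apply: le_trans (vM 0%N).
have e2 : 0 < e / 2 by rewrite divr_gt0.
have [N1 h1] := ul _ (divr_gt0 e2 (ltr_wpDl M0 ltr01)).
have [N2 h2] := vm _ (divr_gt0 e2 (ltr_wpDl (normr_ge0 l) ltr01)).
exists (maxn N1 N2) => n; rewrite geq_max => /andP[n1 n2].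
have -> : inner (u n) (v n) - inner l m = inner (u n - l) (v n) + inner l (v n - m) :> C.
  by rewrite innerDl innerDr innerNl innerNr addrA subrK.
rewrite (le_trans (ler_normD _ _))// [leRHS]splitr lerD// (le_trans (inner_le _ _))//.
  rewrite mulrC; apply: le_trans (mul_div1_le M0 e2).
  by rewrite ler_pM ?vM// h1.
apply: le_trans (mul_div1_le (normr_ge0 l) e2).
by rewrite ler_pM// h2.
Qed.

(** Positivity forces the expression to be real: z = 1 and z = 'i yield B = A^*. The multiples z = t
    A with t real then yield |A|^4 <= D |A|^2 E, from which |A|^2 is cancelled. *)
Lemma positive_2x2 (A B D E : C) : 0 <= E ->
  (forall z : C, 0 <= D + (z^*)%C * A + z * B + `|z| ^+ 2 * E) ->
  B = (A^*)%C /\ `|A| ^+ 2 <= D * E.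
Proof.
move=> E0 h.
have D0 : 0 <= D by have := h 0; rewrite conjc0 normr0 expr0n !mul0r !addr0.
have BA : B = (A^*)%C.
  have im z : Im ((z^*)%C * A + z * B) = 0.
    have := h z; have z0 : 0 <= `|z| ^+ 2 * E by rewrite mulr_ge0 ?exprn_ge0.
    rewrite [D]ReC// [_ * E]ReC// => /ger0_Im.
    case: ((z^*)%C * A) (z * B) => a b [c d] /=; by rewrite add0r addr0.
  have := im 1; have := im 'i; case: (A) (B) => a b [c d] /=.
  rewrite !mul0r !mul1r !mulN1r !oppr0 !mul0r ?subr0 ?add0r ?addr0.
  by move=> h1 h2; apply/eqP; rewrite eq_complex /=; apply/andP; split; apply/eqP; lra.
split=> //.
have AA : `|A| ^+ 2 = (Re (`|A| ^+ 2))%:C by rewrite -ReC// exprn_ge0.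
set a := Re (`|A| ^+ 2) in AA.
have a0 : 0 <= a by rewrite -lecR -AA exprn_ge0.
have [d dE] : exists d, D = d%:C by exists (Re D); exact: ReC.
have [e eE] : exists e, E = e%:C by exists (Re E); exact: ReC.
have d0 : 0 <= d by rewrite -lecR -dE.
have e0 : 0 <= e by rewrite -lecR -eE.
have Q (t : R) : 0 <= d + 2 * t * a + t ^+ 2 * (a * e).
  have := h (t%:C * A); rewrite BA normrM exprMn AA normC -rmorphXn real_normK ?num_real//.
  have -> : ((t%:C * A)^*)%C * A = (t * a)%:C.
    by rewrite conjcMl -mulrA [(A^*)%C * A]mulrC -sqr_normc AA -rmorphM.
  have -> : t%:C * A * (A^*)%C = (t * a)%:C.
    by rewrite -mulrA -sqr_normc AA -rmorphM.
  rewrite dE eE -!rmorphM -!rmorphD lecR; congr (0 <= _); ring.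
have := quadratic_nonneg_discr (mulr_ge0 a0 e0) Q.
rewrite AA dE eE -rmorphM lecR => H1.
have [->|an] := eqVneq a 0; first by rewrite mulr_ge0.
have ap : 0 < a by rewrite lt_def an.
by rewrite -(ler_pM2l ap) -expr2 (le_trans H1)// mulrCA.
Qed.
End scalar_facts.

(** * The second quantization of r *)

Section semigroup_map.
Context {R : realType} {H : realHilbertType R} {q : R} (F : qFock H q).
Hypothesis q1 : `|q| < 1.
Implicit Types (f g : H) (u v w : seq H) (x y : blin F F).
Local Notation C := R[i].
Local Notation k := (@kH R H).
Local Notation tw := (tw F).
Local Notation qfH := (qf k q).
Local Notation gprod := (gprod F).
Local Notation rgprod := (rgprod F).
Local Notation wickop := (wickop F).
Local Notation Om := (Om F).
Local Notation rcomm := (@rcomm R H q F).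
Local Notation vac := (vac (X:=H)).

Variables (r : R) (P : blin F (blin F F)).
Hypotheses (r01 : 0 <= r <= 1) (PE : is_wick_map r P).

Let P_rcomm xi : rcomm (P xi).
Proof. by apply: (wick_map_in _ _ _ PE); [exact: rcomm_cstar|exact: gaussian_rcomm]. Qed.

(** P xi Om is the second quantization of r applied to xi. It may be moved to the other argument
    because words of different lengths are orthogonal. *)
Lemma inner_wick_map xi c :
  inner (P xi Om) (evC tw c) = inner xi (evC (fun u => (r ^+ size u)%:C *: tw u) c).
Proof.
have [d dxi] := approx_seq (@dense_tw _ _ _ F) xi.
have l1 := seq_lim_innerl (evC (fun u => (r ^+ size u)%:C *: tw u) c) dxi.
have POm : linear (fun xi => P xi Om) by move=> a y z; rewrite linearP.
have PM (y : F) : `|P y Om| <= `|P| * `|Om| * `|y|.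
  rewrite (le_trans (opnormP _ _))// [leRHS]mulrAC ler_wpM2r//; exact: (opnormP P y).
have l2 := seq_lim_innerl (evC tw c) (seq_lim_blin (mk_blin POm PM) dxi).
apply: (@seq_lim_unique _ (C^o) _ _ _ l2); move: l1; congr (seq_lim _ _).
apply/funext => n /=; rewrite evc_linear blin_evc /evc !inner_suml.
apply: eq_bigr => p _; rewrite !innerZl /=; congr (_ * _).
rewrite PE (_ : (_ *: _ : blin F F) Om = (r ^+ size p.2)%:C *: wickop p.2 Om)//.
rewrite wickop_vac// !inner_evCr; apply: eq_bigr => b _; congr (_ * _).
rewrite innerZl innerZr conjcC inner_tw.
have [e|e] := eqVneq (size p.2) (size b.2); first by rewrite e.
by rewrite qf_size// !mulr0.
Qed.

Lemma inner_wick_map_rgprod xi w w' :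
  inner (P xi (rgprod w Om)) (rgprod w' Om) = inner (P xi Om) (rgprod (rev w ++ w') Om).
Proof.
rewrite (_ : P xi (rgprod w Om) = (P xi * rgprod w) Om)// rcomm_rgprod//=.
by rewrite starP star_rgprod rgprod_cat.
Qed.

(** The left side becomes a bounded sesquilinear form in the vectors x Om and x' Om. An element of
    the commutant need not be a norm limit of combinations of Gaussian words, but its vacuum vector
    is a limit of theirs, and this suffices for testing positivity. *)
Lemma two_sided w w' : exists Th : blin F F, forall x x', rcomm x -> rcomm x' ->
  inner (P (star x' (x Om)) (rgprod w Om)) (rgprod w' Om) = inner (x Om) (Th (x' Om)).
Proof.
pose c := rgauss k q (rev w ++ w') vac.
exists (evC (fun u => (r ^+ size u)%:C *: rwickop F u) c) => x x' xM xM'.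
rewrite inner_wick_map_rgprod (rgprod_vac F q1) -/c inner_wick_map starPr; congr (inner _ _).
rewrite blin_evC evC_linear; apply: eq_evC => u.
transitivity ((r ^+ size u)%:C *: (rwickop F u * x') Om); last by [].
rewrite -rcomm_rwickop//; transitivity ((r ^+ size u)%:C *: x' (rwickop F u Om)); last by [].
by rewrite rwickop_vac// -linearZZ.
Qed.

Lemma wick_map_words u u' w w' :
  inner (P (star (gprod u') (gprod u Om)) (rgprod w Om)) (rgprod w' Om) =
  (form (qfr k q r) (lgauss k q (rev u' ++ u) vac) (rgauss k q (rev w ++ w') vac))%:C.
Proof.
rewrite inner_wick_map_rgprod star_gprod.
rewrite (_ : gprod (rev u') (gprod u Om) = gprod (rev u' ++ u) Om); last by rewrite gprod_cat.
rewrite (gprod_vac F q1) (rgprod_vac F q1) inner_wick_map inner_evCl /form /ev rmorph_sum.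
apply: eq_bigr => p _; rewrite rmorphM inner_evCr rmorph_sum; congr (_ * _).
apply: eq_bigr => b _; rewrite rmorphM innerZr conjcC inner_tw; congr (_ * _).
rewrite /qfr rmorphM; have [->//|e] := eqVneq (size p.2) (size b.2).
by rewrite qf_size// !mulr0.
Qed.

Lemma wick_map_cp_words n (x : 'I_n -> blin F F) (d : 'I_n -> seq (C * seq H)) :
  (forall i, rcomm (x i)) ->
  0 <= \sum_i \sum_j inner (P (star (x i) (x j Om)) (evc (fun w => rgprod w Om) (d j)))
                       (evc (fun w => rgprod w Om) (d i)).
Proof.
move=> xM.
have /choice[Th ThE] (ww : seq H * seq H) : exists Th : blin F F, forall x x',
    rcomm x -> rcomm x' ->
    inner (P (star x' (x Om)) (rgprod ww.1 Om)) (rgprod ww.2 Om) = inner (x Om) (Th (x' Om)).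
  exact: two_sided.
pose Q (xi : 'I_n -> F) : C := \sum_i \sum_j \sum_(p <- d j) \sum_(p' <- d i)
  (p.1 * (p'.1^*)%C) * inner (xi j) (Th (p.2, p'.2) (xi i)).
have -> : \sum_i \sum_j inner (P (star (x i) (x j Om)) (evc (fun w => rgprod w Om) (d j)))
                       (evc (fun w => rgprod w Om) (d i)) = Q (fun i => x i Om).
  apply: eq_bigr => i _; apply: eq_bigr => j _.
  rewrite evc_linear /evc inner_suml; apply: eq_bigr => p _.
  rewrite inner_sumr; apply: eq_bigr => p' _.
  by rewrite innerZl innerZr mulrA -ThE.
have /choice[c cx] (i : 'I_n) : exists c : nat -> seq (C * seq H),
    seq_lim (fun m => evc (fun u => gprod u Om) (c m)) (x i Om).
  exact: approx_seq (@dense_gprod _ _ _ F q1) _.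
apply: (@seq_lim_ge0 _ (fun m => Q (fun i => evc (fun u => gprod u Om) (c i m)))) => [|m].
  apply: seq_lim_sum => i; apply: seq_lim_sum => j; apply: seq_lim_sum => p.
  apply: seq_lim_sum => p'; apply: (@seq_lim_scale _ (C^o)).
  apply: seq_lim_inner2 => //; exact: seq_lim_blin.
(* A point of the Gram sum is an index together with a term of the left approximant and a term of
   the right vector of that index; the two words go into [psd_two_sided] and the product of the
   coefficients is the weight. *)
pose L := [seq (jc, p) | jc <- [seq (j, a) | j <- index_enum 'I_n, a <- c j m], p <- d jc.1].
have := @psd_complex R _ _ _ L
  (fun a : ('I_n * (C * seq H)) * (C * seq H) => a.1.2.1 * a.2.1)
  (fun a => (a.1.2.2, a.2.2)) (psd_two_sided psd_kH q1 r01).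
congr (0 <= _).
have sumL (G : ('I_n * (C * seq H)) * (C * seq H) -> C) :
    \sum_(a <- L) G a = \sum_j \sum_(a <- c j m) \sum_(p <- d j) G (j, a, p).
  by rewrite /L big_allpairs_dep big_allpairs_dep.
rewrite sumL; under eq_bigr => j _ do under eq_bigr => a _ do under eq_bigr => p _ do rewrite sumL.
rewrite /Q [RHS]exchange_big; apply: eq_bigr => j _.
under eq_bigr => a _ do rewrite exchange_big /=.
rewrite exchange_big; apply: eq_bigr => i _.
rewrite exchange_big; apply: eq_bigr => p _.
pose K' (a b : seq H * seq H) := form (qfr k q r) (lgauss k q (rev b.1 ++ a.1) vac)
  (rgauss k q (rev a.2 ++ b.2) vac).
transitivity (\sum_(p' <- d i) \sum_(a <- c j m) \sum_(b <- c i m)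
   a.1 * p.1 * ((b.1 * p'.1)^*)%C * (K' (a.2, p.2) (b.2, p'.2))%:C).
  rewrite [RHS]exchange_big; apply: eq_bigr => a _; exact: exchange_big.
apply: eq_bigr => p' _; rewrite /evc inner_suml mulr_sumr; apply: eq_bigr => a _.
rewrite raddf_sum inner_sumr mulr_sumr; apply: eq_bigr => b _ /=.
rewrite linearZZ innerZl innerZr -ThE; try exact: gprod_rcomm.
rewrite /K' /= -wick_map_words rmorphM; ring.
Qed.

Lemma wick_map_cp n (x : 'I_n -> blin F F) (z : 'I_n -> F) :
  (forall i, rcomm (x i)) ->
  0 <= \sum_i \sum_j inner (P (star (x i) (x j Om)) (z j)) (z i).
Proof.
move=> xM.
have /choice[d dz] (i : 'I_n) : exists d : nat -> seq (C * seq H),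
    seq_lim (fun m => evc (fun u => rgprod u Om) (d m)) (z i).
  exact: approx_seq (@dense_rgprod _ _ _ F q1) _.
apply: (@seq_lim_ge0 _ (fun m => \sum_i \sum_j inner (P (star (x i) (x j Om))
   (evc (fun w => rgprod w Om) (d j m))) (evc (fun w => rgprod w Om) (d i m)))) => [|m].
  apply: seq_lim_sum => i; apply: seq_lim_sum => j.
  by apply: seq_lim_inner2 => //; exact: seq_lim_blin.
exact: (wick_map_cp_words (fun i => d i m) xM).
Qed.

Lemma wick_map1 : P Om = 1.
Proof.
by rewrite PE expr0 scale1r wickop_nil.
Qed.

Lemma norm_Om : `|Om| = 1.
Proof.
apply/eqP; rewrite -(@eqrXn2 _ 2)// expr1n -inner_norm inner_tw /= .
by [].
Qed.

Let rcommA := (rcomm_cstar F).1.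

Lemma wick_map_pos x z : rcomm x -> 0 <= inner (P (star x (x Om)) z) z.
Proof.
move=> xM; have := @wick_map_cp 1 (fun=> x) (fun=> z) (fun=> xM).
by rewrite !big_ord_recl !big_ord0 !addr0.
Qed.

(** The Kadison-Schwarz inequality: complete positivity for the pair (1, x) and the vectors (a z',
    z), where the scalar a varies. *)
Lemma wick_map_2x2 x z z' : rcomm x ->
  inner (P (star x Om) z') z = ((inner (P (x Om) z) z')^*)%C /\
  `|inner (P (x Om) z) z'| ^+ 2 <= inner (P (star x (x Om)) z) z * `|z'| ^+ 2.
Proof.
move=> xM; apply: positive_2x2 => [|a]; first exact: exprn_ge0.
pose xx (i : 'I_2) := if i == ord0 then 1 else x.
pose zz (i : 'I_2) := if i == ord0 then a *: z' else z.
have xxM i : rcomm (xx i) by rewrite /xx; case: ifP => // _; have [] := rcommA.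
have := wick_map_cp zz xxM.
rewrite !big_ord_recl !big_ord0 !addr0 /xx /zz /= star1 wick_map1 /=.
rewrite linearZZ !innerZl !innerZr inner_norm; congr (0 <= _).
by rewrite sqr_normc; ring.
Qed.

Lemma wick_map_star x : rcomm x -> P (star x Om) = star (P (x Om)).
Proof.
move=> xM; apply: star_unique => z z'; have [E _] := wick_map_2x2 z z' xM.
by rewrite [RHS]inner_conj E conjcK.
Qed.

(** Kadison-Schwarz reduces the claim to h = x^* x. For a vector z the numbers a m = <T(h^m) z, z>
    satisfy (a m)^2 <= |z|^2 a(2m) and grow at most like |P| |x|^(2m) |z|^2, so [log_convex_growth]
    removes |P|, which is not controlled as r tends to 1. *)
Lemma wick_map_contractive x : rcomm x -> `|P (x Om)| <= `|x|.
Proof.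
move=> xM; pose h := star x * x.
have sh : star h = h by rewrite /h starM starK.
have [M1 MP MM Ms] := rcommA.
have hM : rcomm h by apply: (MM) => //; exact: (Ms).
have hmM m : rcomm (h ^+ m) by elim: m => [|m IH]; rewrite ?expr0// exprS; apply: (MM).
have shm m : star (h ^+ m) = h ^+ m.
  elim: m => [|m IH]; first by rewrite expr0 star1.
  by rewrite {1}exprSr starM IH sh -exprS.
have nh m : `|h ^+ m| <= `|x| ^+ (2 * m).
  elim: m => [|m IH].
    by rewrite muln0 !expr0; apply: opnorm_le => y y1.
  rewrite exprS mulnS exprD (le_trans (blin_normrM _ _))// ler_pM//.
  by rewrite expr2 (le_trans (blin_normrM _ _))// ler_wpM2r// norm_star.
pose X := complex.Re `|x|; have XE : `|x| = X%:C by exact: ReC.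
have X0 : 0 <= X by have := normr_ge0 x; rewrite XE lecR.
have key z : inner (P (h Om) z) z <= `|x| ^+ 2 * `|z| ^+ 2.
  pose a m := complex.Re (inner (P ((h ^+ m) Om) z) z).
  have aE m : inner (P ((h ^+ m) Om) z) z = (a m)%:C.
    have [E _] := wick_map_2x2 z z (hmM m); move: E; rewrite shm.
    by rewrite /a; case: (inner _ _) => c d [dE]; congr (_ +i* _); lra.
  have hmh m : star (h ^+ m) ((h ^+ m) Om) = (h ^+ (2 * m)) Om.
    by rewrite shm mul2n -addnn exprD.
  have [b zb] : exists b, `|z| ^+ 2 = b%:C.
    by exists (complex.Re (`|z| ^+ 2)); rewrite -ReC ?exprn_ge0.
  have b0 : 0 <= b by rewrite -lecR -zb exprn_ge0.
  have [p pE] : exists p, `|P| = p%:C by exists (complex.Re `|P|); exact: ReC.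
  have := aE 1%N; rewrite expr1 => ->; rewrite zb XE -rmorphXn -rmorphM lecR.
  apply: (@log_convex_growth _ a b (X ^+ 2) (p * b)) => //.
  - exact: exprn_ge0.
  - by rewrite -lecR -aE expr1; exact: wick_map_pos.
  - move=> m; have [_] := wick_map_2x2 z z (hmM m).
    rewrite hmh !aE zb normC -rmorphXn real_normK ?num_real// -rmorphM lecR.
    by rewrite mulrC.
  move=> m; rewrite -lecR -aE.
  apply: (le_trans (_ : _ <= `|inner (P ((h ^+ m) Om) z) z|)).
    by rewrite aE normC lecR ler_norm.
  apply: (le_trans (inner_le _ _)).
  have -> : (p * b * X ^+ 2 ^+ m)%:C = `|P| * (X ^+ (2 * m))%:C * `|z| * `|z|.
    rewrite -!mulrA -expr2 zb pE -!rmorphM -exprM; congr (_%:C); ring.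
  rewrite ler_wpM2r//; apply: (le_trans (opnormP _ _)); rewrite ler_wpM2r//.
  apply: (le_trans (opnormP P _)); apply: ler_wpM2l; first exact: opnorm_ge0.
  apply: (le_trans (opnormP (h ^+ m) _)); rewrite norm_Om mulr1.
  by apply: (le_trans (nh m)); rewrite XE -rmorphXn.
apply: opnorm_le => z z1; set z' := P (x Om) z.
have [_] := wick_map_2x2 z z' xM; rewrite -/z' inner_norm.
have [->|z0] := eqVneq z' 0; first by rewrite normr0.
rewrite ger0_norm ?exprn_ge0// => Hz.
rewrite -ler_sqr ?nnegrE//.
have zp : 0 < `|z'| ^+ 2 by rewrite exprn_gt0// normr_gt0.
rewrite -(ler_pM2r zp) -expr2 (le_trans Hz)// ler_wpM2r ?exprn_ge0//.
have := key z; rewrite (_ : h Om = star x (x Om))// => kz.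
apply: (le_trans kz); apply: ler_piMr; first exact: exprn_ge0.
exact: exprn_ile1.
Qed.

End semigroup_map.

(** * Norm convergence on C_q as r tends to 1 *)

Section convergence.
Context {R : realType} {H : realHilbertType R} {q : R} (F : qFock H q).
Hypothesis q1 : `|q| < 1.
Implicit Types (f g : H) (u v w : seq H) (x y : blin F F).
Local Notation C := R[i].
Local Notation gprod := (gprod F).
Local Notation Om := (Om F).

Lemma evc_gprodM c d : exists e, evc gprod c * evc gprod d = evc gprod e.
Proof.
elim: c => [|p c [e IH]]; first by exists [::]; rewrite /evc !big_nil mul0r.
exists (scalec p.1 [seq (b.1, p.2 ++ b.2) | b <- d] ++ e).
rewrite evc_cat evc_scale -IH [evc gprod (p :: c)]/evc big_cons mulrDl; congr (_ + _).
rewrite /evc big_map blin_scalerMl mulr_sumr; congr (_ *: _); apply: eq_bigr => b _.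
by rewrite blin_scalerMr gprod_cat.
Qed.

Lemma star_evc_gprod c : exists d, star (evc gprod c) = evc gprod d.
Proof.
elim: c => [|p c [d IH]].
  exists [::]; rewrite /evc !big_nil; apply/esym/star_unique => y z.
  by rewrite /= [inner 0 z]inner0l [inner y 0]inner0r.
exists (((p.1^*)%C, rev p.2) :: d).
by rewrite /evc !big_cons star_conj_linear -/(evc gprod c) IH star_gprod.
Qed.

Lemma star_blinB (x y : blin F F) : star x - star y = star (x - y).
Proof.
have N1 : (((-1 : C)^*)%C = -1) by apply/eqP; rewrite eq_complex /= !oppr0 !eqxx.
by rewrite [x - y]addrC -[- y]scaleN1r star_conj_linear N1 scaleN1r addrC.
Qed.

Definition gspan : set (blin F F) :=
  [set x | forall e : C, 0 < e -> exists c, `|evc gprod c - x| <= e].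

Lemma gspan_cstar : cstar_subalgebra gspan.
Proof.
have mem c : gspan (evc gprod c) by move=> d d0; exists c; rewrite subrr normr0 ltW.
have clos : closed gspan.
  move=> x clx d d0; have d2 : 0 < d / 2 by rewrite divr_gt0.
  have [y [Ay xy]] := clx _ (nbhsx_ballx x _ d2); have [c cy] := Ay _ d2.
  have {}xy : `|x - y| <= d / 2 by apply: ltW; move: xy; rewrite -ball_normE.
  exists c; rewrite -[evc _ _](subrK y) -addrA (le_trans (ler_normD _ _))//.
  rewrite [leRHS]splitr; apply: lerD; first exact: cy.
  by rewrite distrC; exact: xy.
have gen (x : blin F F) : gspan x -> exists c : nat -> seq (C * seq H),
    seq_lim (fun n => evc gprod (c n)) x.
  move=> gx; have /choice[c cP] (n : nat) : exists c, `|evc gprod c - x| <= n.+1%:R^-1.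
    by apply: gx; rewrite invr_gt0.
  by exists c; exact: seq_lim_inv_succ.
split=> //; split.
- move=> d d0; exists [:: (1, [::])].
  by rewrite /evc big_cons big_nil addr0 scale1r /= subrr normr0 ltW.
- move=> b x y /gen[c cx] /gen[d dy].
  apply: (closed_seq_lim clos (seq_lim_lin b cx dy)) => n.
  by rewrite -evc_scale -evc_cat; exact: mem.
- move=> x y /gen[c cx] /gen[d dy].
  have xd m : gspan (x * evc gprod (d m)).
    have RM : seq_lim (fun n => evc gprod (c n) * evc gprod (d m)) (x * evc gprod (d m)).
      move=> e e0; have M0 : 0 < `|evc gprod (d m)| + 1 by rewrite ltr_wpDl.
      have [N h] := cx _ (divr_gt0 e0 M0); exists N => n /h hn.
      rewrite -mulrBl (le_trans (blin_normrM _ _))// mulrC.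
      by rewrite (le_trans (ler_wpM2l _ hn))// mul_div1_le.
    apply: (closed_seq_lim clos RM) => n; have [e ->] := evc_gprodM (c n) (d m).
    exact: mem.
  have LM : seq_lim (fun m => x * evc gprod (d m)) (x * y).
    move=> e e0; have M0 : 0 < `|x| + 1 by rewrite ltr_wpDl.
    have [N h] := dy _ (divr_gt0 e0 M0); exists N => n /h hn.
    rewrite -mulrBr (le_trans (blin_normrM _ _))//.
    by rewrite (le_trans (ler_wpM2l _ hn))// mul_div1_le.
  exact: (closed_seq_lim clos LM).
- move=> x /gen[c cx].
  have SL : seq_lim (fun n => star (evc gprod (c n))) (star x).
    move=> e /cx[N h]; exists N => n /h hn.
    by rewrite star_blinB (le_trans (norm_star _)).
  apply: (closed_seq_lim clos SL) => n; have [d ->] := star_evc_gprod (c n).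
  exact: mem.
Qed.

Lemma C_q_approx (a : blin F F) (e : C) : carrier (C_q F) a -> 0 < e ->
  exists c, `|evc gprod c - a| <= e.
Proof.
move=> /(_ gspan) aC; apply: aC; split; first exact: gspan_cstar.
move=> _ [f _ <-] d d0; exists [:: (1, [:: f])].
by rewrite /evc big_cons big_nil addr0 scale1r /= mulr1 subrr normr0 ltW.
Qed.

Lemma one_sub_expr (r : R) m : 0 <= r <= 1 -> 0 <= 1 - r ^+ m <= m%:R * (1 - r).
Proof.
move=> /andP[r0 r1]; rewrite subr_ge0 exprn_ile1//=.
elim: m => [|m IH]; first by rewrite expr0 subrr mul0r.
have h : 0 <= (1 - r) * (1 - r ^+ m) by rewrite mulr_ge0// subr_ge0 ?exprn_ile1.
by rewrite exprS -natr1; nra.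
Qed.

(** A Gaussian word is a finite sum of Wick operators, and P multiplies the terms of length n by
    r^n, where 1 - r^n <= n (1 - r). Hence K depends on c alone. *)
Lemma wick_map_gprod c : exists2 K : C, 0 <= K & forall (r : R) P, 0 <= r <= 1 ->
  is_wick_map r P -> `|P (evc gprod c Om) - evc gprod c| <= K * (1 - r)%:C.
Proof.
pose B u := \sum_(p <- lgauss (@kH R H) q u (vac (X:=_))) `|p.1|%:C * ((size p.2)%:R * `|wickop F p.2|).
have B0 u : 0 <= B u.
  by apply: sumr_ge0 => p _; rewrite mulr_ge0 ?lecR// mulr_ge0.
exists (\sum_(p <- c) `|p.1| * B p.2).
  by apply: sumr_ge0 => p _; rewrite mulr_ge0.
move=> r P r01 PE.
have -> : P (evc gprod c Om) - evc gprod c =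
    \sum_(p <- c) p.1 *: (P (gprod p.2 Om) - gprod p.2).
  rewrite blin_evc evc_linear /evc -sumrB; apply: eq_bigr => p _.
  by rewrite scalerBr.
rewrite (le_trans (ler_norm_sum _ _ _))// mulr_suml; apply: ler_sum => p _.
rewrite normrZ -mulrA ler_wpM2l//.
rewrite {1}(gprod_vac F q1) {1}(gprod_wick F q1) evC_linear /B /evC -sumrB mulr_suml.
rewrite (le_trans (ler_norm_sum _ _ _))//; apply: ler_sum => b _.
rewrite /= PE -scalerBr normrZ normC -mulrA ler_wpM2l ?lecR//.
rewrite -{2}[wickop F b.2]scale1r -scalerBl normrZ mulrAC ler_wpM2r//.
have /andP[h1 h2] := one_sub_expr (size b.2) r01.
rewrite -(rmorph1 (@real_complex R)) -rmorphB normC distrC ger0_norm//.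
by rewrite -[(size b.2)%:R](rmorph_nat (@real_complex R)) -rmorphM lecR.
Qed.

Lemma wick_map_cvg (a : blin F F) (e : C) : carrier (C_q F) a -> 0 < e ->
  exists2 d : R, 0 < d & forall (r : R) P, 0 <= r <= 1 -> 1 - r <= d ->
    is_wick_map r P -> `|P (a Om) - a| <= e.
Proof.
move=> aC e0; have e3 : 0 < e / 3 by rewrite divr_gt0.
have [c ca] := C_q_approx aC e3; have [K K0 KP] := wick_map_gprod c.
have dd : 0 < complex.Re (e / 3 / (K + 1)).
  by rewrite -ltcR -ReC ?ltW// ?divr_gt0// ltr_wpDl.
exists (complex.Re (e / 3 / (K + 1))) => // r P r01 rd PE.
have aM : rcomm (a - evc gprod c).
  have aM : rcomm a by apply: (Gamma_q_rcomm q1); exact: C_q_sub_Gamma_q.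
  have sA := (rcomm_cstar F).1; have [_ AP _ _] := sA.
  rewrite addrC -scaleN1r; apply: (AP) => //; apply: (@star_subalgebra_sum _ _ (@rcomm R H q F)) => // p.
  exact: gprod_rcomm.
have -> : P (a Om) - a = P ((a - evc gprod c) Om) + (P (evc gprod c Om) - evc gprod c)
    + (evc gprod c - a).
  by rewrite (_ : (a - evc gprod c) Om = a Om - evc gprod c Om)// linearB !addrA !subrK.
have -> : e = e / 3 + e / 3 + e / 3 by field.
rewrite (le_trans (ler_normD _ _))// lerD// (le_trans (ler_normD _ _))// lerD//.
  by rewrite (le_trans (wick_map_contractive q1 r01 PE aM))// distrC.
rewrite (le_trans (KP _ _ r01 PE))//; apply: le_trans (mul_div1_le K0 e3).
by rewrite ler_wpM2l// [leRHS]ReC ?lecR// ltW// divr_gt0// ltr_wpDl.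
Qed.
End convergence.

(** * Hahn-Banach and approximate Riesz representation *)

Section hahn_banach.
Context {R : realType} {V : lmodType R[i]}.
Implicit Types (p : V -> R) (x y : V).

Definition real_linear (f : V -> R) :=
  (forall x y, f (x + y) = f x + f y) /\ (forall (t : R) x, f (t%:C *: x) = t * f x).
Definition sublinear p :=
  (forall x y, p (x + y) <= p x + p y) /\
  (forall (t : R) x, 0 <= t -> p (t%:C *: x) = t * p x).

Lemma sublinear0 p : sublinear p -> p 0 = 0.
Proof. by move=> [_ pZ]; have := pZ 0 0 (lexx _); rewrite scaler0 mul0r. Qed.

Lemma sublinearN p x : sublinear p -> - p (- x) <= p x.
Proof.
move=> sp; have := sp.1 x (- x); rewrite subrr sublinear0// => h.
by rewrite -subr_ge0 opprK.
Qed.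

Lemma positively_homogeneous (g : V -> R) : g 0 = 0 ->
  (forall (u : R) x, 0 < u -> g (u%:C *: x) <= u * g x) ->
  forall (t : R) x, 0 <= t -> g (t%:C *: x) = t * g x.
Proof.
move=> g0 gu t x t0; have [->|tN] := eqVneq t 0; first by rewrite scale0r mul0r.
have tp : 0 < t by rewrite lt_def tN.
have tV : 0 < t^-1 by rewrite invr_gt0.
apply/eqP; rewrite eq_le gu//= -ler_pdivlMl//.
apply: le_trans (gu _ _ tV); rewrite scalerA -rmorphM mulVf// scale1r.
by [].
Qed.

(* A minimal sublinear functional is linear: x |-> inf_(t >= 0) p (x + t y) - t p y is
   sublinear and below p, and its value at - y is at most - p y. *)
Lemma sublinear_minimal_linear p : sublinear p ->
  (forall p', sublinear p' -> (forall x, p' x <= p x) -> p' = p) -> real_linear p.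
Proof.
move=> sp pmin; have [pD pZ] := sp.
have pN y : p (- y) = - p y.
  pose S x := [set p (x + t%:C *: y) - t * p y | t in [set t : R | 0 <= t]].
  have lb x : lbound (S x) (- p (- x)).
    move=> _ [t /= t0 <-]; have := pD (x + t%:C *: y) (- x).
    by rewrite addrAC subrr add0r pZ//; lra.
  have hi x : has_inf (S x).
    by split; [exists (p (x + 0%:C *: y) - 0 * p y), 0 => /=|exists (- p (- x))].
  have Sp x t : 0 <= t -> inf (S x) <= p (x + t%:C *: y) - t * p y.
    by move=> t0; apply: ge_inf; [exact: (hi x).2|exists t].
  pose p' x := inf (S x).
  have p'p x : p' x <= p x.
    by have := Sp x 0 (lexx _); rewrite scale0r addr0 mul0r subr0.
  have sp' : sublinear p'.
    split=> [x z|t x t0].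
      apply/ler_addgt0Pl => e e0; have e2 : 0 < e / 2 by rewrite divr_gt0.
      have [_ [s /= s0 <-] hs] := inf_adherent e2 (hi x).
      have [_ [t /= t0 <-] ht] := inf_adherent e2 (hi z).
      apply: (le_trans (Sp (x + z) (s + t) (addr_ge0 s0 t0))).
      have : p (x + z + (s + t)%:C *: y) <= p (x + s%:C *: y) + p (z + t%:C *: y).
        by rewrite rmorphD scalerDl addrACA.
      by move: hs ht; rewrite -!/(p' _); lra.
    apply: positively_homogeneous t0.
      apply/eqP; rewrite eq_le; apply/andP; split; first by rewrite (le_trans (p'p _))// sublinear0.
      by apply: lb_le_inf; [exact: (hi _).1|move=> z /lb; rewrite oppr0 sublinear0// oppr0].
    move=> u z u0.
    rewrite -ler_pdivrMl//; apply: lb_le_inf; first exact: (hi z).1.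
    move=> _ [s /= s0 <-]; rewrite ler_pdivrMl//.
    apply: (le_trans (Sp _ (u * s) (mulr_ge0 (ltW u0) s0))).
    by rewrite rmorphM -scalerA -scalerDr (pZ _ _ (ltW u0)) mulrBr mulrA.
  have E := pmin p' sp' p'p.
  apply/eqP; rewrite eq_le; apply/andP; split; last by have := sublinearN y sp; lra.
  rewrite -{1}E; apply: (le_trans (Sp (- y) 1 ler01)).
  by rewrite scale1r addNr sublinear0// mul1r sub0r.
split=> [x y|t x].
  apply/eqP; rewrite eq_le pD/=.
  have := pD (- x) (- y); rewrite -opprD !pN; lra.
have [t0|t0] := leP 0 t; first exact: pZ.
have := pZ (- t) x; rewrite oppr_ge0 => /(_ (ltW t0)).
rewrite rmorphN scaleNr pN mulNr; lra.
Qed.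

Lemma linear_below_sublinear p : sublinear p ->
  exists f, real_linear f /\ forall x, f x <= p x.
Proof.
move=> sp; pose T := {p' : V -> R | sublinear p' /\ forall x, p' x <= p x}.
(* The order is reversed, so that the maximal element of Zorn's lemma is a minimal sublinear
   functional. *)
pose Rel (a b : T) := `[< forall x, sval b x <= sval a x >].
have [] := @Zorn T Rel.
- by move=> a; apply/asboolP.
- by move=> b a c /asboolP ab /asboolP bc; apply/asboolP => x; exact: le_trans (bc x) (ab x).
- move=> [a ap] [b bp] /asboolP /= ab /asboolP /= ba.
  have E : a = b by apply/funext => x; apply/eqP; rewrite eq_le ba ab.
  by rewrite E in ap *; congr exist; exact: Prop_irrelevance.
- move=> A tA; have [A0|/set0P[a0 Aa0]] := eqVneq A set0.
    by exists (exist _ p (conj sp (fun x => lexx _))) => s; rewrite A0.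
  pose S x := [set sval a x | a in A].
  have lb x : lbound (S x) (- p (- x)).
    move=> _ [a Aa <-]; have [sa ap] := svalP a.
    by apply: le_trans (sublinearN x sa); rewrite lerN2.
  have hi x : has_inf (S x).
    by split; [exists (sval a0 x), a0|exists (- p (- x))].
  have Sp x a : A a -> inf (S x) <= sval a x.
    by move=> Aa; apply: ge_inf; [exact: (hi x).2|exists a].
  have mp : sublinear (fun x => inf (S x)) /\ forall x, inf (S x) <= p x.
    split; last by move=> x; apply: (le_trans (Sp x _ Aa0)); exact: (svalP a0).2.
    split=> [x y|t x t0].
      apply/ler_addgt0Pl => e e0; have e2 : 0 < e / 2 by rewrite divr_gt0.
      have [_ [a Aa <-] ha] := inf_adherent e2 (hi x).
      have [_ [b Ab <-] hb] := inf_adherent e2 (hi y).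
      have [c Ac [ca cb]] : exists2 c, A c & sval c x <= sval a x /\ sval c y <= sval b y.
        by have [/asboolP h|/asboolP h] := tA a b Aa Ab; [exists b|exists a].
      apply: (le_trans (Sp _ _ Ac)); have := (svalP c).1.1 x y.
      by move: ca cb ha hb; rewrite -!/(S _); lra.
    apply: (@positively_homogeneous (fun x => inf (S x))) t0.
      have a00 (a : T) : sval a 0 = 0 by exact: (sublinear0 (svalP a).1).
      apply/eqP; rewrite eq_le; apply/andP; split; first by rewrite -(a00 a0) Sp.
      by apply: lb_le_inf; [exact: (hi _).1|move=> _ [a _ <-]; rewrite a00].
    move=> u z u0; rewrite -ler_pdivrMl//; apply: lb_le_inf; first exact: (hi z).1.
    move=> _ [a Aa <-]; rewrite ler_pdivrMl// -((svalP a).1.2 _ _ (ltW u0)).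
    exact: Sp.
  exists (exist (fun p' : V -> R => sublinear p' /\ forall x, p' x <= p x) (fun x => inf (S x)) mp).
  by move=> s As; apply/asboolP => x; exact: Sp.
move=> m mmin; exists (sval m); split; last exact: (svalP m).2.
apply: sublinear_minimal_linear; first exact: (svalP m).1.
move=> p' sp' p'm.
have p'p x : p' x <= p x by apply: le_trans (p'm x) ((svalP m).2 x).
have := mmin (exist _ p' (conj sp' p'p)); rewrite /Rel asboolT// => /(_ isT).
by move=> /(congr1 sval).
Qed.

(** Hahn-Banach with lower constraints: the infimum over finite families of p (x + sum of g) - sum
    of c is still sublinear, and a linear functional below it satisfies the constraint i by
    evaluation at - g i. The scaling [sc] makes the constraints a cone. *)
Lemma linear_sandwich p (I : Type) (g : I -> V) (c : I -> R) (sc : R -> I -> I) :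
  sublinear p ->
  (forall s : seq I, \sum_(i <- s) c i <= p (\sum_(i <- s) g i)) ->
  (forall t i, 0 <= t -> g (sc t i) = t%:C *: g i /\ c (sc t i) = t * c i) ->
  exists f, [/\ real_linear f, forall x, f x <= p x & forall i, c i <= f (g i)].
Proof.
move=> sp cp scE; have [pD pZ] := sp.
pose S x := [set p (x + \sum_(i <- s) g i) - \sum_(i <- s) c i | s in [set: seq I]].
have lb x : lbound (S x) (- p (- x)).
  move=> _ [s _ <-]; have := pD (x + \sum_(i <- s) g i) (- x).
  by rewrite addrAC subrr add0r; have := cp s; lra.
have hi x : has_inf (S x).
  by split; [exists (p (x + \sum_(i <- [::]) g i) - \sum_(i <- [::]) c i), [::]|exists (- p (- x))].
have Sp x s : inf (S x) <= p (x + \sum_(i <- s) g i) - \sum_(i <- s) c i.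
  by apply: ge_inf; [exact: (hi x).2|exists s].
have [] := @linear_below_sublinear (fun x => inf (S x)).
  split=> [x y|t x t0].
    apply/ler_addgt0Pl => e e0; have e2 : 0 < e / 2 by rewrite divr_gt0.
    have [_ [a _ <-] ha] := inf_adherent e2 (hi x).
    have [_ [b _ <-] hb] := inf_adherent e2 (hi y).
    apply: (le_trans (Sp (x + y) (a ++ b))); rewrite !big_cat /= addrACA.
    have := pD (x + \sum_(i <- a) g i) (y + \sum_(i <- b) g i); move: ha hb.
    set X := inf _; set Y := inf _; lra.
  apply: (@positively_homogeneous (fun x => inf (S x))) t0.
    apply/eqP; rewrite eq_le; apply/andP; split.
      by have := Sp 0 [::]; rewrite !big_nil addr0 sublinear0// subr0.
    by apply: lb_le_inf; [exact: (hi _).1|move=> z /lb; rewrite oppr0 sublinear0// oppr0].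
  move=> u z u0; rewrite -ler_pdivrMl//; apply: lb_le_inf; first exact: (hi z).1.
  move=> _ [s _ <-]; rewrite ler_pdivrMl//; apply: (le_trans (Sp _ (map (sc u) s))).
  have u0' := ltW u0; rewrite !big_map.
  under eq_bigr => i _ do rewrite (scE _ _ u0').1.
  under [X in _ - X]eq_bigr => i _ do rewrite (scE _ _ u0').2.
  by rewrite -scaler_sumr -mulr_sumr -scalerDr pZ// mulrBr.
move=> f [fl fS]; exists f; split=> // [x|i].
  by apply: (le_trans (fS x)); have := Sp x [::]; rewrite !big_nil addr0 subr0.
have := le_trans (fS (- g i)) (Sp _ [:: i]).
rewrite !big_seq1 addNr sublinear0// sub0r -scaleN1r.
by rewrite -(rmorph1 (@real_complex R)) -rmorphN fl.2 mulN1r lerN2.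
Qed.

(* By nearly minimizing c |-> b c c - 2 L c; V need not be complete. *)
Lemma riesz_approx (b : V -> V -> R) (L : V -> R) (M d : R) :
  (forall z, real_linear (b^~ z)) -> (forall x y, b x y = b y x) ->
  (forall x, 0 <= b x x) -> real_linear L -> (forall x, L x ^+ 2 <= M ^+ 2 * b x x) ->
  0 < d -> exists c, forall x, (L x - b x c) ^+ 2 <= d * b x x.
Proof.
move=> bl bC b0 [LD LZ] Lb d0.
pose J x := b x x - 2 * L x.
have Jlb x : - M ^+ 2 <= J x.
  have := Lb x; rewrite /J; have := b0 x; set y := b x x => y0 h.
  have [z z0 yz] : exists2 z, 0 <= z & y = z ^+ 2 by exists (Num.sqrt y); rewrite ?sqrtr_ge0 ?sqr_sqrtr.
  move: h; rewrite yz -exprMn => h.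
  have : `|L x| <= `|M| * z by rewrite -[z]ger0_norm// -normrM -ler_sqr ?nnegrE// !real_normK ?num_real.
  have := ler_norm (L x); have := real_normK (num_real M); have := normr_ge0 M.
  set m := `|M| => m0 <-; have := sqr_ge0 (m - z); rewrite sqrrB; nra.
have hi : has_inf (range J) by split; [exists (J 0), 0|exists (- M ^+ 2) => _ [x _ <-]].
have [_ [c _ <-] hc] := inf_adherent d0 hi.
exists c => x.
have h t : 0 <= d + 2 * t * (b x c - L x) + t ^+ 2 * b x x.
  have : inf (range J) <= J (c + t%:C *: x) by apply: ge_inf; [exact: hi.2|exists (c + t%:C *: x)].
  have : J (c + t%:C *: x) = J c + 2 * t * (b x c - L x) + t ^+ 2 * b x x.
    rewrite /J LD LZ (bl _).1 [b c _]bC [b (_ *: _) (_ + _)]bC !(bl _).1 !(bl _).2.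
    by rewrite [b c (_ *: _)]bC [b x (_ *: _)]bC !(bl _).2; ring.
  lra.
have := quadratic_nonneg_discr (b0 x) h.
by rewrite -sqrrN opprB.
Qed.
End hahn_banach.

Section phase.
Context {R : realType}.
Local Notation Re := (@complex.Re R).

Lemma norm_le_Re (z : R[i]) (M : R) :
  (forall u : R[i], `|u| = 1 -> Re (u * z) <= M) -> `|z| <= M%:C.
Proof.
move=> h; have [z0|z0] := eqVneq z 0.
  by rewrite z0 normr0 lecR; have := h 1 (normr1 _); rewrite z0 mulr0.
have nz : `|z| != 0 by rewrite normr_eq0.
have u1 : `|(z^*)%C / `|z| | = 1 by rewrite normf_div normcJ normr_id divff.
have := h _ u1; rewrite mulrAC [_ * z]mulrC -sqr_normc expr2 mulfK//.
by rewrite -lecR -ReC.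
Qed.

Lemma Re_le_norm (z : R[i]) (M : R) : `|z| <= M%:C -> Re z <= M.
Proof.
move=> h; rewrite -lecR; apply: le_trans h.
by apply: le_trans (normc_ge_Re z); rewrite lecR ler_norm.
Qed.

Lemma Re_norm_ge0 (W : normedModType R[i]) (x : W) : 0 <= Re `|x|.
Proof. by rewrite -lecR Re_norm normr_ge0. Qed.

Lemma Re_normM (U W : normedModType R[i]) (x : U) (y : W) :
  (Re `|x| * Re `|y|)%:C = `|x| * `|y|.
Proof. by rewrite rmorphM /= !Re_norm. Qed.

Lemma Re_mulC (t : R) (z : R[i]) : Re (t%:C * z) = t * Re z.
Proof. by case: z => u v /=; rewrite mul0r subr0. Qed.

Lemma le_of_forall_mul (x y z : R) : 0 <= z ->
  (forall d, 0 < d -> x <= y + d * z) -> x <= y.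
Proof.
move=> z0 h; apply/ler_addgt0Pr => e e0.
have z1 : 0 < z + 1 by rewrite ltr_wpDl.
apply: le_trans (h _ (divr_gt0 e0 z1)) _; rewrite lerD2l mulrAC ler_pdivrMr//.
by rewrite ler_pM2l// lerDl.
Qed.

Lemma le_sqrt_mul (x y z : R) : 0 <= y -> 0 <= z -> x ^+ 2 <= y ^+ 2 * z -> `|x| <= y * Num.sqrt z.
Proof.
move=> y0 z0 h; rewrite -ler_sqr ?nnegrE ?mulr_ge0 ?sqrtr_ge0//.
by rewrite real_normK ?num_real// exprMn sqr_sqrtr.
Qed.
End phase.

(** * Functionals dominated by a Hilbertian seminorm *)

Section hilbertian_dual.
Context {R : realType} {V : normedModType R[i]}.
Local Notation Re := (@complex.Re R).
Variables (b : V -> V -> R) (K : R).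
Hypotheses (bl : forall z, real_linear (b^~ z)) (bC : forall x y, b x y = b y x)
  (b0 : forall x, 0 <= b x x)
  (bU : forall (u : R[i]) x, `|u| = 1 -> b (u *: x) (u *: x) = b x x)
  (bK : forall x, Num.sqrt (b x x) <= K * Re `|x|) (K0 : 0 <= K).
Local Notation nb x := (Num.sqrt (b x x)).

Let bDl x y z : b (x + y) z = b x z + b y z. Proof. exact: (bl z).1. Qed.
Let bZl (t : R) x z : b (t%:C *: x) z = t * b x z. Proof. exact: (bl z).2. Qed.
Let bDr x y z : b z (x + y) = b z x + b z y. Proof. by rewrite bC bDl !(bC _ z). Qed.
Let bZr (t : R) x z : b z (t%:C *: x) = t * b z x. Proof. by rewrite bC bZl bC. Qed.

Lemma form_le x y : `|b x y| <= nb x * nb y.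
Proof.
apply: le_sqrt_mul; rewrite ?sqrtr_ge0// sqr_sqrtr//.
apply: quadratic_nonneg_discr => // t.
have := b0 (x + t%:C *: y); rewrite !bDl !bDr !bZl !bZr [b y x]bC.
by congr (0 <= _); ring.
Qed.

Lemma norm_le_nb (g : V -> R[i]^o) (M : R) : linear g ->
  (forall x, Re (g x) <= M * nb x) -> forall x, `|g x| <= (M * nb x)%:C.
Proof.
move=> lg gM x; apply: norm_le_Re => u u1.
have -> : u * g x = g (u *: x).
  have g0 : g 0 = 0 by have := lg (-1) 0 0; rewrite scaler0 addr0 scaleN1r addNr.
  by have := lg u x 0; rewrite !addr0 g0 addr0.
by rewrite -(bU x u1).
Qed.

(** The complex-linear functional with real part b(., c); b itself is only a real bilinear form. *)
Definition form_fun c x : R[i]^o := b x c +i* (- b ('i *: x) c).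

Lemma form_fun_linear c : linear (form_fun c).
Proof.
move=> k x y; rewrite /form_fun.
have kE (z : V) : k *: z = (Re k)%:C *: z + (complex.Im k)%:C *: ('i *: z).
  by rewrite {1}[k]complexE scalerDl scalerA ['i * _]mulrC.
have iE (z : V) : 'i *: ('i *: z) = (- 1)%:C *: z.
  by rewrite scalerA -expr2 sqr_i rmorphN rmorph1.
rewrite scalerDr !bDl [k *: x]kE scalerDr !bDl !bZl.
rewrite !scalerA ![_ * _%:C]mulrC -!scalerA !bZl iE bZl.
case: k {kE} => u v /=; apply/eqP; rewrite eq_complex /=; apply/andP; split; apply/eqP; ring.
Qed.

Lemma form_fun_le c x : `|form_fun c x| <= (nb c * nb x)%:C.
Proof.
apply: (norm_le_nb (form_fun_linear c)) => y.
by rewrite mulrC; exact: le_trans (ler_norm _) (form_le y c).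
Qed.

Lemma nb_le_norm x (M : R) : 0 <= M -> (M * nb x)%:C <= (M * K)%:C * `|x|.
Proof.
by move=> M0; rewrite -Re_norm -rmorphM lecR -mulrA ler_wpM2l.
Qed.

Lemma form_fun_bound c x : `|form_fun c x| <= (nb c * K)%:C * `|x|.
Proof. by apply: le_trans (form_fun_le c x) _; rewrite nb_le_norm ?sqrtr_ge0. Qed.

Definition form_dual c : dual_space V := mk_blin (form_fun_linear c) (form_fun_bound c).

(* Functionals dominated by nb extend to the Hilbert space of b, on whose dual eta
   acts as a vector; [e] approximates this vector. *)
Lemma bidual_approx (eta : bidual V) (eps : R) : 0 < eps ->
  exists e : V, forall (g : dual_space V) (D : R), 0 <= D ->
    (forall x, `|g x| <= (D * nb x)%:C) -> `|eta g - g e| <= (D * eps)%:C.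
Proof.
move=> eps0; pose L c := Re (eta (form_dual c)).
pose N := Re `|eta|; have NE : `|eta| = N%:C by exact/ReC/opnorm_ge0.
have N0 : 0 <= N by rewrite -lecR -NE; exact: opnorm_ge0.
have etaM (g : dual_space V) (M : R) : 0 <= M -> `|g| <= M%:C -> Re (eta g) <= N * M.
  move=> M0 gM; apply: Re_le_norm; apply: le_trans (opnormP eta g) _.
  have -> : (N * M)%:C = `|eta| * M%:C by rewrite {1}NE -rmorphM.
  by apply: ler_wpM2l; [exact: opnorm_ge0|exact: gM].
have Ll : real_linear L.
  split=> [x y|t x]; rewrite /L.
    transitivity (Re (eta (form_dual x + form_dual y))); last by rewrite linearD raddfD.
    congr (Re (eta _)); apply: blin_ext => z /=.
    by rewrite /form_fun !bDr; apply/eqP; rewrite eq_complex /= opprD !eqxx.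
  rewrite (_ : form_dual _ = t%:C *: form_dual x).
    by rewrite linearZZ; exact: Re_mulC.
  apply: blin_ext => z /=; rewrite /form_fun !bZr; apply/eqP; rewrite eq_complex /=.
  by rewrite !mul0r subr0 addr0 mulrN !eqxx.
have Llin x : L x <= N * K * nb x.
  rewrite /L -mulrA [K * _]mulrC; apply: etaM; first by rewrite mulr_ge0 ?sqrtr_ge0.
  apply: mk_blin_norm; first by rewrite lecR mulr_ge0 ?sqrtr_ge0.
have nbN x : nb (- x) = nb x by rewrite -scaleN1r bU// normrN1.
have LN x : L (- x) = - L x.
  by rewrite -scaleN1r -(rmorph1 (@real_complex R)) -rmorphN Ll.2 mulN1r.
have Lb x : L x ^+ 2 <= (N * K) ^+ 2 * b x x.
  have : `|L x| <= N * K * nb x.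
    rewrite ler_norml Llin andbT lerNl -LN -nbN; exact: Llin.
  rewrite -ler_sqr ?nnegrE ?mulr_ge0 ?sqrtr_ge0//.
  by rewrite real_normK ?num_real// exprMn sqr_sqrtr.
have eps20 : 0 < eps ^+ 2 by rewrite exprn_gt0.
have [e He] := riesz_approx bl bC b0 Ll Lb eps20.
exists e => g D D0 gD.
wlog suff main : g gD / Re (eta g - g e) <= D * eps.
  apply: norm_le_Re => u u1.
  have -> : u * (eta g - g e) = eta (u *: g) - (u *: g) e.
    have E1 : eta (u *: g) = u *: eta g by rewrite linearZZ.
    have E2 : (u *: g) e = u *: g e by [].
    by rewrite E1 E2 -scalerBr.
  by apply: main => x; rewrite (_ : (u *: g) x = u * g x)// normrM u1 mul1r.
pose Lg x := Re (g x).
have Lgl : real_linear Lg.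
  split=> [x y|t x]; rewrite /Lg; first by rewrite linearD raddfD.
  by rewrite linearZZ; exact: Re_mulC.
have Lgb x : Lg x ^+ 2 <= D ^+ 2 * b x x.
  have : `|Lg x| <= D * nb x.
    by rewrite -lecR; apply: le_trans (gD x); exact: normc_ge_Re.
  rewrite -ler_sqr ?nnegrE ?mulr_ge0 ?sqrtr_ge0//.
  by rewrite real_normK ?num_real// exprMn sqr_sqrtr.
(* In the chain eta g, L c, b e c, g e, of which real parts are taken, consecutive differences are
   at most N d K, eps * nb c and d * nb e. As nb c <= D + d, their sum is D * eps plus d times the
   given factor, and d is arbitrary. *)
apply: (@le_of_forall_mul _ _ _ (N * K + eps + nb e)) => [|d d0].
  by rewrite !addr_ge0 ?mulr_ge0 ?sqrtr_ge0// ltW.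
have d20 : 0 < d ^+ 2 by rewrite exprn_gt0.
have [c Hc] := riesz_approx bl bC b0 Lgl Lgb d20.
have {}He x : `|L x - b x e| <= eps * nb x by apply: le_sqrt_mul => //; exact: ltW.
have {}Hc x : `|Lg x - b x c| <= d * nb x by apply: le_sqrt_mul => //; exact: ltW.
have h1 : Re (eta g) - L c <= N * (d * K).
  have -> : Re (eta g) - L c = Re (eta (g - form_dual c)) by rewrite linearB raddfB.
  apply: etaM; first by rewrite mulr_ge0// ltW.
  apply: opnorm_le => x x1.
  apply: (@le_trans _ _ (d * nb x)%:C).
    apply: (@norm_le_nb (g - form_dual c)) => [k y z|y]; first exact: linearP.
    by rewrite (_ : (g - form_dual c) y = g y - form_dual c y)// raddfB; apply: le_trans (Hc y); exact: ler_norm.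
  apply: le_trans (nb_le_norm _ (ltW d0)) _; apply: ler_piMr => //.
  by rewrite lecR mulr_ge0// ltW.
have h2 : L c - b e c <= eps * nb c.
  by rewrite bC; exact: le_trans (ler_norm _) (He c).
have h3 : b e c - Lg e <= d * nb e.
  by apply: le_trans (Hc e); rewrite distrC ler_norm.
have h4 : nb c <= D + d.
  have [->|c0] := eqVneq (nb c) 0; first by rewrite addr_ge0// ltW.
  have cp : 0 < nb c by rewrite lt_def c0 sqrtr_ge0.
  rewrite -(ler_pM2r cp) -[X in X <= _]expr2 sqr_sqrtr// mulrDl.
  have := Hc c; rewrite distrC => /(le_trans (ler_norm _)).
  have : Lg c <= D * nb c by apply: Re_le_norm.
  by lra.
rewrite raddfB -/(Lg e) /=.
have h5 : eps * nb c <= eps * (D + d) by rewrite ler_pM2l.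
by move: h1 h2 h3 h5; set p := Re _; nra.
Qed.
End hilbertian_dual.

(** * Arens regularity *)

Section factorization.
Context {R : realType} {E : complexHilbertType R}.
Local Notation Re := (@complex.Re R).
Implicit Types (x y : blin E E) (v : E).

(** Only upper bounds of the real part count, and v = 0 is allowed: this is the positive part of the
    supremum of Re <x v, v> over unit vectors. It is sublinear, and on b^* b it is at most |b|^2. *)
Definition num_radius x : R := sup [set Re (inner (x v) v) | v in [set v | `|v| <= 1]].

Lemma num_radius_has_ubound x :
  ubound [set Re (inner (x v) v) | v in [set v | `|v| <= 1]] (Re `|x|).
Proof.
move=> _ [v v1 <-]; apply: Re_le_norm; rewrite Re_norm.
apply: le_trans (inner_le _ _) _; apply: le_trans (_ : _ <= `|x v|) _.
  by rewrite ler_piMr.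
by apply: le_trans (opnormP x v) _; rewrite ler_piMr ?opnorm_ge0.
Qed.

Lemma num_radius_ub x v : `|v| <= 1 -> Re (inner (x v) v) <= num_radius x.
Proof.
by move=> v1; apply: ub_le_sup; [exists (Re `|x|); exact: num_radius_has_ubound|exists v].
Qed.

Lemma num_radius_le x (M : R) :
  (forall v, `|v| <= 1 -> Re (inner (x v) v) <= M) -> num_radius x <= M.
Proof.
move=> h; apply: ge_sup => [|_ [v /= v1 <-]]; last exact: h.
by exists (Re (inner (x 0) 0)), 0 => //=; rewrite normr0.
Qed.

Lemma num_radius_ge0 x : 0 <= num_radius x.
Proof.
by apply: le_trans (@num_radius_ub x 0 _); rewrite ?inner0r// normr0.
Qed.

Lemma num_radius_sublinear : sublinear num_radius.
Proof.
split=> [x y|t x t0].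
  apply: num_radius_le => v v1; rewrite (_ : (x + y) v = x v + y v)// innerDl raddfD.
  by apply: lerD; exact: num_radius_ub.
apply: (@positively_homogeneous _ (blin E E) num_radius) t0 => [|u z u0].
  apply/eqP; rewrite eq_le num_radius_ge0 andbT; apply: num_radius_le => v _.
  by rewrite (_ : (0 : blin E E) v = 0)// inner0l.
apply: num_radius_le => v v1; rewrite (_ : (u%:C *: z) v = u%:C *: z v)// innerZl Re_mulC.
by rewrite ler_pM2l//; exact: num_radius_ub.
Qed.

Variable A : starSubalg E.
Local Notation A' := (dual_space (elt A)).
Implicit Types (a b c : elt A) (phi : A').

Lemma elt_star_add a b : star (a + b) = star a + star b.
Proof. by have := elt_starD 1 a b; rewrite rmorph1 !scale1r. Qed.

Lemma elt_star0 : star (0 : elt A) = 0.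
Proof.
have := elt_star_add 0 0; rewrite addr0 => /esym/eqP.
by rewrite -subr_eq0 addrK => /eqP.
Qed.

Lemma elt_starZ (k : R[i]) b : star (k *: b) = (k^*)%C *: star b.
Proof.
by have := elt_starD k b 0; rewrite elt_star0 !addr0.
Qed.

Lemma inner_star_sqr b v : Re (inner ((star b * b : elt A) v) v) = Re `|b v| ^+ 2.
Proof.
rewrite (_ : (star b * b : elt A) v = star (val b) (val b v))// starPr inner_norm.
by rewrite -[X in Re (X ^+ 2)]Re_norm -rmorphXn.
Qed.

(** At a vector v of the unit ball each term is at most |a| |b v|; the arithmetic-geometric mean
    separates the factors, and the sum of the |b v|^2 is a value of the form of the sum of the b^*
    b. *)
Lemma norm_sum_mul_le (s : seq (elt A * elt A)) :
  Re `|\sum_(p <- s) p.1 * p.2| <=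
  (\sum_(p <- s) Re `|p.1| ^+ 2 + num_radius (\sum_(p <- s) val (star p.2 * p.2))) / 2.
Proof.
rewrite -lecR Re_norm.
apply: opnorm_le => v v1.
have valS : val (\sum_(p <- s) p.1 * p.2) = \sum_(p <- s) val p.1 * val p.2.
  by rewrite raddf_sum.
rewrite valS blin_sumE.
apply: le_trans (ler_norm_sum _ _ _) _.
have -> : \sum_(p <- s) `|(val p.1 * val p.2) v| = (\sum_(p <- s) Re `|(val p.1 * val p.2) v|)%:C.
  by rewrite rmorph_sum; apply: eq_bigr => p _; exact/esym/Re_norm.
rewrite lecR ler_pdivlMr// mulr_suml.
have hr := num_radius_ub (\sum_(p <- s) val (star p.2 * p.2)) v1.
apply: le_trans (lerD (lexx _) hr).
rewrite blin_sumE inner_suml raddf_sum -big_split; apply: ler_sum => p _.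
rewrite [leRHS](_ : _ = Re `|p.1| ^+ 2 + Re `|p.2 v| ^+ 2); last first.
  by congr (_ + _); exact: inner_star_sqr.
have h : Re `|(val p.1 * val p.2) v| <= Re `|p.1| * Re `|p.2 v|.
  by rewrite -lecR Re_normM Re_norm; exact: (opnormP (val p.1)).
have := sqr_ge0 (Re `|p.1| - Re `|p.2 v|); rewrite sqrrB; move: h; lra.
Qed.

(* Half of the Grothendieck-Haagerup factorization, by the Hahn-Banach theorem. *)
Lemma functional_factor phi : exists f : blin E E -> R, exists K : R,
  [/\ real_linear f, 0 <= K, forall b, 0 <= f (star b * b : elt A),
      forall b, f (star b * b : elt A) <= K * Re `|b| ^+ 2
    & forall a b, Re (phi (a * b)) ^+ 2 <= (4 * K * Re `|a| ^+ 2) * f (star b * b : elt A)].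
Proof.
pose k := Re `|phi| / 2.
have k0 : 0 <= k by rewrite divr_ge0// -lecR Re_norm; exact: opnorm_ge0.
pose p x := k * num_radius x.
have sp : sublinear p.
  have [nD nZ] := num_radius_sublinear; split=> [x y|t x t0].
    by rewrite /p -mulrDr ler_wpM2l.
  by rewrite /p nZ// mulrCA.
pose g (ab : elt A * elt A) : blin E E := val (star ab.2 * ab.2).
pose c (ab : elt A * elt A) : R := Re (phi (ab.1 * ab.2)) - k * Re `|ab.1| ^+ 2.
(* [g] and [c] are quadratic in the pair, so multiplying them by t means multiplying both components
   by the square root of t. *)
pose sc (t : R) (ab : elt A * elt A) := ((Num.sqrt t)%:C *: ab.1, (Num.sqrt t)%:C *: ab.2).
have starZ (t : R) b : star (t%:C *: b) = t%:C *: star b.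
  by rewrite elt_starZ conjcC.
have starsq (t : R) b : star (t%:C *: b) * (t%:C *: b) = (t ^+ 2)%:C *: (star b * b).
  by rewrite starZ elt_scalerMl elt_scalerMr scalerA -rmorphM.
have normt (t : R) a : Re `|t%:C *: a| = `|t| * Re `|a|.
  by rewrite normrZ normC Re_mulC.
have [f [fl fp fc]] : exists f, [/\ real_linear f, forall x, f x <= p x & forall i, c i <= f (g i)].
  apply: (linear_sandwich (sc := sc) sp) => [s|t ab t0]; last first.
    pose s := Num.sqrt t; have s2 : s ^+ 2 = t by exact: sqr_sqrtr.
    split.
      transitivity (val (star (s%:C *: ab.2) * (s%:C *: ab.2))); first by [].
      by rewrite starsq s2.
    transitivity (Re (phi ((s%:C *: ab.1) * (s%:C *: ab.2))) - k * Re `|s%:C *: ab.1| ^+ 2); first by [].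
    rewrite elt_scalerMl elt_scalerMr scalerA -rmorphM -expr2 s2.
    rewrite linearZZ normt exprMn real_normK ?num_real// s2 [RHS]mulrBr.
    by congr (_ - _); [exact: Re_mulC|rewrite mulrCA].
  rewrite /c sumrB -mulr_sumr lerBlDl.
  have -> : \sum_(i <- s) Re (phi (i.1 * i.2)) = Re (phi (\sum_(i <- s) i.1 * i.2)).
    by rewrite linear_sum raddf_sum.
  rewrite /p -mulrDr.
  apply: Re_le_norm; apply: (@le_trans _ _ (`|phi| * `|\sum_(i <- s) i.1 * i.2|)).
    exact: (opnormP phi _).
  rewrite -Re_normM lecR.
  have := norm_sum_mul_le s; rewrite -/g => h.
  apply: le_trans (ler_wpM2l _ h) _; first by rewrite -lecR Re_norm; exact: opnorm_ge0.
  by rewrite /k mulrAC mulrA.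
have f0 b : 0 <= f (star b * b : elt A).
  have h : Re (phi (0 * b)) - k * Re `|0 : elt A| ^+ 2 <= f (star b * b : elt A) := fc (0, b).
  by move: h; rewrite mul0r linear0 normr0 raddf0 expr0n mulr0 subr0.
exists f, k; split=> //.
  move=> b; apply: le_trans (fp _) _; rewrite ler_wpM2l//.
  apply: num_radius_le => v v1; rewrite inner_star_sqr.
  rewrite ler_sqr ?nnegrE; [|exact: Re_norm_ge0|exact: Re_norm_ge0].
  rewrite -lecR !Re_norm.
  by apply: le_trans (opnormP (val b) v) _; rewrite ler_piMr ?opnorm_ge0.
move=> a b; have -> : 4 * k * Re `|a| ^+ 2 * f (star b * b : elt A) = 
   4 * (k * Re `|a| ^+ 2 * f (star b * b : elt A)) by rewrite !mulrA.
set X := Re (phi _).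
(* Replacing b by t b in the constraint gives a quadratic polynomial in t; its middle coefficient is
   X rather than 2 X, whence the 4. *)
suff h : forall t, 0 <= k * Re `|a| ^+ 2 + 2 * t * (- X / 2) + t ^+ 2 * f (star b * b : elt A).
  have := quadratic_nonneg_discr (f0 b) h; rewrite expr_div_n sqrrN ler_pdivrMr ?exprn_gt0//.
  by rewrite [leRHS]mulrC -natrX.
move=> t.
have : Re (phi (a * (t%:C *: b))) - k * Re `|a| ^+ 2 <=
  f (star (t%:C *: b) * (t%:C *: b) : elt A) := fc (a, t%:C *: b).
rewrite starsq elt_scalerMr linearZZ.
have -> : Re (t%:C *: phi (a * b)) = t * X by exact: Re_mulC.
rewrite (_ : elt_val ((t ^+ 2)%:C *: (star b * b)) = (t ^+ 2)%:C *: elt_val (star b * b))// fl.2.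
by set Y := f _; set Z := k * _; move: Y Z => Y Z; lra.
Qed.
End factorization.

Section regularity.
Context {R : realType} {E : complexHilbertType R} {A : starSubalg E}.
Local Notation Re := (@complex.Re R).
Local Notation A' := (dual_space (elt A)).
Local Notation A'' := (bidual (elt A)).
Implicit Types (a b c : elt A) (phi psi : A') (xi eta : A'').

(* b |-> psi (a b) is dominated by a Hilbertian seminorm, uniformly in |a| <= 1. *)
Lemma functional_dominated psi : exists (beta : elt A -> elt A -> R) (C : R),
  [/\ forall z, real_linear (beta^~ z), forall x y, beta x y = beta y x,
      forall x, 0 <= beta x x,
      forall (u : R[i]) x, `|u| = 1 -> beta (u *: x) (u *: x) = beta x x &
  [/\ 0 <= C, forall x, Num.sqrt (beta x x) <= C * Re `|x| &
      forall a b, `|psi (a * b)| <= (C * Re `|a| * Num.sqrt (beta b b))%:C]].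
Proof.
have [f [K [[fD fZ] K0 f0 fK fpsi]]] := functional_factor psi.
have feD x y : f (x + y : elt A) = f x + f y by exact: (fD (val x)).
have feZ (t : R) x : f (t%:C *: x : elt A) = t * f x by exact: (fZ t (val x)).
(* Symmetrized, because f is only real linear and need not agree on c^* b and its adjoint. *)
pose beta b c := (f (star c * b : elt A) + f (star b * c : elt A)) / 2.
have betaE b : beta b b = f (star b * b : elt A).
  by rewrite /beta; move: (f _) => Y; field.
have betaU (u : R[i]) x : `|u| = 1 -> beta (u *: x) (u *: x) = beta x x.
  move=> u1; rewrite !betaE elt_starZ elt_scalerMl elt_scalerMr scalerA.
  by rewrite [_ * u]mulrC -sqr_normc u1 expr1n scale1r.
exists beta, (2 * Num.sqrt K); split=> //.
- move=> z; split=> [x y|t x]; rewrite /beta.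
    rewrite mulrDr elt_star_add.
    rewrite [(star x + star y) * z]mulrDl !feD -mulrDl; congr (_ / _).
    by rewrite addrACA.
  rewrite elt_starZ conjcC elt_scalerMl elt_scalerMr !feZ -mulrDr.
  by rewrite mulrA.
- by move=> x y; rewrite /beta addrC.
- by move=> x; rewrite betaE.
have s0 : 0 <= 2 * Num.sqrt K by rewrite mulr_ge0 ?sqrtr_ge0.
split=> // [x|a b].
  have h : beta x x <= (2 * Num.sqrt K * Re `|x|) ^+ 2.
    rewrite betaE; apply: le_trans (fK x) _.
    rewrite !exprMn sqr_sqrtr// -mulrA [leRHS]mulrC ler_peMr ?mulr_ge0 ?exprn_ge0 ?Re_norm_ge0//.
    by rewrite -natrX ler1n.
  apply: le_trans (ler_wsqrtr h) _; rewrite sqrtr_sqr ger0_norm//.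
  by rewrite mulr_ge0 ?Re_norm_ge0.
apply: norm_le_Re => u u1.
have -> : u * psi (a * b) = psi ((u *: a) * b).
  by rewrite elt_scalerMl linearZZ.
apply: le_trans (ler_norm _) _; apply: le_sqrt_mul; rewrite ?betaE//.
  by rewrite mulr_ge0 ?Re_norm_ge0.
apply: le_trans (fpsi _ _) _; rewrite ler_wpM2r//.
by rewrite normrZ u1 mul1r !exprMn sqr_sqrtr// -natrX.
Qed.

(** The two sides are the first and the second Arens product of xi and eta at psi. With e an
    approximation of eta for the Hilbertian seminorm that dominates psi (a b), both are close to xi
    (h e). *)
Lemma arens_exchange xi eta psi (S : A') (h : elt A -> A') :
  (forall a b, h b a = psi (a * b)) -> (forall b, S b = xi (h b)) ->
  xi (bidual_act eta psi) = eta S.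
Proof.
move=> hE SE.
have [beta [C [bl bC b0 bU [C0 bK psiC]]]] := functional_dominated psi.
pose N := Re `|xi|; have N0 : 0 <= N by exact: Re_norm_ge0.
have NE : `|xi| = N%:C by rewrite Re_norm.
apply/eqP; rewrite -subr_eq0 -normr_le0; apply/ler_addgt0Pl => d d0; rewrite addr0.
pose M := N * C + N * C.
have M0 : 0 <= M by rewrite /M addr_ge0// mulr_ge0.
have dr : 0 < Re d by rewrite -ltcR -ReC// ltW.
have M1 : 0 < M + 1 by rewrite ltr_wpDl.
pose e1 := Re d / (M + 1).
have e10 : 0 < e1 by rewrite divr_gt0.
have [e He] := bidual_approx bl bC b0 bU bK C0 eta e10.
have h1 : `|bidual_act eta psi - h e| <= (C * e1)%:C.
  apply: opnorm_le => a a1.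
  have -> : (bidual_act eta psi - h e) a = eta (dual_mul psi a) - dual_mul psi a e.
    by rewrite (_ : (bidual_act eta psi - h e) a = bidual_act eta psi a - h e a)// hE.
  have Ca0 : 0 <= C * Re `|a| by rewrite mulr_ge0 ?Re_norm_ge0.
  apply: le_trans (He (dual_mul psi a) _ Ca0 (psiC a)) _.
  rewrite lecR ler_pM2r// ler_piMr// -lecR Re_norm.
  exact: a1.
have h2 : `|xi (bidual_act eta psi) - xi (h e)| <= (N * (C * e1))%:C.
  have -> : xi (bidual_act eta psi) - xi (h e) = xi (bidual_act eta psi - h e).
    by rewrite linearB.
  apply: le_trans (opnormP xi _) _.
  have -> : (N * (C * e1))%:C = `|xi| * (C * e1)%:C by rewrite {1}NE -rmorphM.
  by apply: ler_wpM2l; [exact: opnorm_ge0|exact: h1].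
have NC0 : 0 <= N * C by rewrite mulr_ge0.
have SD x : `|S x| <= (N * C * Num.sqrt (beta x x))%:C.
  rewrite SE; apply: le_trans (opnormP xi _) _.
  have -> : (N * C * Num.sqrt (beta x x))%:C = `|xi| * (C * Num.sqrt (beta x x))%:C.
    by rewrite {1}NE -rmorphM mulrA.
  apply: ler_wpM2l; first exact: opnorm_ge0.
  apply: opnorm_le => a a1; rewrite hE; apply: le_trans (psiC a x) _.
  rewrite lecR -mulrA ler_wpM2l// ler_piMl ?sqrtr_ge0//.
  by rewrite -lecR Re_norm; exact: a1.
have h3 := He S _ NC0 SD.
have -> : xi (bidual_act eta psi) - eta S =
   (xi (bidual_act eta psi) - xi (h e)) - (eta S - S e) by rewrite SE opprB addrA subrK.
apply: le_trans (ler_normB _ _) _; apply: le_trans (lerD h2 h3) _.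
rewrite -rmorphD (ReC (ltW d0)) lecR mulrA -mulrDl -/M /e1 mulrCA ler_piMr ?(ltW dr)//.
by rewrite ler_pdivrMr// mul1r lerDl.
Qed.

Lemma bidual_starM xi eta : star (xi * eta) = star eta * star xi.
Proof.
apply: blin_ext => phi.
pose h b := dual_star (dual_mul phi (star b)).
have hE a b : h b a = dual_star phi (a * b).
  rewrite /= /dual_star_fun /= /dual_mul_fun; congr ((phi _)^*)%C.
  by apply/val_inj; exact/esym/starM.
have := @arens_exchange xi eta (dual_star phi) (dual_star (bidual_act (star xi) phi)) h hE.
move=> /(_ _) h1.
transitivity ((xi (bidual_act eta (dual_star phi)))^*)%C; first by [].
rewrite h1// => b.
transitivity ((((xi (h b))^*)^*)%C); first by [].
by rewrite conjcK.
Qed.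
End regularity.

(** * Positivity of matrices over the second dual *)

Section bidual_algebra.
Context {R : realType} {E : complexHilbertType R} {A : starSubalg E}.
Local Notation A' := (dual_space (elt A)).
Local Notation A'' := (bidual (elt A)).
Implicit Types (phi : A') (xi eta : A'').

Lemma bidualZl (k : R[i]) xi eta : (k *: xi) * eta = k *: (xi * eta).
Proof. exact: blin_ext. Qed.

Lemma bidualZr (k : R[i]) xi eta : xi * (k *: eta) = k *: (xi * eta).
Proof.
apply: blin_ext => phi.
have E1 : bidual_act (k *: eta) phi = k *: bidual_act eta phi by exact: blin_ext.
transitivity (xi (bidual_act (k *: eta) phi)); first by [].
by rewrite E1 linearZZ.
Qed.

Lemma bidual_normM xi eta : `|xi * eta| <= `|xi| * `|eta|.
Proof.
apply: mk_blin_norm; apply: mulr_ge0; exact: opnorm_ge0.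
Qed.

Lemma bidual_starD (k : R[i]) xi eta : star (k *: xi + eta) = (k^*)%C *: star xi + star eta.
Proof.
apply: blin_ext => phi.
transitivity (((k * xi (dual_star phi) + eta (dual_star phi))^*)%C); first by [].
by rewrite rmorphD rmorphM.
Qed.

Lemma bidual_star_add xi eta : star (xi + eta) = star xi + star eta.
Proof. by have := bidual_starD 1 xi eta; rewrite rmorph1 !scale1r. Qed.

Lemma bidual_star0 : star (0 : A'') = 0.
Proof.
have := bidual_star_add 0 0; rewrite addr0 => /esym/eqP.
by rewrite -subr_eq0 addrK => /eqP.
Qed.

Lemma bidual_starZ (k : R[i]) xi : star (k *: xi) = (k^*)%C *: star xi.
Proof. by have := bidual_starD k xi 0; rewrite bidual_star0 !addr0. Qed.

Lemma bidual_norm_star xi : `|star xi| <= `|xi|.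
Proof. apply: mk_blin_norm; exact: opnorm_ge0. Qed.

Lemma bidual_star1 : star (1 : A'') = 1.
Proof.
apply: blin_ext => phi.
transitivity ((((phi (star 1))^*)^*)%C); first by [].
rewrite conjcK (_ : star (1 : elt A) = 1)//.
by apply/val_inj; exact: star1.
Qed.

Lemma bidual_complete : seq_complete A''.
Proof. exact/blin_seq_complete/seq_complete_scalar. Qed.

Lemma seq_lim_bidualM (u v : nat -> A'') xi eta :
  seq_lim u xi -> seq_lim v eta -> seq_lim (fun n => u n * v n) (xi * eta).
Proof.
move=> ul vl e e0; pose K := 1 + `|eta| + `|xi|.
have K0 : 0 < K by rewrite /K -addrA ltr_pwDl// addr_ge0//; exact: opnorm_ge0.
have eK : 0 < e + K by rewrite addr_gt0.
pose d := e / (e + K); have d0 : 0 < d by rewrite divr_gt0.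
have d1 : d <= 1 by rewrite ler_pdivrMr// mul1r lerDl ltW.
have dK : d * K <= e.
  by rewrite mulrAC ler_pdivrMr// ler_pM2l// lerDr ltW.
have [N1 h1] := ul _ d0; have [N2 h2] := vl _ d0.
exists (maxn N1 N2) => n; rewrite geq_max => /andP[/h1 un /h2 vn].
have -> : u n * v n - xi * eta = (u n - xi) * (v n - eta) + (u n - xi) * eta + xi * (v n - eta).
  by rewrite -mulrDr subrK mulrBl mulrBr addrA subrK.
have b1 : `|(u n - xi) * (v n - eta)| <= d.
  apply: (@le_trans _ _ (`|u n - xi| * `|v n - eta|)); first exact: bidual_normM.
  apply: (@le_trans _ _ (d * 1)); last by rewrite mulr1.
  apply: ler_pM; [exact: opnorm_ge0|exact: opnorm_ge0|exact: un|exact: le_trans vn d1].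
have b2 : `|(u n - xi) * eta| <= d * `|eta|.
  apply: (@le_trans _ _ (`|u n - xi| * `|eta|)); first exact: bidual_normM.
  by apply: ler_wpM2r; [exact: opnorm_ge0|exact: un].
have b3 : `|xi * (v n - eta)| <= d * `|xi|.
  rewrite [leRHS]mulrC.
  apply: (@le_trans _ _ (`|xi| * `|v n - eta|)); first exact: bidual_normM.
  by apply: ler_wpM2l; [exact: opnorm_ge0|exact: vn].
move: b1 b2 b3; set x := _ * _; set y := _ * _; set z := _ * _ => b1 b2 b3.
apply: le_trans (ler_normD _ _) _; apply: le_trans (lerD (ler_normD _ _) (lexx _)) _.
apply: le_trans (lerD (lerD b1 b2) b3) _.
by apply: le_trans dK; rewrite /K !mulrDr mulr1.
Qed.

Lemma seq_lim_bidual_star (u : nat -> A'') xi :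
  seq_lim u xi -> seq_lim (fun n => star (u n)) (star xi).
Proof.
move=> ul e /ul[N h]; exists N => n /h hn.
have -> : star (u n) - star xi = star (u n - xi).
  rewrite [u n - xi]addrC -[- xi]scaleN1r bidual_starD.
  by rewrite rmorphN rmorph1 scaleN1r addrC.
exact: le_trans (bidual_norm_star _) hn.
Qed.
End bidual_algebra.

Section matrix_norm.
Context {R : realType} {E : complexHilbertType R} {A : starSubalg E} {n : nat}.
Local Notation A' := (dual_space (elt A)).
Local Notation A'' := (bidual (elt A)).
Implicit Types (a b : 'M[elt A]_n) (phi : 'I_n -> 'I_n -> A') (X Y : 'M[A'']_n).

Definition op_bound a (M : R) := forall v : 'I_n -> E,
  \sum_i `|\sum_j a i j (v j)| ^+ 2 <= (M ^+ 2)%:C * \sum_j `|v j| ^+ 2.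
Definition dual_mx_bound phi (D : R) := forall a (M : R), 0 <= M -> op_bound a M ->
  `|\sum_i \sum_j phi i j (a i j)| <= (D * M)%:C.
(* The norm of M_n(A)^**, through the duality of M_n(A) with matrices over A^*. *)
Definition bidual_mx_bound X (N : R) := forall phi (D : R), 0 <= D -> dual_mx_bound phi D ->
  `|\sum_i \sum_j X i j (phi i j)| <= (N * D)%:C.

Lemma op_boundM a b M N : 0 <= M -> 0 <= N -> op_bound a M -> op_bound b N -> op_bound (a *m b) (M * N).
Proof.
move=> M0 N0 aM bN v.
have -> : \sum_i `|\sum_j (a *m b) i j (v j)| ^+ 2 =
    \sum_i `|\sum_k a i k (\sum_j b k j (v j))| ^+ 2.
  apply: eq_bigr => i _; congr (`|_| ^+ 2).
  transitivity (\sum_j \sum_k a i k (b k j (v j))).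
    apply: eq_bigr => j _; rewrite mxE.
    transitivity ((\sum_k val (a i k * b k j)) (v j)); last by rewrite blin_sumE.
    by congr (blin_fun _ _); rewrite -raddf_sum.
  by rewrite exchange_big; apply: eq_bigr => k _; rewrite linear_sum.
apply: le_trans (aM _) _; rewrite exprMn (_ : (M ^+ 2 * N ^+ 2)%:C = (M ^+ 2)%:C * (N ^+ 2)%:C); last by rewrite -rmorphM.
rewrite -mulrA.
by apply: ler_wpM2l; [rewrite lecR exprn_ge0|exact: bN].
Qed.

Lemma bidual_mx_boundD X Y M N : bidual_mx_bound X M -> bidual_mx_bound Y N ->
  bidual_mx_bound (X + Y) (M + N).
Proof.
move=> XM YN phi D D0 phiD.
have -> : \sum_i \sum_j (X + Y) i j (phi i j) =
   \sum_i \sum_j X i j (phi i j) + \sum_i \sum_j Y i j (phi i j).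
  rewrite -big_split; apply: eq_bigr => i _; rewrite -big_split; apply: eq_bigr => j _.
  by rewrite mxE.
apply: le_trans (ler_normD _ _) _; rewrite mulrDl (_ : (M * D + N * D)%:C = (M * D)%:C + (N * D)%:C); last by rewrite -rmorphD.
by apply: lerD; [exact: XM|exact: YN].
Qed.

Definition scale_mx (k : R[i]) X : 'M[A'']_n := map_mx (fun x => k *: x) X.

Lemma bidual_mx_boundZ (k : R) X M : 0 <= k -> bidual_mx_bound X M ->
  bidual_mx_bound (scale_mx k%:C X) (k * M).
Proof.
move=> k0 XM phi D D0 phiD.
have -> : \sum_i \sum_j (scale_mx k%:C X) i j (phi i j) = k%:C * \sum_i \sum_j X i j (phi i j).
  rewrite mulr_sumr; apply: eq_bigr => i _; rewrite mulr_sumr; apply: eq_bigr => j _.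
  by rewrite mxE.
rewrite normrM normC (ger0_norm k0) (_ : (k * M * D)%:C = k%:C * (M * D)%:C); last by rewrite -rmorphM mulrA.
by apply: ler_wpM2l; [rewrite lecR|exact: XM].
Qed.

Lemma bidual_mx_bound0 : bidual_mx_bound 0 0.
Proof.
move=> phi D D0 _; rewrite mul0r big1 ?normr0// => i _; rewrite big1// => j _.
by rewrite mxE.
Qed.

(** The Arens product unwinds one duality at a time: the bound on X leaves a test against a matrix a
    over A, the bound on Y a test against a matrix b, and the rest is submultiplicativity for a
    b. *)
Lemma bidual_mx_boundM X Y M N : 0 <= M -> 0 <= N ->
  bidual_mx_bound X M -> bidual_mx_bound Y N -> bidual_mx_bound (X *m Y) (M * N).
Proof.
move=> M0 N0 XM YN phi D D0 phiD.
pose psi i k := \sum_j bidual_act (Y k j) (phi i j).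
have -> : \sum_i \sum_j (X *m Y) i j (phi i j) = \sum_i \sum_k X i k (psi i k).
  apply: eq_bigr => i _.
  transitivity (\sum_j \sum_k X i k (bidual_act (Y k j) (phi i j))).
    by apply: eq_bigr => j _; rewrite mxE blin_sumE.
  by rewrite exchange_big; apply: eq_bigr => k _; rewrite linear_sum.
rewrite -mulrA; apply: XM; first by rewrite mulr_ge0.
move=> a K K0 aK.
pose chi k j := \sum_i dual_mul (phi i j) (a i k).
have -> : \sum_i \sum_k psi i k (a i k) = \sum_k \sum_j Y k j (chi k j).
  rewrite exchange_big; apply: eq_bigr => k _.
  transitivity (\sum_i \sum_j Y k j (dual_mul (phi i j) (a i k))).
    by apply: eq_bigr => i _; rewrite blin_sumE.
  by rewrite exchange_big; apply: eq_bigr => j _; rewrite linear_sum.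
rewrite -mulrA; apply: YN; first by rewrite mulr_ge0.
move=> b L L0 bL.
have -> : \sum_k \sum_j chi k j (b k j) = \sum_i \sum_j phi i j ((a *m b) i j).
  transitivity (\sum_k \sum_j \sum_i phi i j (a i k * b k j)).
    by apply: eq_bigr => k _; apply: eq_bigr => j _; rewrite blin_sumE.
  rewrite exchange_big; rewrite [RHS]exchange_big; apply: eq_bigr => j _.
  rewrite exchange_big; apply: eq_bigr => i _; rewrite mxE linear_sum.
  by [].
rewrite -mulrA; apply: phiD; first by rewrite mulr_ge0.
exact: op_boundM.
Qed.

Lemma op_bound_entry a M i j : 0 <= M -> op_bound a M -> `|a i j| <= M%:C.
Proof.
move=> M0 aM; apply: opnorm_le => v v1.
have Mv : `|a i j v| <= M%:C * `|v|.
  rewrite -ler_sqr ?nnegrE; last 2 first.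
  - exact: normr_ge0.
  - by apply: mulr_ge0; [rewrite lecR|exact: normr_ge0].
  have := aM (fun k => if k == j then v else 0).
  have -> : \sum_k `|if k == j then v else 0| ^+ 2 = `|v| ^+ 2.
    rewrite (bigD1 j)//= eqxx big1 ?addr0// => k /negbTE ->.
    by rewrite normr0 expr0n.
  rewrite exprMn -rmorphXn; apply: le_trans.
  rewrite (bigD1 i)//=.
  have -> : \sum_k a i k (if k == j then v else 0) = a i j v.
    rewrite (bigD1 j)//= eqxx big1 ?addr0// => k /negbTE ->.
    by rewrite linear0.
  by rewrite lerDl; apply: sumr_ge0 => k _; apply: exprn_ge0.
by apply: le_trans Mv _; apply: ler_piMr; rewrite ?lecR.
Qed.

Lemma bidual_mx_bound_entry X N i j : bidual_mx_bound X N -> `|X i j| <= N%:C.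
Proof.
move=> XN; apply: opnorm_le => phi phi1.
pose psi k l : A' := if (k == i) && (l == j) then phi else 0.
have sumE (T : 'I_n -> 'I_n -> R[i]) : (forall k l, ~~ ((k == i) && (l == j)) -> T k l = 0) ->
    \sum_k \sum_l T k l = T i j.
  move=> T0; rewrite (bigD1 i)//= (bigD1 j)//= big1 ?addr0 => [|l lj].
    rewrite big1 ?addr0// => k ki; rewrite big1// => l _.
    by rewrite T0// (negbTE ki).
  by rewrite T0// (negbTE lj) andbF.
have psi1 : dual_mx_bound psi 1.
  move=> a M M0 aM; rewrite sumE => [|k l h]; last by rewrite /psi (negbTE h).
  rewrite /psi !eqxx mul1r /=; apply: (@le_trans _ _ (`|phi| * `|a i j|)).
    exact: (opnormP phi).
  apply: (@le_trans _ _ `|a i j|); first by apply: ler_piMl; [exact: opnorm_ge0|exact: phi1].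
  exact: op_bound_entry.
have := XN psi 1 ler01 psi1; rewrite sumE => [|k l h].
  by rewrite /psi !eqxx mulr1.
by rewrite /psi (negbTE h) linear0.
Qed.
End matrix_norm.

Section matrix_sqrt.
Context {R : realType} {E : complexHilbertType R} {A : starSubalg E} {n : nat}.
Local Notation A'' := (bidual (elt A)).
Implicit Types (X Y Q : 'M[A'']_n).
Local Notation half := ((2^-1 : R)%:C).
Local Notation dag X := ((map_mx star X)^T).

Lemma scale_mxBr (k : R[i]) X Y : scale_mx k (X - Y) = scale_mx k X - scale_mx k Y.
Proof. by apply/matrixP => i j; rewrite !mxE scalerBr. Qed.

Lemma dagM X Y : dag (X *m Y) = dag Y *m dag X.
Proof.
apply/matrixP => i j; rewrite !mxE.
have starS (u : 'I_n -> A'') : star (\sum_k u k) = \sum_k star (u k).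
  exact: (big_morph (fun x : A'' => star x) bidual_star_add bidual_star0).
by rewrite starS; apply: eq_bigr => k _; rewrite bidual_starM !mxE.
Qed.

Fixpoint sqrt_mx Q m : 'M[A'']_n :=
  if m is m'.+1 then scale_mx half (Q + sqrt_mx Q m' *m sqrt_mx Q m') else 0.
Fixpoint sqrt_bound m : R :=
  if m is m'.+1 then 2^-1 * (1 + sqrt_bound m' * sqrt_bound m') else 0.

Lemma sqrt_bound01 m : 0 <= sqrt_bound m <= 1.
Proof.
elim: m => [|m /andP[h0 h1]]; first by rewrite lexx ler01.
by rewrite /=; apply/andP; split; nra.
Qed.

Lemma sqrt_mx_bound Q m : bidual_mx_bound Q 1 -> bidual_mx_bound (sqrt_mx Q m) (sqrt_bound m).
Proof.
move=> Q1; elim: m => [|m IH]; first exact: bidual_mx_bound0.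
have /andP[h0 h1] := sqrt_bound01 m.
apply: bidual_mx_boundZ; first by rewrite invr_ge0.
by apply: bidual_mx_boundD => //; exact: bidual_mx_boundM.
Qed.

Lemma sqrt_bound_mono m : sqrt_bound m <= sqrt_bound m.+1.
Proof.
elim: m => [|m IH]; first by have /andP[] := sqrt_bound01 1.
have /andP[h0 h1] := sqrt_bound01 m; have /andP[k0 k1] := sqrt_bound01 m.+1.
rewrite [sqrt_bound m.+2]/= [leLHS]/=; rewrite ler_pM2l ?invr_gt0// lerD2l.
exact: ler_pM.
Qed.

(** Since Y1^2 - Y^2 = Y1 (Y1 - Y) + (Y1 - Y) Y, the increments are dominated by those of the scalar
    recursion with Q = 1. That sequence is monotone and bounded, which gives the Cauchy property
    although at norm 1 there is no geometric rate. *)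
Lemma sqrt_mx_step Q m : bidual_mx_bound Q 1 ->
  bidual_mx_bound (sqrt_mx Q m.+1 - sqrt_mx Q m) (sqrt_bound m.+1 - sqrt_bound m).
Proof.
move=> Q1; elim: m => [|m IH]; first by rewrite !subr0; exact: sqrt_mx_bound.
set Y1 := sqrt_mx Q m.+1 in IH *; set Y := sqrt_mx Q m in IH.
set y1 := sqrt_bound m.+1 in IH *; set y := sqrt_bound m in IH.
have -> : sqrt_mx Q m.+2 - Y1 = scale_mx half (Y1 *m (Y1 - Y) + (Y1 - Y) *m Y).
  rewrite [sqrt_mx Q m.+2]/= -/Y1 {3}/Y1 /= -/Y -scale_mxBr; congr (scale_mx _ _).
  by rewrite mulmxBr mulmxBl opprD addrACA subrr add0r addrA subrK.
have -> : sqrt_bound m.+2 - y1 = 2^-1 * (y1 * (y1 - y) + (y1 - y) * y).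
  transitivity (2^-1 * (1 + y1 * y1) - 2^-1 * (1 + y * y)); first by [].
  by move: y1 y {IH} => y1 y; ring.
have /andP[h0 _] := sqrt_bound01 m; have /andP[k0 _] := sqrt_bound01 m.+1.
have d0 : 0 <= y1 - y by rewrite subr_ge0; exact: sqrt_bound_mono.
apply: bidual_mx_boundZ; first by rewrite invr_ge0.
by apply: bidual_mx_boundD; apply: bidual_mx_boundM => //; exact: sqrt_mx_bound.
Qed.

Lemma sqrt_mx_diff Q m k : bidual_mx_bound Q 1 ->
  bidual_mx_bound (sqrt_mx Q (m + k) - sqrt_mx Q m) (sqrt_bound (m + k) - sqrt_bound m).
Proof.
move=> Q1; elim: k => [|k IH]; first by rewrite addn0 !subrr; exact: bidual_mx_bound0.
rewrite addnS.
have := bidual_mx_boundD (sqrt_mx_step (m + k) Q1) IH.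
by rewrite !addrA !subrK.
Qed.

Lemma sqrt_bound_le m k : (m <= k)%N -> sqrt_bound m <= sqrt_bound k.
Proof.
move=> /subnK <-; elim: (k - m)%N => [|j IH]; first by rewrite add0n.
by rewrite addSn; exact: le_trans IH (sqrt_bound_mono _).
Qed.

Lemma sqrt_bound_cauchy (e : R) : 0 < e ->
  exists N, forall m k, (N <= m)%N -> (m <= k)%N -> sqrt_bound k - sqrt_bound m <= e.
Proof.
move=> e0; have hs : has_sup (range sqrt_bound).
  split; first by exists (sqrt_bound 0), 0%N.
  by exists 1 => _ [m _ <-]; have /andP[] := sqrt_bound01 m.
have [_ [N _ <-] hN] := sup_adherent e0 hs.
exists N => m k Nm mk.
have h1 := sqrt_bound_le Nm.
have h2 : sqrt_bound k <= sup (range sqrt_bound) by apply: ub_le_sup; [exact: hs.2|exists k].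
lra.
Qed.

Lemma sqrt_mx_lim Q : bidual_mx_bound Q 1 ->
  exists Y, forall i j, seq_lim (fun m => sqrt_mx Q m i j) (Y i j).
Proof.
move=> Q1.
have cy i j : cauchy_seq (fun m => sqrt_mx Q m i j).
  move=> e e0; have er : 0 < complex.Re e by rewrite -ltcR -ReC// ltW.
  have [N hN] := sqrt_bound_cauchy er.
  have key m k : (N <= m)%N -> (m <= k)%N -> `|sqrt_mx Q k i j - sqrt_mx Q m i j| <= e.
    move=> Nm mk; have := bidual_mx_bound_entry i j (sqrt_mx_diff m (k - m) Q1).
    rewrite subnKC// !mxE => /le_trans; apply.
    by rewrite (ReC (ltW e0)) lecR; exact: hN.
  exists N => m k Nm Nk; have [mk|/ltnW km] := leqP m k; last exact: key.
  by rewrite distrC; exact: key.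
have /choice[f fP] (ij : 'I_n * 'I_n) :
    exists l, seq_lim (fun m => sqrt_mx Q m ij.1 ij.2) l.
  exact: bidual_complete (cy ij.1 ij.2).
exists (\matrix_(i, j) f (i, j)) => i j; rewrite mxE; exact: fP (i, j).
Qed.

Lemma sqrt_mx_dag Q m : dag Q = Q -> dag (sqrt_mx Q m) = sqrt_mx Q m.
Proof.
move=> Qd; elim: m => [|m IH]; first by apply/matrixP => i j; rewrite !mxE bidual_star0.
have dh X : dag (scale_mx half X) = scale_mx half (dag X).
  by apply/matrixP => i j; rewrite !mxE bidual_starZ conjcC.
have dD X Y : dag (X + Y) = dag X + dag Y.
  by apply/matrixP => i j; rewrite !mxE bidual_star_add.
by rewrite /= dh dD dagM IH Qd.
Qed.

(* 1 - Q has a self-adjoint square root 1 - Y, where Y is the limit of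
   Y_(m+1) = (Q + Y_m^2) / 2; the same recursion for the norms stays below 1. *)
Lemma positive_mx_one_sub Q : dag Q = Q -> bidual_mx_bound Q 1 -> positive_mx (1%:M - Q).
Proof.
move=> Qd Q1; have [Y YP] := sqrt_mx_lim Q1.
have Yd : dag Y = Y.
  apply/matrixP => i j; rewrite !mxE.
  apply: (seq_lim_unique (seq_lim_bidual_star (YP j i))).
  rewrite (_ : (fun m => _) = (fun m => sqrt_mx Q m i j)); first exact: YP.
  by apply/funext => m; rewrite -[in RHS](sqrt_mx_dag m Qd) !mxE.
have YE : Q + Y *m Y = Y + Y.
  apply/matrixP => i j; rewrite !mxE.
  have l1 : seq_lim (fun m => \sum_k sqrt_mx Q m i k * sqrt_mx Q m k j) (\sum_k Y i k * Y k j).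
    by apply: seq_lim_sum => k; apply: seq_lim_bidualM.
  have l2 : seq_lim (fun m => sqrt_mx Q m.+1 i j) (Y i j).
    by move=> e /(YP i j)[N h]; exists N => m Nm; apply: h; exact: leqW.
  have cst (x : A'') : seq_lim (fun=> x) x.
    by move=> e e0; exists 0%N => m _; rewrite subrr normr0 ltW.
  have l3 := seq_lim_lin half l1 (seq_lim_scale half (cst (Q i j))).
  have -> : Y i j = half *: (\sum_k Y i k * Y k j) + half *: Q i j.
    have e4 : (fun m => sqrt_mx Q m.+1 i j) = (fun m =>
        half *: (\sum_k sqrt_mx Q m i k * sqrt_mx Q m k j) + half *: Q i j).
      apply/funext => m.
      have -> : sqrt_mx Q m.+1 = scale_mx half (Q + sqrt_mx Q m *m sqrt_mx Q m) by [].
      by rewrite /scale_mx mxE mxE [X in _ + X]mxE scalerDr addrC.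
    rewrite e4 in l2; exact: (seq_lim_unique l2 l3).
  rewrite -scalerDr -scalerDl -rmorphD (_ : 2^-1 + 2^-1 = 1 :> R); last by field.
  by rewrite rmorph1 scale1r addrC.
have d1Y : dag (1%:M - Y) = 1%:M - Y.
  rewrite -{2}Yd; apply/matrixP => i j; rewrite !mxE.
  rewrite -[- Y j i]scaleN1r addrC bidual_starD rmorphN rmorph1 scaleN1r addrC.
  congr (_ + _); rewrite eq_sym; case: eqP => _; first exact: bidual_star1.
  exact: bidual_star0.
exists (1%:M - Y); rewrite d1Y mulmxBl mul1mx mulmxBr mulmx1.
have -> : Q = Y + Y - Y *m Y by rewrite -YE addrK.
by rewrite !opprD !opprK !addrA.
Qed.

Lemma positive_mx_bidual (P : 'M[A'']_n) (K : R) : 0 < K -> dag P = P ->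
  bidual_mx_bound (1%:M - scale_mx (K^-1)%:C P) 1 -> positive_mx P.
Proof.
move=> K0 Pd Pb; set Q := 1%:M - _ in Pb.
have starZC (t : R) (x : A'') : star (t%:C *: x) = t%:C *: star x.
  by rewrite bidual_starZ conjcC.
have Qd : dag Q = Q.
  apply/matrixP => i j; rewrite !mxE -[in RHS]Pd !mxE.
  rewrite bidual_star_add -scaleN1r -(rmorph1 (@real_complex R)) -rmorphN !starZC rmorphN rmorph1 scaleN1r.
  congr (_ - _); rewrite eq_sym; case: eqP => _; first exact: bidual_star1.
  exact: bidual_star0.
have [N NE] := positive_mx_one_sub Qd Pb.
pose k := (Num.sqrt K)%:C; exists (scale_mx k N).
have -> : P = scale_mx K%:C (1%:M - Q).
  rewrite /Q opprB addrC subrK; apply/matrixP => i j; rewrite !mxE scalerA -rmorphM divff ?gt_eqF//.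
  by rewrite rmorph1 scale1r.
rewrite NE; apply/matrixP => i j; rewrite !mxE scaler_sumr; apply: eq_bigr => l _.
rewrite !mxE starZC bidualZl bidualZr scalerA -rmorphM -expr2 sqr_sqrtr//.
exact: ltW.
Qed.
End matrix_sqrt.

(** * Ultralimits *)

Section ultralimit.
Context {R : realType} (U : set_system nat) {UU : UltraFilter U}.
Local Notation C := R[i].
Implicit Types (z w : nat -> C) (l m : C).

Lemma Re_normC (a : C) : (complex.Re `|a|)%:C = `|a|. Proof. exact: (@Re_norm R (C^o)). Qed.

Definition ulim z l := forall e : R, 0 < e -> U [set n | `|z n - l| <= e%:C].

Lemma real_ulim_exists (x : nat -> R) (M : R) : (forall n, `|x n| <= M) ->
  exists l : R, forall e : R, 0 < e -> U [set n | `|x n - l| <= e].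
Proof.
move=> xM; pose S := [set c | U [set n | c <= x n]].
have xM' n : - M <= x n <= M by rewrite -ler_norml.
have hs : has_sup S.
  split.
    exists (- M); rewrite /S /= (_ : [set n | _] = setT); first exact: filterT.
    by apply/seteqP; split=> // n _ /=; have /andP[] := xM' n.
  exists M => c /= Sc; rewrite leNgt; apply/negP => Mc.
  have [n /= cn] := filter_ex Sc.
  by have /andP[_] := xM' n; rewrite leNgt (lt_le_trans Mc cn).
exists (sup S) => e e0.
have [c Sc hc] := sup_adherent e0 hs.
have hU : U [set n | ~ (sup S + e <= x n)].
  have [h|//] := in_ultra_setVsetC [set n | sup S + e <= x n] UU.
  by have := ub_le_sup hs.2 h; rewrite gerDl leNgt e0.
apply: filterS (filterI Sc hU) => n [/= cn /negP]; rewrite -ltNge => hn.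
by rewrite ler_norml; apply/andP; split; lra.
Qed.

Lemma ulim_exists z (M : R) : (forall n, `|z n| <= M%:C) -> exists l, ulim z l.
Proof.
move=> zM.
have reM n : `|complex.Re (z n)| <= M by rewrite -lecR; apply: le_trans (zM n); exact: normc_ge_Re.
have imM n : `|complex.Im (z n)| <= M.
  rewrite -lecR; apply: le_trans (zM n).
  by rewrite normc_def lecR -sqrtr_sqr ler_wsqrtr// lerDr sqr_ge0.
have [a ha] := real_ulim_exists reM; have [b hb] := real_ulim_exists imM.
exists (a +i* b) => e e0; have e2 : 0 < e / 2 by rewrite divr_gt0.
apply: filterS (filterI (ha _ e2) (hb _ e2)) => n [/= h1 h2].
have -> : z n - (a +i* b) = (complex.Re (z n) - a)%:C + 'i * (complex.Im (z n) - b)%:C.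
  by case: (z n) => x y; apply/eqP; rewrite eq_complex /=; apply/andP; split; apply/eqP; ring.
apply: le_trans (ler_normD _ _) _; rewrite normrM normCi mul1r !normC -rmorphD lecR.
lra.
Qed.

Lemma ulim_norm z l (M : R) : ulim z l -> (forall n, `|z n| <= M%:C) -> `|l| <= M%:C.
Proof.
move=> zl zM; rewrite -Re_normC lecR; apply/ler_addgt0Pr => e e0.
have [n /= hn] := filter_ex (zl e e0).
rewrite -lecR Re_normC rmorphD -[l](subrK (z n)) addrC /=.
apply: le_trans (ler_normD _ _) _; apply: lerD; first exact: zM.
by rewrite distrC.
Qed.

Lemma ulim_lin (a : C) z w l m : ulim z l -> ulim w m ->
  ulim (fun n => a * z n + w n) (a * l + m).
Proof.
move=> zl wm e e0; have e2 : 0 < e / 2 by rewrite divr_gt0.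
pose k := complex.Re `|a|; have k0 : 0 <= k by rewrite -lecR /k Re_normC; exact: normr_ge0.
have k1 : 0 < k + 1 by rewrite ltr_wpDl.
apply: filterS (filterI (zl _ (divr_gt0 e2 k1)) (wm _ e2)) => n [/= h1 h2].
rewrite opprD addrACA -mulrBr; apply: le_trans (ler_normD _ _) _.
rewrite normrM -[`|a|]Re_normC -/k.
apply: (@le_trans _ _ (k%:C * (e / 2 / (k + 1))%:C + (e / 2)%:C)).
  by apply: lerD; [apply: ler_wpM2l; [rewrite lecR|exact: h1]|exact: h2].
rewrite -rmorphM -rmorphD lecR [leRHS]splitr lerD2r mulrA ler_pdivrMr// mulrC.
by rewrite ler_pM2l// lerDl.
Qed.

Lemma ulim_unique z l m : ulim z l -> ulim z m -> l = m.
Proof.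
move=> zl zm; apply/eqP; rewrite -subr_eq0 -normr_le0.
have h := ulim_lin (-1) zm zl.
have := @ulim_norm _ _ 0 h; rewrite mulN1r addrC; apply => n.
by rewrite mulN1r addNr normr0.
Qed.

Lemma ulim_cst l : ulim (fun=> l) l.
Proof.
move=> e e0; rewrite (_ : [set n | _] = setT); first exact: filterT.
by apply/seteqP; split=> // n _ /=; rewrite subrr normr0 lecR ltW.
Qed.

Lemma ulim_sum I (s : seq I) (u : I -> nat -> C) (l : I -> C) :
  (forall i, ulim (u i) (l i)) -> ulim (fun n => \sum_(i <- s) u i n) (\sum_(i <- s) l i).
Proof.
move=> ul; elim: s => [|i s IH].
  rewrite big_nil (_ : (fun n => _) = fun=> 0); first exact: ulim_cst.
  by apply/funext => n; rewrite big_nil.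
rewrite big_cons (_ : (fun n => _) = fun n => 1 * u i n + \sum_(j <- s) u j n).
  by rewrite -[l i]mul1r; exact: ulim_lin.
by apply/funext => n; rewrite big_cons mul1r.
Qed.

Lemma ulim_conj z l : ulim z l -> ulim (fun n => ((z n)^*)%C) ((l^*)%C).
Proof.
by move=> zl e /zl; apply: filterS => n /=; rewrite -rmorphB normcJ.
Qed.
End ultralimit.

(** * Quadratic forms and norms of operator matrices *)

Section positive_operator_matrix.
Context {R : realType} {E : complexHilbertType R} {A : starSubalg E} {n : nat}.
Implicit Types (a : 'M[elt A]_n) (v w : 'I_n -> E).
Local Notation Re := (@complex.Re R).

Definition mx_apply a v (i : 'I_n) : E := \sum_j a i j (v j).
Definition vec_inner v w : R[i] := \sum_i inner (v i) (w i).

Lemma vec_innerE v : vec_inner v v = \sum_i `|v i| ^+ 2.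
Proof. by apply: eq_bigr => i _; rewrite inner_norm. Qed.

Lemma vec_inner_ge0 v : 0 <= vec_inner v v.
Proof. by rewrite vec_innerE; apply: sumr_ge0 => i _; exact: exprn_ge0. Qed.

(* Cauchy-Schwarz for the form of a, at v and a v. *)
Lemma op_bound_of_form a :
  (forall v, 0 <= vec_inner (mx_apply a v) v) ->
  (forall v, vec_inner (mx_apply a v) v <= vec_inner v v) ->
  (forall v w, vec_inner (mx_apply a v) w = vec_inner v (mx_apply a w)) ->
  op_bound a 1.
Proof.
move=> a0 a1 aH v; rewrite expr1n mul1r -vec_innerE.
pose w := mx_apply a v.
rewrite [leLHS](_ : _ = vec_inner w w); last by rewrite vec_innerE.
have reE u : 0 <= u -> exists2 x : R, u = x%:C & 0 <= x.
  by move=> u0; exists (Re u); [exact: ReC|rewrite -lecR -ReC].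
have [S SE S0] := reE _ (vec_inner_ge0 w).
have [X XE X0] := reE _ (vec_inner_ge0 v).
have [x xE x0] := reE _ (a0 v).
have [y yE y0] := reE _ (a0 w).
have h : S ^+ 2 <= x * y.
  apply: quadratic_nonneg_discr => // t.
  have := a0 (fun i => v i + t%:C *: w i).
  have -> : vec_inner (mx_apply a (fun i => v i + t%:C *: w i)) (fun i => v i + t%:C *: w i)
    = vec_inner (mx_apply a v) v + t%:C * (vec_inner w w + vec_inner (mx_apply a w) v)
       + (t%:C) ^+ 2 * vec_inner (mx_apply a w) w.
    rewrite /vec_inner !mulrDr !mulr_sumr -!big_split; apply: eq_bigr => i _.
    have -> : mx_apply a (fun i => v i + t%:C *: w i) i = w i + t%:C *: mx_apply a w i.
      rewrite /w /mx_apply scaler_sumr -big_split; apply: eq_bigr => j _.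
      by rewrite linearD linearZZ.
    by rewrite -/(w i) !innerDl !innerDr !innerZl !innerZr conjcC /=; ring.
  rewrite (aH w v) xE yE SE -!rmorphD -rmorphXn -!rmorphM -!rmorphD lecR.
  by congr (0 <= _); ring.
have yS : y <= S by rewrite -lecR -yE -SE.
have xX : x <= X by rewrite -lecR -xE -XE.
rewrite SE XE lecR.
have [->|Sn] := eqVneq S 0; first by [].
have Sp : 0 < S by rewrite lt_def Sn.
rewrite -(ler_pM2r Sp) -expr2; apply: le_trans h _.
exact: ler_pM.
Qed.

Lemma vec_inner_le a v (m : R) : 0 <= m -> (forall i j, `|a i j| <= m%:C) ->
  `|vec_inner (mx_apply a v) v| <= (n%:R * m)%:C * vec_inner v v.
Proof.
move=> m0 am; rewrite /vec_inner; apply: le_trans (ler_norm_sum _ _ _) _.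
apply: (@le_trans _ _ (\sum_i \sum_j (m / 2)%:C * (`|v i| ^+ 2 + `|v j| ^+ 2))).
  apply: ler_sum => i _; rewrite /mx_apply inner_suml.
  apply: le_trans (ler_norm_sum _ _ _) _; apply: ler_sum => j _.
  apply: le_trans (inner_le _ _) _.
  apply: (@le_trans _ _ (m%:C * `|v j| * `|v i|)).
    apply: ler_wpM2r => //; apply: le_trans (opnormP (val (a i j)) _) _.
    by apply: ler_wpM2r => //; exact: am.
  rewrite -[`|v i|]Re_norm -[`|v j|]Re_norm -!rmorphXn -!rmorphM -rmorphD -rmorphM lecR.
  have := mulr_ge0 m0 (sqr_ge0 (Re `|v i| - Re `|v j|)); rewrite sqrrB.
  by move: (Re `|v i|) (Re `|v j|) => x y; nra.
rewrite -/(vec_inner v v) vec_innerE.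
pose S : R[i] := \sum_i `|v i| ^+ 2; rewrite -/S.
have -> : \sum_i \sum_j (m / 2)%:C * (`|v i| ^+ 2 + `|v j| ^+ 2) = (m / 2)%:C * (S *+ n + S *+ n).
  have e i : \sum_j (m / 2)%:C * (`|v i| ^+ 2 + `|v j| ^+ 2) = (m / 2)%:C * (`|v i| ^+ 2 *+ n + S).
    by rewrite -mulr_sumr big_split /= sumr_const card_ord.
  under eq_bigr => i _ do rewrite e.
  by rewrite -mulr_sumr big_split /= sumrMnl sumr_const card_ord.
have -> : (m / 2)%:C = m%:C / 2 by rewrite rmorphM fmorphV rmorph_nat.
have -> : (n%:R * m)%:C = n%:R * m%:C by rewrite rmorphM rmorph_nat.
rewrite -[S *+ n]mulr_natl (_ : m%:C / 2 * (n%:R * S + n%:R * S) = n%:R * m%:C * S)//.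
by field.
Qed.
End positive_operator_matrix.

Lemma term_le_sum (R : numDomainType) (I : finType) (f : I -> R) i :
  (forall j, 0 <= f j) -> f i <= \sum_j f j.
Proof. by move=> f0; rewrite (bigD1 i)//= lerDl sumr_ge0. Qed.

(** * The ultralimit of the maps into the second dual *)

Section ultralimit_map.
Context {R : realType} {E : complexHilbertType R} (A M : starSubalg E).
Hypothesis AM : A `<=` M.
Local Notation A' := (dual_space (elt A)).
Local Notation A'' := (bidual (elt A)).
Variable T : nat -> elt M -> elt A.
Hypotheses (Tlin : forall n, linear (T n))
  (T1 : forall n, T n 1 = 1)
  (Tstar : forall n x, T n (star x) = star (T n x))
  (Tcontr : forall n x, `|T n x| <= `|x|)
  (Tpos : forall n k (P : 'M[elt M]_k), positive_mx P ->
     forall v : 'I_k -> E, 0 <= vec_inner (mx_apply (map_mx (T n) P) v) v)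
  (Tcvg : forall a (e : R), 0 < e ->
     exists N, forall n, (N <= n)%N -> `|T n (elt_incl AM a) - a| <= e%:C).
Variable U : set_system nat.
Context {UU : UltraFilter U}.
Hypothesis Uoo : \oo `<=` U.

Lemma ulim_map_exists (x : elt M) : exists X : A'', forall phi : A', ulim U (fun n => phi (T n x)) (X phi).
Proof.
have bd (phi : A') n : `|phi (T n x)| <= (complex.Re `|phi| * complex.Re `|x|)%:C.
  rewrite Re_normM; apply: (@le_trans _ _ (`|phi| * `|T n x|)); first exact: (opnormP phi _).
  by apply: ler_wpM2l; [exact: opnorm_ge0|exact: Tcontr].
have /choice[f fP] (phi : A') : exists l, ulim U (fun n => phi (T n x)) l.
  exact: (ulim_exists (bd phi)).
have lf : linear (f : A' -> R[i]^o).
  move=> k phi psi; apply: (ulim_unique (fP _)).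
  exact: (ulim_lin k (fP phi) (fP psi)).
have bf phi : `|(f : A' -> R[i]^o) phi| <= `|x| * `|phi|.
  by rewrite mulrC -Re_normM; exact: (ulim_norm (fP phi) (bd phi)).
by exists (mk_blin lf bf).
Qed.

Definition ulim_map (x : elt M) : A'' := sval (cid (ulim_map_exists x)).

Lemma ulim_mapP x (phi : A') : ulim U (fun n => phi (T n x)) (ulim_map x phi).
Proof. by rewrite /ulim_map; case: cid => X /=. Qed.

Lemma ulim_map_linear : linear ulim_map.
Proof.
move=> k x y; apply: blin_ext => phi; apply: (ulim_unique (ulim_mapP _ phi)).
rewrite (_ : (fun n => _) = fun n => k * phi (T n x) + phi (T n y)).
  exact: (ulim_lin k (ulim_mapP x phi) (ulim_mapP y phi)).
by apply/funext => n; rewrite Tlin linearP.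
Qed.

HB.instance Definition _ := GRing.isLinear.Build R[i] (elt M) A'' *:%R ulim_map
  ulim_map_linear.

Lemma ulim_map1 : ulim_map 1 = 1.
Proof.
apply: blin_ext => phi; apply: (ulim_unique (ulim_mapP _ phi)).
rewrite (_ : (fun n => _) = fun=> phi 1); first exact: ulim_cst.
by apply/funext => n; rewrite T1.
Qed.

Lemma ulim_map_star x : ulim_map (star x) = star (ulim_map x).
Proof.
apply: blin_ext => phi; apply: (ulim_unique (ulim_mapP _ phi)).
rewrite (_ : (fun n => _) = fun n => ((dual_star phi (T n x))^*)%C).
  exact: (ulim_conj (ulim_mapP x (dual_star phi))).
apply/funext => n; rewrite Tstar.
by transitivity (((phi (star (T n x)))^*)^*)%C; [rewrite conjcK|by []].
Qed.

Lemma ulim_map_incl a : ulim_map (elt_incl AM a) = bidual_embed a.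
Proof.
apply: blin_ext => phi; apply: (ulim_unique (ulim_mapP _ phi)) => e e0.
pose p := complex.Re `|phi|; have p0 : 0 <= p by exact: Re_norm_ge0.
have p1 : 0 < p + 1 by rewrite ltr_wpDl.
have [N h] := Tcvg a (divr_gt0 e0 p1).
apply: Uoo; exists N => // n /= /h hn.
have -> : phi (T n (elt_incl AM a)) - embed_fun a phi = phi (T n (elt_incl AM a) - a).
  by rewrite linearB.
apply: (@le_trans _ _ (`|phi| * `|T n (elt_incl AM a) - a|)); first exact: (opnormP phi _).
apply: (@le_trans _ _ (`|phi| * (e / (p + 1))%:C)).
  by apply: ler_wpM2l; [exact: opnorm_ge0|exact: hn].
rewrite -[`|phi|]Re_norm -/p -rmorphM lecR mulrCA ler_piMr ?(ltW e0)//.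
by rewrite ler_pdivrMr// mul1r lerDl.
Qed.

Lemma positive_mx_star k (P : 'M[elt M]_k) : positive_mx P -> forall i j, star (P j i) = P i j.
Proof.
move=> [N ->] i j; rewrite !mxE.
have starS (u : 'I_k -> elt M) : star (\sum_l u l) = \sum_l star (u l).
  exact: (big_morph (fun x : elt M => star x) (@elt_star_add _ _ M) (@elt_star0 _ _ M)).
rewrite starS; apply: eq_bigr => l _; rewrite !mxE.
by apply/val_inj; rewrite /= starM starK.
Qed.

(** For each n, positivity of T_n and the bound by K put 1 - T_n(P) / K between 0 and 1, so its
    operator norm is at most 1. Tested against a fixed matrix of functionals, this bound passes to
    the ultralimit. *)
Lemma ulim_map_cp : completely_positive ulim_map.
Proof.
move=> k P Ppos; have Pstar := positive_mx_star Ppos.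
pose m := \sum_i \sum_j complex.Re `|P i j|.
have m0 : 0 <= m by apply: sumr_ge0 => i _; apply: sumr_ge0 => j _; exact: Re_norm_ge0.
have Pm i j : `|P i j| <= m%:C.
  rewrite -Re_norm lecR /m.
  apply: (le_trans (term_le_sum j (fun l => Re_norm_ge0 (P i l)))).
  apply: (@term_le_sum _ _ (fun i => \sum_l complex.Re `|P i l|)) => i'.
  by apply: sumr_ge0 => l _; exact: Re_norm_ge0.
(* k m bounds the quadratic form of a k-by-k matrix with entries of norm at most m; the 1 keeps K
   invertible when P = 0. *)
pose K := k%:R * m + 1; have K0 : 0 < K by rewrite ltr_wpDl// mulr_ge0.
have KV0 : 0 <= K^-1 by rewrite invr_ge0 ltW.
apply: (positive_mx_bidual K0).
  by apply/matrixP => i j; rewrite !mxE -ulim_map_star Pstar.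
move=> phi D D0 phiD.
pose Q n : 'M[elt A]_k := 1%:M - map_mx (fun x => (K^-1)%:C *: x) (map_mx (T n) P).
have QE n v i : mx_apply (Q n) v i = v i - (K^-1)%:C *: mx_apply (map_mx (T n) P) v i.
  rewrite /mx_apply.
  have -> : v i = \sum_j ((1%:M : 'M[elt A]_k) i j) (v j).
    rewrite (bigD1 i)//= big1 ?addr0; first by rewrite mxE eqxx.
    by move=> j ji; rewrite mxE eq_sym (negbTE ji).
  by rewrite scaler_sumr -sumrB; apply: eq_bigr => j _; rewrite !mxE.
have QV n v w : vec_inner (mx_apply (Q n) v) w =
    vec_inner v w - (K^-1)%:C * vec_inner (mx_apply (map_mx (T n) P) v) w.
  rewrite /vec_inner mulr_sumr -sumrB; apply: eq_bigr => i _.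
  by rewrite QE innerDl innerNl innerZl.
have Q1 n : op_bound (Q n) 1.
  have tm i j : `|(map_mx (T n) P) i j| <= m%:C.
    by rewrite mxE; apply: le_trans (Tcontr _ _) (Pm _ _).
  apply: op_bound_of_form => [v|v|v w].
  - rewrite QV subr_ge0.
    apply: (@le_trans _ _ ((K^-1)%:C * (K%:C * vec_inner v v))); last first.
      by rewrite mulrA -rmorphM mulVf ?gt_eqF// rmorph1 mul1r.
    apply: ler_wpM2l; first by rewrite lecR.
    rewrite -[leLHS]ger0_norm; last exact: Tpos.
    apply: le_trans (vec_inner_le v m0 tm) _; apply: ler_wpM2r; first exact: vec_inner_ge0.
    by rewrite lecR lerDl.
  - by rewrite QV gerBl mulr_ge0 ?lecR//; exact: Tpos.
  rewrite QV; transitivity (vec_inner v w - (K^-1)%:C * vec_inner v (mx_apply (map_mx (T n) P) w)).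
    congr (_ - _ * _); rewrite /vec_inner /mx_apply.
    under eq_bigr => i _ do rewrite inner_suml.
    under [RHS]eq_bigr => i _ do rewrite inner_sumr.
    rewrite exchange_big; apply: eq_bigr => i _; apply: eq_bigr => j _.
    by rewrite starP !mxE -(Pstar i j) Tstar.
  rewrite /vec_inner mulr_sumr -sumrB; apply: eq_bigr => i _.
  by rewrite QE innerDr innerNr innerZr conjcC.
have lims : ulim U (fun n => \sum_i \sum_j phi i j (Q n i j))
   (\sum_i \sum_j (1%:M - scale_mx (K^-1)%:C (map_mx ulim_map P)) i j (phi i j)).
  apply: ulim_sum => i; apply: ulim_sum => j; rewrite !mxE.
  pose d : elt A := (1%:M : 'M[elt A]_k) i j.
  rewrite (_ : (fun n => _) = fun n => - (K^-1)%:C * phi i j (T n (P i j)) + phi i j d); last first.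
    apply/funext => n; have -> : Q n i j = d - (K^-1)%:C *: T n (P i j) by rewrite /d !mxE.
    by rewrite linearB linearZZ addrC mulNr.
  rewrite [X in ulim _ _ X](_ : _ = - (K^-1)%:C * ulim_map (P i j) (phi i j) + phi i j d).
    exact: (ulim_lin _ (ulim_mapP (P i j) (phi i j)) (ulim_cst _)).
  transitivity (((i == j)%:R : A'') (phi i j) - (K^-1)%:C * ulim_map (P i j) (phi i j)); first by [].
  rewrite [RHS]addrC mulNr /d !mxE; congr (_ - _).
  by case: eqP => // _; rewrite mulr0n linear0.
rewrite mul1r -[D]mulr1.
by apply: (ulim_norm lims) => n; exact: phiD.
Qed.

Lemma weakly_cp_of_ultralimit : weakly_cp_complemented AM.
Proof.
exists ulim_map; split; [exact: ulim_map1|exact: ulim_map_cp|exact: ulim_map_incl].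
Qed.
End ultralimit_map.

Theorem lemma3p5 (R : realType) (H : realHilbertType R) (q : R)
    (hq : -1 < q < 1) (F : qFock H q) :
  weakly_cp_complemented (C_q_sub_Gamma_q F).
Proof.
have q1 : `|q| < 1 by rewrite ltr_norml.
pose r n : R := 1 - n.+2%:R^-1.
have rr n : 0 <= r n < 1.
  have h : 0 < (n.+2%:R^-1 : R) <= 1 by rewrite invr_gt0 ltr0n /= invf_le1 ?ler1n.
  by move/andP: h => [h1 h2]; rewrite /r subr_ge0 h2 gtrBl h1.
have r01 n : 0 <= r n <= 1 by have /andP[-> /ltW] := rr n.
have /choice[P PE] n : exists P : blin F (blin F F), @is_wick_map R H q F (r n) P by exact: (wick_map_exists F q1 (rr n)).
have inC n (x : elt (Gamma_q F)) : P n (val x (Om F)) \in in_subalg (C_q F).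
  by apply/in_subalgP; apply: C_q_wick_map (PE n).
have rc (x : elt (Gamma_q F)) : @rcomm R H q F (val x).
  by apply: (Gamma_q_rcomm q1); exact/in_subalgP/eltP.
pose T n x : elt (C_q F) := Elt (inC n x).
have Tlin n : linear (T n).
  move=> k x y; apply/val_inj.
  have e : val (T n (k *: x + y)) = P n (val (k *: x + y) (Om F)) by [].
  have e1 : val (k *: x + y) = k *: val x + val y by rewrite linearP.
  have e2 (a b : blin F F) : (k *: a + b) (Om F) = k *: a (Om F) + b (Om F) by [].
  by rewrite e e1 e2 linearP [RHS]linearP.
have T1 n : T n 1 = 1 by apply/val_inj; exact: wick_map1 (PE n).
have Tstar n x : T n (star x) = star (T n x).
  by apply/val_inj; exact: (wick_map_star q1 (r01 n) (PE n) (rc x)).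
have Tcontr n x : `|T n x| <= `|x|.
  exact: (wick_map_contractive q1 (r01 n) (PE n) (rc x)).
have Tpos n k (Q : 'M[elt (Gamma_q F)]_k) : positive_mx Q ->
    forall v : 'I_k -> F, 0 <= vec_inner (mx_apply (map_mx (T n) Q) v) v.
  move=> [N NE] v.
  (* The (i, j) entry of N^* N is the sum over l of (N l i)^* (N l j), so [wick_map_cp] is applied
     once to each row of N. *)
  have := sumr_ge0 (index_enum 'I_k) (fun l (_ : true) =>
    wick_map_cp q1 (r01 n) (PE n) v (fun i => rc (N l i))).
  congr (0 <= _).
  rewrite exchange_big; apply: eq_bigr => i _.
  rewrite /mx_apply inner_suml exchange_big; apply: eq_bigr => j _.
  rewrite -inner_suml -blin_sumE -linear_sum mxE; congr (inner (P n _ _) _).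
  rewrite NE mxE.
  have -> : val (\sum_l (map_mx star N)^T i l * N l j) = \sum_l star (val (N l i)) * val (N l j).
    by rewrite raddf_sum; apply: eq_bigr => l _; rewrite !mxE.
  by rewrite blin_sumE.
have Tcvg a (e : R) : 0 < e ->
    exists N, forall n, (N <= n)%N -> `|T n (elt_incl (C_q_sub_Gamma_q F) a) - a| <= e%:C.
  move=> e0; have e0' : 0 < e%:C by rewrite ltcR.
  have aC : carrier (C_q F) (val a) by exact/in_subalgP/eltP.
  have [d d0 dP] := wick_map_cvg q1 aC e0'.
  have [N hN] : exists N : nat, d^-1 < N%:R.
    by exists (Num.bound d^-1); apply: le_lt_trans (archi_boundP _); rewrite ?ler_norm ?invr_ge0 ?(ltW d0).
  exists N => n Nn; apply: (dP _ _ (r01 n) _ (PE n)).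
  rewrite /r opprB addrC subrK invf_ple ?posrE// ?ltr0n//.
  by apply: (le_trans (ltW hN)); rewrite ler_nat; lia.
have [U [UU Uoo]] := ultraFilterLemma (eventually_filter : ProperFilter \oo).
exact: (weakly_cp_of_ultralimit Tlin T1 Tstar Tcontr Tpos Tcvg Uoo).
Qed.
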